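(* Let $\Omega\subset\mathbb{R}^2$ be a bounded, connected, simply connected domain with piecewise smooth boundary. Let $\varphi:\Phi\to\Phi$ be the billiard map, $\nu$ the Liouville measure, and $\rho:\Phi\to\mathbb{R}$ the rotation number function. (1) Let $X\subset[0,1]$ be measurable and $1-X=\{1-x:x\in X\}$. Then $\rho^{-1}(X)$ and $\rho^{-1}(1-X)$ are measurable subsets of $\Phi$ and $\nu(\rho^{-1}(X))=\nu(\rho^{-1}(1-X))$. (2) $\displaystyle\frac{\int_\Phi\rho(z)\,d\nu(z)}{\nu(\Phi)}=\frac12.$ (3) If the billiard in $\Omega$ is ergodic (with respect to $\nu$), then $\rho(z)=1/2$ for $\nu$-almost all $z$.
   Context: $|\partial\Omega|$ denotes the perimeter of $\partial\Omega$, a simple closed curve. Choose a reference point on $\partial\Omega$, orient $\partial\Omega$ positively and parametrize it by arclength $s$, identifying $\partial\Omega$ with $\mathbb{R}/|\partial\Omega|\mathbb{Z}$. The phase space $\Phi$ consists of pairs $(s,\theta)$, $0\le s\le|\partial\Omega|$, $0\le\theta\le\pi$, where $\theta$ is the angle between a ray leaving the boundary point with coordinate $s$ into $\Omega$ and the positively oriented tangent there. The billiard map $\varphi$ sends $(s,\theta)$ to the phase point at the next boundary hit of that ray, with direction given by the law of reflection. The Liouville measure is $d\nu=\sin\theta\,ds\,d\theta$, $\nu(\Phi)=2|\partial\Omega|$. The footpoint $p(z)$ of $z=(s,\theta)$ is the boundary point with coordinate $s$. For $x_1,x_2\in\partial\Omega$ with coordinates $s_1,s_2\in[0,|\partial\Omega|)$,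 $\xi(x_1,x_2)$ is the unique $0\le\xi<|\partial\Omega|$ with $s_1+\xi=s_2$ or $s_1+\xi=s_2+|\partial\Omega|$; set $\xi(z)=\xi(p(z),p(\varphi(z)))$. The footpoint gain is $\upsilon(z)=\lim_{n\to\infty}\frac1n\sum_{k=0}^{n-1}\xi(\varphi^k(z))$ (defined where the limit exists, which is $\nu$-a.e.), and the rotation number function is $\rho(z)=\upsilon(z)/|\partial\Omega|$. *)

(* Defs.v *)
From mathcomp Require Import all_boot all_order all_algebra.
From mathcomp Require Import all_classical all_reals all_analysis.
Import Order.TTheory GRing.Theory Num.Theory numFieldNormedType.Exports.

Set Implicit Arguments.
Unset Strict Implicit.
Unset Printing Implicit Defensive.

Local Open Scope classical_set_scope.
Local Open Scope ring_scope.

Section Billiard.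
Variable R : realType.

Definition gamma (x y : R -> R) (s : R) : R * R := (x s, y s).

Definition smooth_fun (f : R -> R) : Prop :=
  forall (n : nat) (t : R), derivable (derive1n n f) t 1.

Definition simple_closed_curve (L : R) (x y : R -> R) : Prop :=
  [/\ 0 < L, continuous x, continuous y,
      (forall s, x (s + L) = x s /\ y (s + L) = y s) &
      (forall s t, 0 <= s < L -> 0 <= t < L -> gamma x y s = gamma x y t -> s = t)].

Definition piecewise_smooth_arclength (L : R) (x y : R -> R) : Prop :=
  exists (n : nat) (b : nat -> R),
    [/\ b 0%N = 0, b n = L,
        (forall i, (i < n)%N -> b i < b i.+1) &
        (forall i, (i < n)%N -> exists gx gy : R -> R,
           [/\ smooth_fun gx, smooth_fun gy &
               forall s, b i <= s <= b i.+1 ->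
                 [/\ gx s = x s, gy s = y s &
                     (derive1 gx s) ^+ 2 + (derive1 gy s) ^+ 2 = 1]])].

Definition bounded2 (Om : set (R * R)) : Prop :=
  exists M : R, forall p, Om p -> `|p.1| <= M /\ `|p.2| <= M.

Definition simply_connected (Om : set (R * R)) : Prop :=
  forall c : R -> R * R,
    {within `[0, 1], continuous c} -> c 0 = c 1 -> c @` `[0, 1] `<=` Om ->
    exists H : R * R -> R * R,
      [/\ {within `[0, 1] `*` `[0, 1], continuous H},
          H @` (`[0, 1] `*` `[0, 1]) `<=` Om,
          (forall t, 0 <= t <= 1 -> H (t, 0) = c t /\ H (t, 1) = c 0) &
          (forall u, 0 <= u <= 1 -> H (0, u) = c 0 /\ H (1, u) = c 0)].

(* positive orientation: at every regular point the left normal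
   (-y', x') points into Om *)
Definition positively_oriented (L : R) (x y : R -> R) (Om : set (R * R)) :=
  forall s, 0 <= s < L -> derivable x s 1 -> derivable y s 1 ->
    (derive1 x s, derive1 y s) != (0, 0) ->
    \forall t \near 0^'+, Om (x s - t * derive1 y s, y s + t * derive1 x s).

Definition billiard_table (L : R) (x y : R -> R) (Om : set (R * R)) : Prop :=
  [/\ simple_closed_curve L x y, piecewise_smooth_arclength L x y,
      [/\ open Om, connected Om, Om !=set0, bounded2 Om & simply_connected Om],
      closure Om `\` Om = gamma x y @` `[0, L] &
      positively_oriented L x y Om].

Definition Phi (L : R) : set (R * R) := `[0, L] `*` `[0, pi].

(* direction of the ray leaving gamma(s) at angle theta with the tangent *)
Definition bdir (x y : R -> R) (z : R * R) : R * R :=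
  (cos z.2 * derive1 x z.1 - sin z.2 * derive1 y z.1,
   sin z.2 * derive1 x z.1 + cos z.2 * derive1 y z.1).

Definition hit_time (x y : R -> R) (Om : set (R * R)) (z : R * R) : R :=
  inf [set t : R | 0 < t /\
        ~ Om (x z.1 + t * (bdir x y z).1, y z.1 + t * (bdir x y z).2)].

Definition hit_point (x y : R -> R) (Om : set (R * R)) (z : R * R) : R * R :=
  (x z.1 + hit_time x y Om z * (bdir x y z).1,
   y z.1 + hit_time x y Om z * (bdir x y z).2).

Definition bcoord (L : R) (x y : R -> R) (q : R * R) : R :=
  xget 0 [set s : R | 0 <= s < L /\ gamma x y s = q].

(* billiard map: new footpoint s', new angle theta' = angle between the
   incoming direction and the tangent at s' (law of reflection) *)
Definition billiard_map (L : R) (x y : R -> R) (Om : set (R * R))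
    (z : R * R) : R * R :=
  let v := bdir x y z in
  let s' := bcoord L x y (hit_point x y Om z) in
  (s', acos (v.1 * derive1 x s' + v.2 * derive1 y s')).

Definition liouville (L : R) (A : set (R * R)) : \bar R :=
  (\int[(@lebesgue_measure R \x @lebesgue_measure R)%E]_(z in A `&` Phi L)
      (sin z.2)%:E)%E.

Definition liouville_integral (L : R) (f : R * R -> R) : \bar R :=
  (\int[(@lebesgue_measure R \x @lebesgue_measure R)%E]_(z in Phi L)
      (f z * sin z.2)%:E)%E.

(* xi(z): the unique 0 <= xi < L with s1 + xi = s2 or s1 + xi = s2 + L,
   s1, s2 the coordinates of p(z), p(phi z) *)
Definition fgain (L : R) (x y : R -> R) (Om : set (R * R)) (z : R * R) : R :=
  let s1 := if z.1 < L then z.1 else 0 in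
  let s2 := (billiard_map L x y Om z).1 in
  if s1 <= s2 then s2 - s1 else s2 - s1 + L.

(* upsilon(z) = lim_n (1/n) sum_{k<n} xi(phi^k z)  (lim = MathComp's lim,
   meaningful where the limit exists) *)
Definition footpoint_gain (L : R) (x y : R -> R) (Om : set (R * R))
    (z : R * R) : R :=
  limn (fun n : nat =>
    (\sum_(k < n.+1) fgain L x y Om (iter k (billiard_map L x y Om) z))
      / n.+1%:R).

Definition rotation_number (L : R) (x y : R -> R) (Om : set (R * R))
    (z : R * R) : R :=
  footpoint_gain L x y Om z / L.

Definition billiard_ergodic (L : R) (x y : R -> R) (Om : set (R * R)) : Prop :=
  forall A : set (R * R), measurable A -> A `<=` Phi L ->
    Phi L `&` (billiard_map L x y Om) @^-1` A = A ->
    liouville L A = 0%E \/ liouville L (Phi L `\` A) = 0%E.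

End Billiard.

(* Main.v *)
(* Let J (s, theta) = (s, pi - theta) be time reversal and S = J o phi.  Running a
   trajectory backwards shows that S is an involution almost everywhere and that
   xi (S z) = |bd Om| - xi z.  Both phi and J preserve the Liouville measure, so by
   Birkhoff's theorem rho exists almost everywhere; integrating against invariant
   functions, the reversal of xi gives rho o J = 1 - rho almost everywhere.  All three
   claims follow from this symmetry.

   Invariance of nu under S.  Disintegrate nu over the direction v of the ray: for fixed
   v it becomes |f'| ds, where f (s) = x s * v.2 - y s * v.1 is the offset of the line
   through gamma (s) with direction v.  S exchanges the points of one chord, hence
   preserves f and replaces v by - v, and a bijection between sets of footpoints that
   preserves f preserves |f'| ds.  By Sard's theorem the offsets of tangent lines are
   negligible, so almost every chord ends transversally at a smooth point.

   That a chord leaves Om where it hits the boundary transversally uses that the two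
   sides of a smooth boundary arc cannot both lie in Om: their winding numbers with
   respect to the curve differ modulo 2, whereas the winding number modulo 2 is constant
   on the connected set Om. *)
Require Import Defs.
From HB Require Import structures.
From mathcomp Require Import all_boot all_order all_algebra.
From mathcomp Require Import all_classical all_reals all_analysis.
From mathcomp Require Import measurable_realfun ring lra.
Import Order.TTheory GRing.Theory Num.Theory numFieldNormedType.Exports.
Set Implicit Arguments.
Unset Strict Implicit.
Unset Printing Implicit Defensive.
Local Open Scope classical_set_scope.
Local Open Scope ring_scope.

(** The difficulty is the exceptional set. [hit_time], [bcoord], [acos] and [derive1] are total
    functions that return default values, so identities for the billiard map may fail at corners and
    tangencies. The map is therefore shown measurable on the whole plane, defaults included, and the
    geometric identities are proved on the set [transversal], which is stable under reversal and has
    full measure. No derivative of the billiard map is taken. For a fixed direction the invariance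
    of the measure is a one-dimensional area formula, for which a decomposition into rational
    intervals of monotonicity suffices. The winding number modulo 2 is encoded without integrals:
    for points p, q off the curve, the two numbers agree when gamma - p times the conjugate of gamma
    - q has a continuous periodic complex square root. The symmetry of rho is proved in an abstract
    reversible system. The deviation from it is an invariant function and can serve as its own test
    function, so its square integrates to zero; conditional expectations do not occur. *)

(** * Bounded measurable functions on a finite measure space *)

Section bounded_measurable.
Context d (X : measurableType d) (R : realType).

Definition bounded_mfun (f : X -> R) : Prop :=
  measurable_fun setT f /\ exists M : R, forall x, `|f x| <= M.

Implicit Types f g : X -> R.

Lemma bounded_mfun_cst (c : R) : bounded_mfun (cst c).
Proof. by split; [exact: measurable_cst|exists `|c|]. Qed.

Lemma bounded_mfunD f g :
  bounded_mfun f -> bounded_mfun g -> bounded_mfun (fun x => f x + g x).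
Proof.
move=> [mf [M fM]] [mg [N gN]]; split; first exact: measurable_funD.
by exists (M + N) => x; rewrite (le_trans (ler_normD _ _))// lerD.
Qed.

Lemma bounded_mfunM f g :
  bounded_mfun f -> bounded_mfun g -> bounded_mfun (fun x => f x * g x).
Proof.
move=> [mf [M fM]] [mg [N gN]]; split; first exact: measurable_funM.
by exists (M * N) => x; rewrite normrM ler_pM.
Qed.

Lemma bounded_mfunN f : bounded_mfun f -> bounded_mfun (fun x => - f x).
Proof.
move=> [mf [M fM]]; split; first exact: measurable_funN.
by exists M => x; rewrite normrN.
Qed.

Lemma bounded_mfunB f g :
  bounded_mfun f -> bounded_mfun g -> bounded_mfun (fun x => f x - g x).
Proof. by move=> bf bg; apply: bounded_mfunD => //; exact: bounded_mfunN. Qed.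

Lemma bounded_mfun_indic A : measurable A -> bounded_mfun \1_A.
Proof.
move=> mA; split; first exact: measurable_indic.
by exists 1 => x; rewrite indicE; case: (_ \in _); rewrite ?normr1 ?normr0.
Qed.

Lemma bounded_mfun_comp (T : X -> X) f :
  measurable_fun setT T -> bounded_mfun f -> bounded_mfun (fun x => f (T x)).
Proof.
move=> mT [mf [M fM]]; split; first exact: measurableT_comp.
by exists M => x.
Qed.

Variable mu : {finite_measure set X -> \bar R}.

Lemma bounded_mfun_integrable f :
  bounded_mfun f -> mu.-integrable setT (EFin \o f).
Proof.
move=> [mf [M fM]]; apply: measurable_bounded_integrable => //.
  by rewrite ltey_eq fin_num_measure.
exists M; split; first exact: num_real.
by move=> N MN x _ /=; apply: le_trans (fM x) _; exact: ltW.
Qed.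

Let I f := (\int[mu]_x f x)%R.

Lemma bintegralD f g : bounded_mfun f -> bounded_mfun g ->
  I (fun x => f x + g x) = I f + I g.
Proof. by move=> bf bg; apply: RintegralD => //; exact: bounded_mfun_integrable. Qed.

Lemma bintegralB f g : bounded_mfun f -> bounded_mfun g ->
  I (fun x => f x - g x) = I f - I g.
Proof. by move=> bf bg; apply: RintegralB => //; exact: bounded_mfun_integrable. Qed.

Lemma bintegralZl (r : R) f : bounded_mfun f ->
  I (fun x => r * f x) = r * I f.
Proof. by move=> bf; apply: RintegralZl => //; exact: bounded_mfun_integrable. Qed.

Lemma le_bintegral f g : bounded_mfun f -> bounded_mfun g ->
  (forall x, f x <= g x) -> I f <= I g.
Proof. by move=> bf bg fg; apply: le_Rintegral => //; exact: bounded_mfun_integrable. Qed.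

Lemma bintegral_indic A : measurable A -> I \1_A = fine (mu A).
Proof. by move=> mA; rewrite /I /Rintegral integral_indic// setIT. Qed.

Lemma ae_eq_bintegral f g : bounded_mfun f -> bounded_mfun g ->
  {ae mu, forall x, f x = g x} -> I f = I g.
Proof.
move=> [mf _] [mg _] fg; rewrite /I /Rintegral; congr fine.
apply: ae_eq_integral => //; [exact/measurable_EFinP|exact/measurable_EFinP|].
by apply: filterS fg => x fgx _; rewrite fgx.
Qed.

Lemma bintegral_cvg (f_ : nat -> X -> R) f (M : R) :
  (forall n, measurable_fun setT (f_ n)) -> measurable_fun setT f ->
  (forall n x, `|f_ n x| <= M) ->
  {ae mu, forall x, f_ ^~ x @ \oo --> f x} ->
  (fun n => I (f_ n)) @ \oo --> I f.
Proof.
move=> mf_ mf fM f_f.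
have [if_ _] : [/\ mu.-integrable setT (EFin \o f),
    [sequence (\int[mu]_x `|(f_ n x)%:E - (f x)%:E|)%E]_n @ \oo --> 0%E &
    [sequence (\int[mu]_x (f_ n x)%:E)%E]_n @ \oo --> (\int[mu]_x (f x)%:E)%E].
  apply: (@dominated_convergence _ _ _ mu setT measurableT
    (fun n => EFin \o f_ n) (EFin \o f) (cst M%:E)).
  - by move=> n; exact/measurable_EFinP.
  - exact/measurable_EFinP.
  - by apply: filterS f_f => x fx _; apply: cvg_EFin => //; near=> n.
  - exact/(@bounded_mfun_integrable (cst M))/bounded_mfun_cst.
  - by apply: aeW => x n _; rewrite lee_fin.
move=> cv; apply: fine_cvg; rewrite fineK//.
exact: integrable_fin_num.
Unshelve. all: by end_near. Qed.

Lemma bintegral_sqr_eq0 f : bounded_mfun f -> I (fun x => f x * f x) = 0 ->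
  {ae mu, forall x, f x = 0}.
Proof.
move=> bf I0; have bff := bounded_mfunM bf bf.
have mff : measurable_fun setT (EFin \o (fun x => f x * f x)).
  by apply/measurable_EFinP; case: bff.
have [+ _] := ae_eq_integral_abs mu measurableT mff.
have -> : (\int[mu]_x `|(EFin \o (fun x => f x * f x)%R) x| = 0)%E.
  under eq_integral do rewrite /= ger0_norm -?expr2 ?sqr_ge0// expr2.
  rewrite -[LHS]fineK//; first by congr EFin.
  by apply: integrable_fin_num => //; exact: bounded_mfun_integrable.
move=> /(_ erefl); apply: filterS => x /(_ Logic.I) [] /eqP.
by rewrite mulf_eq0 orbb => /eqP.
Qed.

End bounded_measurable.

(** * Measure-preserving maps *)

Section measure_preserving.
Context d (X : measurableType d) (R : realType).
Variable mu : {finite_measure set X -> \bar R}.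

Definition measure_preserving (T : X -> X) : Prop :=
  measurable_fun setT T /\ forall A, measurable A -> mu (T @^-1` A) = mu A.

Lemma measure_preserving_comp (T S : X -> X) :
  measure_preserving T -> measure_preserving S -> measure_preserving (T \o S).
Proof.
move=> [mT T1] [mS S1]; split; first exact: measurableT_comp.
move=> A mA; rewrite comp_preimage S1 ?T1//.
by rewrite -[X in measurable X]setTI; exact: mT.
Qed.

Lemma measure_preserving_ae (T : X -> X) (P : X -> Prop) :
  measure_preserving T -> {ae mu, forall x, P x} -> {ae mu, forall x, P (T x)}.
Proof.
move=> [mT T1] [N [mN N0 PN]]; exists (T @^-1` N); split.
- by rewrite -[X in measurable X]setTI; exact: mT.
- by rewrite /= T1.
- by move=> x /= nP; exact: PN.
Qed.

Lemma bintegral_comp (T : X -> X) (f : X -> R) :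
  measure_preserving T -> bounded_mfun f ->
  (\int[mu]_x f (T x) = \int[mu]_x f x)%R.
Proof.
move=> [mT T1] bf; rewrite /Rintegral; congr fine.
have [mf _] := bf.
have -> : (\int[mu]_x (f x)%:E)%E = (\int[pushforward mu T]_x (f x)%:E)%E.
  by apply: eq_measure_integral => A mA _; exact/esym/T1.
rewrite (@integral_pushforward _ _ _ _ _ T mT mu setT (EFin \o f))//.
- exact/measurable_EFinP.
- by rewrite preimage_setT; exact: (bounded_mfun_integrable mu (bounded_mfun_comp mT bf)).
Qed.

End measure_preserving.

(** * Upper limits through frequent exceedance *)

Section frequently.
Variable R : realType.
Implicit Types (u v : nat -> R) (a b : R).

(** A substitute for a lower bound [b] on the limsup that stays within real numbers; the difference
    between strict and weak inequality is absorbed by margins later on. *)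
Definition freq_gt u b := forall m : nat, exists2 n, (m <= n)%N & b < u n.

Lemma freq_gt_le u a b : a <= b -> freq_gt u b -> freq_gt u a.
Proof.
by move=> ab ub m; have [n mn bn] := ub m; exists n => //; exact: le_lt_trans bn.
Qed.

Lemma not_freq_gt u b : ~ freq_gt u b -> \forall n \near \oo, u n <= b.
Proof.
move=> /existsNP[m /forall2NP um]; exists m => // n /= mn.
by case: (um n) => // /negP; rewrite -leNgt.
Qed.

(** The two sequences differ by something that only tends to zero, so the level has to drop from [b]
    to a smaller [a]. *)
Lemma freq_gt_shift u v a b : (fun n => u n.+1 - v n) @ \oo --> (0 : R) ->
  a < b -> (freq_gt u b -> freq_gt v a) /\ (freq_gt v b -> freq_gt u a).
Proof.
move=> /cvgrPdist_lt/(_ (b - a)) + ab; rewrite subr_gt0 => /(_ ab)[m _ /= mP].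
split=> ub k.
  have [[|n] kn bn] := ub (maxn k.+1 m.+1); first by rewrite geq_max in kn.
  move: kn; rewrite geq_max !ltnS => /andP[kn mn]; exists n => //.
  by have := mP n mn; rewrite /= sub0r normrN ltr_norml => /andP[]; lra.
have [n] := ub (maxn k m); rewrite geq_max => /andP[kn mn] bn.
exists n.+1; first exact: leqW.
by have := mP n mn; rewrite /= sub0r normrN ltr_norml => /andP[]; lra.
Qed.

(** The limit is the limsup, obtained as the supremum of the levels exceeded infinitely often. If
    [u] also fell below [sup B - e] infinitely often, an element of [B] above [sup B - e] would give
    a forbidden oscillation. *)
Lemma no_oscillation_cvg u (M : R) : (forall n, `|u n| <= M) ->
  (forall a b, a < b -> freq_gt u b -> ~ freq_gt (fun n => - u n) (- a)) ->
  cvg (u @ \oo).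
Proof.
move=> uM osc; pose B := [set b | freq_gt u b].
have B0 : B !=set0.
  exists (- M - 1) => m; exists m => //.
  by have := uM m; rewrite ler_norml => /andP[]; lra.
have ubB : has_ubound B.
  exists M => b ub; have [n _ bn] := ub 0%N.
  by apply: le_trans (ltW bn) _; apply: le_trans (ler_norm _) _.
apply/cvg_ex; exists (sup B); apply/cvgrPdist_le => e e0.
have h1 : \forall n \near \oo, u n <= sup B + e.
  apply: not_freq_gt => ub; have := sup_upper_bound (conj B0 ubB) ub.
  by lra.
have h2 : \forall n \near \oo, - u n <= - (sup B - e).
  apply: not_freq_gt => ua.
  have [b ub bB] := sup_adherent e0 (conj B0 ubB).
  exact: (osc _ _ bB ub).
near=> n; rewrite ler_distlC.
have : u n <= sup B + e by near: n.
have : - u n <= - (sup B - e) by near: n.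
by lra.
Unshelve. all: by end_near. Qed.

End frequently.

(* [limn] is [0] where the sequence diverges. *)
Lemma measurable_limn d (X : measurableType d) (R : realType) (h : nat -> X -> R) :
  (forall n, measurable_fun setT (h n)) ->
  measurable_fun setT (fun x => limn (h ^~ x)).
Proof.
move=> mh; pose C := [set x | cvg (h ^~ x @ \oo)].
have mC : measurable C.
  (* The Cauchy criterion in countable form, each tail being compared with its first term only. *)
  have -> : C = \bigcap_k \bigcup_N \bigcap_(n in [set n | (N <= n)%N])
      [set x | `|h N x - h n x| <= k.+1%:R^-1].
    apply/seteqP; split => x.
      move=> /cvgrPdist_lt hx k _.
      have [|N _ hN] := hx (k.+1%:R^-1 / 2); first by rewrite divr_gt0.
      exists N => // n /= Nn; rewrite (splitr (k.+1%:R^-1)).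
      rewrite -(subrKA (limn (h^~ x))) (le_trans (ler_normD _ _))//.
      by rewrite lerD// ltW// ?(distrC (h N x)) hN//=.
    move=> hx; apply: cauchy_cvg; apply: cauchy_exP => e e0.
    have [k ke] := ltr_add_invr e0; rewrite add0r in ke.
    have [N _ hN] := hx k Logic.I; exists (h N x); exists N => // n /= Nn.
    exact: le_lt_trans (hN n Nn) ke.
  apply: bigcapT_measurable => k; apply: bigcupT_measurable => N.
  apply: bigcap_measurable; first by exists N => /=.
  move=> n _; have mhh : measurable_fun setT (fun x => `|h N x - h n x|).
    by apply: measurableT_comp => //; exact: measurable_funB.
  have := mhh measurableT _ (measurable_itv `]-oo, k.+1%:R^-1 : R]); rewrite setTI.
  by congr measurable; apply/seteqP; split => x /=; rewrite in_itv.
(* Cutting the sequence off outside [C] makes it converge everywhere; outside [C] its limit [0] is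
   also the default of [limn]. *)
apply: (@measurable_fun_cvg _ _ _ setT (fun n x => h n x * \1_C x)).
  by move=> n; apply: measurable_funM => //; exact: measurable_indic.
move=> x _; have [Cx|nCx] := pselect (C x).
  rewrite indicE mem_set//=; under eq_cvg do rewrite mulr1.
  exact: Cx.
rewrite indicE memNset// (dvgP nCx)/=; under eq_cvg do rewrite mulr0.
exact: cvg_cst.
Qed.

(** * The pointwise ergodic theorem *)

Section birkhoff.
Context d (X : measurableType d) (R : realType).
Variable mu : {finite_measure set X -> \bar R}.
Variable T : X -> X.
Hypothesis mpT : measure_preserving mu T.

Let mT : measurable_fun setT T. Proof. by case: mpT. Qed.

Let I (f : X -> R) := (\int[mu]_x f x)%R.

Implicit Types (f : X -> R) (a b : R).

Definition birkhoff_sum (f : X -> R) (n : nat) (x : X) : R :=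
  \sum_(k < n) f (iter k T x).

(** The index is shifted so that the divisor never vanishes, in agreement with [footpoint_gain]. *)
Definition birkhoff_avg (f : X -> R) (n : nat) (x : X) : R :=
  (\sum_(k < n.+1) f (iter k T x)) / n.+1%:R.

Lemma measurable_iter k : measurable_fun setT (iter k T).
Proof.
elim: k => [|k IH]; first exact: measurable_id.
exact: (measurableT_comp mT IH).
Qed.

Lemma birkhoff_sumS f n x :
  birkhoff_sum f n.+1 x = f x + birkhoff_sum f n (T x).
Proof.
rewrite /birkhoff_sum big_ord_recl/=; congr (_ + _).
by apply: eq_bigr => i _; rewrite -iterSr.
Qed.

(** The maximum of the Birkhoff sums of length [0] to [n], in a recursive form from which the
    inequality behind the maximal ergodic theorem is read off by one unfolding. *)
Fixpoint running_max (f : X -> R) (n : nat) (x : X) : R :=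
  if n is m.+1 then Num.max 0 (f x + running_max f m (T x)) else 0.

Lemma running_max_ge0 f n x : 0 <= running_max f n x.
Proof. by case: n => //= n; rewrite le_max lexx. Qed.

Lemma running_max_nd f n x : running_max f n x <= running_max f n.+1 x.
Proof.
elim: n x => [|n IH] x; first exact: running_max_ge0.
rewrite [X in X <= _]/= ge_max; apply/andP; split; first exact: running_max_ge0.
by rewrite [X in _ <= X]/= le_max; apply/orP; right; rewrite lerD2l; exact: IH.
Qed.

Lemma le_running_max f n m x : (n <= m)%N -> running_max f n x <= running_max f m x.
Proof.
move=> /subnK <-; elim: (m - n)%N => // k IH.
by rewrite addSn (le_trans IH)// running_max_nd.
Qed.

Lemma birkhoff_sum_le_running_max f n x :
  birkhoff_sum f n x <= running_max f n x.
Proof.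
elim: n x => [|n IH] x; first by rewrite /birkhoff_sum big_ord0.
by rewrite birkhoff_sumS/= le_max; apply/orP; right; rewrite lerD2l.
Qed.

Lemma bounded_mfun_running_max f n :
  bounded_mfun f -> bounded_mfun (running_max f n).
Proof.
move=> bf; elim: n => [|n IH]; first exact: bounded_mfun_cst.
have [mg [M gM]] := bounded_mfunD bf (bounded_mfun_comp mT IH).
split; first by apply: measurable_maxr => //; exact: measurable_cst.
exists M => x /=; rewrite (le_trans _ (gM x))//.
by rewrite /Num.max; case: ifPn; rewrite // normr0.
Qed.

(* Garsia: where [running_max f n] is positive it is at most
   [f x + running_max f n (T x)], and its integral is [T]-invariant. *)
Lemma maximal_ergodic f : bounded_mfun f ->
  (forall x, f x = 0 \/ exists n, 0 < birkhoff_sum f n x) -> 0 <= I f.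
Proof.
move=> bf f0; pose P n := [set x | 0 < running_max f n x].
have bF n := bounded_mfun_running_max n bf.
have mP n : measurable (P n).
  have [mF _] := bF n; rewrite -[P n]setTI.
  rewrite (_ : P n = running_max f n @^-1` `]0, +oo[%classic).
    by apply: mF => //; exact: measurable_itv.
  by apply/seteqP; split => x /=; rewrite in_itv/= andbT.
pose g n x := f x * \1_(P n) x.
have bg n : bounded_mfun (g n) by apply: bounded_mfunM => //; exact: bounded_mfun_indic.
have Ig n : 0 <= I (g n).
  have -> : 0 = I (fun x => running_max f n x - running_max f n (T x)).
    rewrite /I bintegralB//; last exact: bounded_mfun_comp.
    by rewrite bintegral_comp// subrr.
  apply: le_bintegral => //.
    by apply: bounded_mfunB => //; exact: bounded_mfun_comp.
  move=> x; rewrite /g indicE; have [|] := boolP (x \in P n).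
    rewrite inE /P/= => F0; rewrite mulr1 lerBlDr.
    case: n F0 {bF mP g bg P} => [|n]; first by rewrite /= ltxx.
    rewrite [X in 0 < X]/= [X in X <= _]/= lt_max ltxx/= => fF0.
    rewrite max_r; last exact: ltW.
    by rewrite lerD2l; exact: (running_max_nd f n (T x)).
  rewrite notin_setE /P/= => /negP; rewrite -leNgt mulr0 => Fx.
  rewrite (_ : running_max f n x = 0) ?sub0r ?oppr_le0 ?running_max_ge0//.
  by apply/eqP; rewrite eq_le Fx running_max_ge0.
have [mf [M fM]] := bf.
have cg : (fun n => I (g n)) @ \oo --> I f.
  apply: (@bintegral_cvg _ _ _ mu g f M) => //.
  - by move=> n; case: (bg n).
  - move=> n x; rewrite /g indicE; case: (_ \in _); rewrite ?mulr1 ?mulr0//.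
    by rewrite normr0 (le_trans _ (fM x)).
  - apply: aeW => x; case: (f0 x) => [fx0|[n fn]].
      rewrite fx0 (_ : g^~ x = cst 0); first exact: cvg_cst.
      by apply/funext => n; rewrite /g fx0 mul0r.
    apply: cvg_near_cst; exists n => // m /= nm.
    rewrite /g indicE mem_set ?mulr1//= /P/=.
    apply: lt_le_trans fn _; apply: le_trans (birkhoff_sum_le_running_max _ _ _) _.
    exact: le_running_max.
by apply: (cvgr_to_ge cg); near=> n; exact: Ig.
Unshelve. all: by end_near. Qed.

Lemma measurable_birkhoff_avg f n :
  measurable_fun setT f -> measurable_fun setT (birkhoff_avg f n).
Proof.
move=> mf; apply: measurable_funM; last exact: measurable_cst.
by apply: measurable_sum => k; exact: (measurableT_comp mf (measurable_iter k)).
Qed.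

Lemma birkhoff_avg_le f (M : R) n x :
  (forall x, `|f x| <= M) -> `|birkhoff_avg f n x| <= M.
Proof.
move=> fM; rewrite /birkhoff_avg normrM normfV [X in _ / X]ger0_norm//.
rewrite ler_pdivrMr// (le_trans (ler_norm_sum _ _ _))//.
rewrite (le_trans (ler_sum _ (fun (i : 'I_n.+1) _ => fM (iter i T x))))//.
by rewrite sumr_const card_ord mulr_natr.
Qed.

(** The difference equals [(f x - birkhoff_avg f n.+1 x) / n.+1], which is at most [2 * M / n.+1] in
    absolute value. *)
Lemma birkhoff_avg_shift f (M : R) x : (forall x, `|f x| <= M) ->
  (fun n => birkhoff_avg f n.+1 x - birkhoff_avg f n (T x)) @ \oo --> (0 : R).
Proof.
move=> fM.
have bnd n : `|birkhoff_avg f n.+1 x - birkhoff_avg f n (T x)| <= (2 * M) * harmonic n.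
  have -> : birkhoff_avg f n.+1 x - birkhoff_avg f n (T x) =
      (f x - birkhoff_avg f n.+1 x) * harmonic n.
    rewrite /birkhoff_avg /harmonic/= -!/(birkhoff_sum _ _ _).
    rewrite -/(birkhoff_sum f n.+2 x) -/(birkhoff_sum f n.+1 (T x)).
    rewrite birkhoff_sumS; set S := birkhoff_sum _ _ _.
    have n1 : n.+1%:R != 0 :> R by rewrite pnatr_eq0.
    have -> : n.+2%:R = n.+1%:R + 1 :> R by rewrite -natr1.
    have n2 : n.+1%:R + 1 != 0 :> R by rewrite natr1 pnatr_eq0.
    by move: (n.+1%:R) n1 n2 => N n1 n2; field; rewrite ?n1 ?n2.
  rewrite normrM [X in _ * X <= _]ger0_norm ?invr_ge0// ler_wpM2r ?invr_ge0//.
  rewrite (le_trans (ler_normB _ _))// mulr2n mulrDl mul1r lerD//.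
  exact: birkhoff_avg_le.
have /cvgrPdist_le cb : (fun n => 2 * M * harmonic n) @ \oo --> (0 : R).
  by rewrite -(mulr0 (2 * M)); apply: cvgMr; exact: cvg_harmonic.
apply/cvgrPdist_le => e /cb; apply: filterS => n; rewrite !sub0r !normrN => h.
exact: le_trans (bnd n) (le_trans (ler_norm _) h).
Qed.

Lemma cvg_birkhoff_avg_shift f (M : R) x (l : R) : (forall x, `|f x| <= M) ->
  birkhoff_avg f ^~ (T x) @ \oo --> l <-> birkhoff_avg f ^~ x @ \oo --> l.
Proof.
move=> fM; have sh := birkhoff_avg_shift x fM; split=> cl.
  rewrite -cvg_shiftS -[l]add0r.
  rewrite [X in X @ _](_ : _ = fun n => birkhoff_avg f n.+1 x - birkhoff_avg f n (T x)
    + birkhoff_avg f n (T x)); last by apply/funext => n; rewrite subrK.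
  exact: cvgD.
have cl' : (fun n => birkhoff_avg f n.+1 x) @ \oo --> l by move: cl; rewrite -cvg_shiftS.
rewrite -[l]subr0.
rewrite [X in X @ _](_ : _ = fun n => birkhoff_avg f n.+1 x -
  (birkhoff_avg f n.+1 x - birkhoff_avg f n (T x))); last first.
  by apply/funext => n; rewrite subKr.
exact: cvgB.
Qed.

Definition birkhoff_lim (f : X -> R) (x : X) : R := limn (birkhoff_avg f ^~ x).

(** This is an identity at every point, not only almost everywhere: the averages at [x] and at [T x]
    converge together, and where they diverge both limits take the same default value. *)
Lemma birkhoff_lim_invariant f (M : R) x : (forall x, `|f x| <= M) ->
  birkhoff_lim f (T x) = birkhoff_lim f x.
Proof.
move=> fM; have [cx|ncx] := pselect (cvg (birkhoff_avg f ^~ x @ \oo)).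
  apply: cvg_lim => //; exact/(cvg_birkhoff_avg_shift x _ fM).
rewrite /birkhoff_lim (dvgP ncx) dvgP//; apply: contra_not ncx => cTx.
by apply/cvg_ex; exists (lim (birkhoff_avg f ^~ (T x) @ \oo));
  exact/(cvg_birkhoff_avg_shift x _ fM).
Qed.

(** For bounded [f] this is the set where the limsup of the averages is greater than [b]. The union
    over the margins makes it exactly invariant under [T], whereas [freq_gt] alone is invariant only
    up to a loss in the level. *)
Definition exceeds (f : X -> R) (b : R) : set X :=
  [set x | exists k : nat, freq_gt (birkhoff_avg f ^~ x) (b + k.+1%:R^-1)].

Lemma measurable_exceeds f b : measurable_fun setT f -> measurable (exceeds f b).
Proof.
move=> mf.
have -> : exceeds f b = \bigcup_k \bigcap_m \bigcup_(n in [set n | (m <= n)%N])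
    [set x | b + k.+1%:R^-1 < birkhoff_avg f n x].
  apply/seteqP; split => x.
    by move=> [k fk]; exists k => // m _; have [n mn bn] := fk m; exists n.
  by move=> [k _ fk]; exists k => m; have [n mn bn] := fk m Logic.I; exists n.
apply: bigcupT_measurable => k; apply: bigcapT_measurable => m.
apply: bigcup_measurable => n _.
have := measurable_birkhoff_avg n mf.
move=> /(_ measurableT _ (measurable_itv `]b + k.+1%:R^-1, +oo[)); rewrite setTI.
by congr measurable; apply/seteqP; split => x /=; rewrite in_itv/= andbT.
Qed.

Lemma exceeds_invariant f (M : R) b x : (forall x, `|f x| <= M) ->
  exceeds f b (T x) <-> exceeds f b x.
Proof.
move=> fM; have sh := birkhoff_avg_shift x fM.
have lt k : b + k.+2%:R^-1 < b + k.+1%:R^-1 :> R.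
  by rewrite ltrD2l ltf_pV2 ?posrE// ltr_nat.
by split=> -[k fk]; exists k.+1; have [h1 h2] :=
  @freq_gt_shift R (birkhoff_avg f ^~ x) (birkhoff_avg f ^~ (T x)) _ _ sh (lt k);
  [exact: h2|exact: h1].
Qed.

(** The maximal ergodic theorem is applied to [(f - b) * \1_E]. As [E] is invariant, the Birkhoff
    sums of this function are [\1_E] times [birkhoff_sum f n x - b * n], and on [E] one of them is
    positive. *)
Lemma exceeds_integral f (M : R) b (E : set X) :
  measurable_fun setT f -> (forall x, `|f x| <= M) -> measurable E ->
  (forall x, E (T x) <-> E x) -> E `<=` exceeds f b ->
  b * I \1_E <= I (fun x => f x * \1_E x).
Proof.
move=> mf fM mE iE Eb.
have bE := @bounded_mfun_indic _ _ R _ mE.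
have bf : bounded_mfun f by split => //; exists M.
rewrite -subr_ge0 /I -bintegralZl// -bintegralB//; last 2 first.
- exact: bounded_mfunM.
- by apply: bounded_mfunM => //; exact: bounded_mfun_cst.
have sumE n x : birkhoff_sum (fun x => f x * \1_E x - b * \1_E x) n x =
    \1_E x * (birkhoff_sum f n x - b * n%:R).
  elim: n x => [|n IH] x.
    by rewrite /birkhoff_sum !big_ord0 mulr0 subrr mulr0.
  rewrite !birkhoff_sumS IH -natr1.
  have -> : \1_E (T x) = \1_E x :> R.
    rewrite !indicE; congr ((_ : bool)%:R).
    by apply/idP/idP; rewrite !inE => /iE.
  by ring.
apply: maximal_ergodic.
  apply: bounded_mfunB; first exact: bounded_mfunM.
  by apply: bounded_mfunM => //; exact: bounded_mfun_cst.
move=> x; have [Ex|nEx] := pselect (E x); last first.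
  by left; rewrite indicE memNset// !mulr0 subrr.
right; have [k fk] := Eb _ Ex; have [n _ bn] := fk 0%N; exists n.+1.
rewrite sumE indicE mem_set// mul1r subr_gt0.
have : b < birkhoff_avg f n x by apply: le_lt_trans bn; rewrite lerDl invr_ge0.
by rewrite /birkhoff_avg ltr_pdivlMr.
Qed.

Lemma birkhoff_avgN f n x :
  birkhoff_avg (fun x => - f x) n x = - birkhoff_avg f n x.
Proof. by rewrite /birkhoff_avg sumrN mulNr. Qed.

(** On this invariant set the integral of [f] is at least [b] times and at most [a] times its
    measure, which is impossible for [a < b] unless the measure is zero. *)
Lemma oscillation_null f (M : R) a b :
  measurable_fun setT f -> (forall x, `|f x| <= M) -> a < b ->
  mu (exceeds f b `&` exceeds (fun x => - f x) (- a)) = 0%E.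
Proof.
move=> mf fM ab; set E := _ `&` _.
have mNf : measurable_fun setT (fun x => - f x) by exact: measurable_funN.
have NfM x : `|- f x| <= M by rewrite normrN.
have mE : measurable E by apply: measurableI; exact: measurable_exceeds.
have iE x : E (T x) <-> E x.
  by split=> -[E1 E2]; split; [exact/(exceeds_invariant b x fM)|
   exact/(exceeds_invariant (- a) x NfM)|exact/(exceeds_invariant b x fM)|
   exact/(exceeds_invariant (- a) x NfM)].
have bE := @bounded_mfun_indic _ _ R _ mE.
have bf : bounded_mfun f by split => //; exists M.
have le1 : b * I \1_E <= I (fun x => f x * \1_E x).
  by apply: (exceeds_integral mf fM) => // x [].
have le2 : - a * I \1_E <= I (fun x => - f x * \1_E x).
  by apply: (exceeds_integral mNf NfM) => // x [].
have e2 : I (fun x => - f x * \1_E x) = - I (fun x => f x * \1_E x).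
  rewrite -mulN1r /I -bintegralZl; last exact: bounded_mfunM.
  by congr Rintegral; apply/funext => x; rewrite mulN1r mulNr.
have IE : I \1_E = fine (mu E) by rewrite /I bintegral_indic.
have E0 : 0 <= fine (mu E) by rewrite fine_ge0.
have : fine (mu E) = 0.
  apply/eqP; rewrite eq_le E0 andbT -(pmulr_rle0 _ (_ : 0 < b - a)) ?subr_gt0//.
  by move: le1 le2; rewrite e2 IE mulrBl; lra.
by move=> fE; rewrite -[LHS]fineK ?fin_num_measure// fE.
Qed.

(** Divergence means oscillation across some interval []a, b[], hence across one with rational
    endpoints, and there are only countably many of these. *)
Theorem birkhoff f : bounded_mfun f ->
  {ae mu, forall x, birkhoff_avg f ^~ x @ \oo --> birkhoff_lim f x}.
Proof.
move=> [mf [M fM]].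
have h : {ae mu, forall x, forall p : rat * rat, p.1 < p.2 ->
    ~ (exceeds f (ratr p.2) `&` exceeds (fun x => - f x) (- ratr p.1)) x}.
  suff : {ae mu, forall x, forall k : nat, forall p : rat * rat, unpickle k = Some p ->
      p.1 < p.2 ->
      ~ (exceeds f (ratr p.2) `&` exceeds (fun x => - f x) (- ratr p.1)) x}.
    by apply: filterS => x hx p; apply: (hx (pickle p)); rewrite pickleK.
  apply/ae_foralln => k; case: (unpickle k) => [p|]; last by apply: aeW => x.
  have [p12|p12] := boolP (p.1 < p.2); last by apply: aeW => x q [<-] /(negP p12).
  exists (exceeds f (ratr p.2) `&` exceeds (fun x => - f x) (- ratr p.1)); split.
  - apply: measurableI; apply: measurable_exceeds => //; exact: measurable_funN.
  - by apply: (oscillation_null mf fM); rewrite ltr_rat.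
  - by move=> x /= /existsNP[q /not_implyP[[<-]] /not_implyP[_ /contrapT]].
apply: filterS h => x hx.
apply: (no_oscillation_cvg (fun n => birkhoff_avg_le n x fM)) => a b ab fb fa.
(* Two rationals strictly between [a] and [b] leave the positive margins that [exceeds] requires on
   either side. *)
have [q1 /= ] := rat_in_itvoo ab; rewrite in_itv/= => /andP[aq1 q1b].
have [q2 /= ] := rat_in_itvoo q1b; rewrite in_itv/= => /andP[q12 q2b].
apply: (hx (q1, q2)) => /=; first by rewrite -(ltr_rat R).
have inv (c e : R) : c < e -> exists k : nat, c + k.+1%:R^-1 <= e.
  by move=> ce; have [k ?] := ltr_add_invr ce; exists k; exact: ltW.
split => /=.
  by have [k kb] := inv _ _ q2b; exists k; exact: freq_gt_le fb.
have [k kb] := inv (- ratr q1) (- a) ltac:(lra); exists k; apply: freq_gt_le kb _.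
by under eq_fun do rewrite birkhoff_avgN.
Qed.

End birkhoff.

(** * Reversible systems *)

Section reversible.
Context d (X : measurableType d) (R : realType).
Variable mu : {finite_measure set X -> \bar R}.
Variables T J : X -> X.
Hypothesis mpT : measure_preserving mu T.
Hypothesis mpJ : measure_preserving mu J.
Hypothesis JJ : involutive J.
Hypothesis TJT : {ae mu, forall x, T (J (T x)) = J x}.
Variable f : X -> R.
Hypothesis mf : measurable_fun setT f.
Hypothesis f01 : forall x, 0 <= f x <= 1.
Hypothesis fJT : {ae mu, forall x, f (J (T x)) = 1 - f x}.

Let mT : measurable_fun setT T. Proof. by case: mpT. Qed.
Let mJ : measurable_fun setT J. Proof. by case: mpJ. Qed.
Let I (g : X -> R) := (\int[mu]_x g x)%R.
Let r := birkhoff_lim T f.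

Let fle x : `|f x| <= 1.
Proof. by have /andP[f0 f1] := f01 x; rewrite ger0_norm. Qed.

Let bf : bounded_mfun f. Proof. by split => //; exists 1. Qed.

Lemma measurable_birkhoff_lim : measurable_fun setT r.
Proof. by apply: measurable_limn => n; exact: (measurable_birkhoff_avg mpT). Qed.

Lemma birkhoff_lim_bounds x : 0 <= r x <= 1.
Proof.
have avg01 n : 0 <= birkhoff_avg T f n x <= 1.
  have := birkhoff_avg_le T n x fle; rewrite ler_norml => /andP[_ ->]; rewrite andbT.
  by rewrite divr_ge0// sumr_ge0// => k _; case/andP: (f01 (iter k T x)).
have [cx|ncx] := pselect (cvg (birkhoff_avg T f ^~ x @ \oo)); last first.
  by rewrite /r /birkhoff_lim (dvgP ncx) lexx ler01.
apply/andP; split.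
  by apply: limr_ge => //; near=> n; case/andP: (avg01 n).
by apply: limr_le => //; near=> n; case/andP: (avg01 n).
Unshelve. all: by end_near. Qed.

Let br : bounded_mfun r.
Proof.
split; first exact: measurable_birkhoff_lim.
by exists 1 => x; have /andP[r0 r1] := birkhoff_lim_bounds x; rewrite ger0_norm.
Qed.

(** Invariance of [h] and of [mu] makes the integral of [h] against [f \o iter k T] independent of
    [k], hence equal to the one against every average; bounded convergence passes to the limit. This
    replaces the description of [r] as a conditional expectation. *)
Lemma integral_invariant_avg h : bounded_mfun h ->
  {ae mu, forall x, h (T x) = h x} ->
  I (fun x => h x * r x) = I (fun x => h x * f x).
Proof.
move=> bh hT.
have bfk k : bounded_mfun (fun x => f (iter k T x)).
  exact: (bounded_mfun_comp (measurable_iter mpT k) bf).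
have Ik k : I (fun x => h x * f (iter k T x)) = I (fun x => h x * f x).
  elim: k => // k IH; rewrite -IH.
  have bhk : bounded_mfun (fun x => h x * f (iter k T x)) by exact: bounded_mfunM.
  rewrite /I -[RHS](bintegral_comp mpT bhk); apply: ae_eq_bintegral.
  - exact: bounded_mfunM.
  - exact: (bounded_mfun_comp mT bhk).
  - by apply: filterS hT => x ->; rewrite iterSr.
have IS n : I (fun x => h x * birkhoff_sum T f n x) = n%:R * I (fun x => h x * f x).
  elim: n => [|n IH].
    rewrite mul0r -(mul0r (I (cst 0))) /I -bintegralZl; last exact: bounded_mfun_cst.
    by congr Rintegral; apply/funext => x; rewrite /birkhoff_sum big_ord0 mulr0 mul0r.
  have bS : bounded_mfun (birkhoff_sum T f n).
    rewrite /birkhoff_sum; elim: n {IH} => [|n IH].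
      by under eq_fun do rewrite big_ord0; exact: bounded_mfun_cst.
    by under eq_fun do rewrite big_ord_recr/=; exact: bounded_mfunD.
  rewrite -natr1 mulrDl mul1r -IH -(Ik n) /I -bintegralD; last 2 first.
  - exact: bounded_mfunM.
  - exact: bounded_mfunM.
  by congr Rintegral; apply/funext => x; rewrite /birkhoff_sum big_ord_recr/= mulrDr.
have IA n : I (fun x => h x * birkhoff_avg T f n x) = I (fun x => h x * f x).
  have n1 : n.+1%:R != 0 :> R by rewrite pnatr_eq0.
  apply: (mulfI n1); rewrite -IS /I -bintegralZl.
    congr Rintegral; apply/funext => x; rewrite /birkhoff_avg -/(birkhoff_sum T f n.+1 x).
    by field.
  apply: bounded_mfunM => //; split; first exact: (measurable_birkhoff_avg mpT).
  by exists 1 => x; exact: birkhoff_avg_le.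
have [mh [M hM]] := bh.
have : (fun n => I (fun x => h x * birkhoff_avg T f n x)) @ \oo --> I (fun x => h x * r x).
  apply: (@bintegral_cvg _ _ _ mu _ _ M).
  - by move=> n; apply: measurable_funM => //; exact: (measurable_birkhoff_avg mpT).
  - by apply: measurable_funM => //; exact: measurable_birkhoff_lim.
  - move=> n x; rewrite normrM -[M]mulr1 ler_pM//; exact: birkhoff_avg_le.
  - by apply: filterS (birkhoff mpT bf) => x cx; apply: cvgMr.
under eq_fun do rewrite IA; move=> cI.
by rewrite -(cvg_lim _ cI)// lim_cst.
Qed.

(* The deviation [D = r \o J - 1 + r] is invariant, and integrating any invariant
   function against it gives zero, since [J \o T] turns [f] into [1 - f]. *)
Theorem birkhoff_lim_reversed : {ae mu, forall x, r (J x) = 1 - r x}.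
Proof.
have bD : bounded_mfun (fun x => r (J x) - (1 - r x)).
  apply: bounded_mfunB; first exact: bounded_mfun_comp.
  by apply: bounded_mfunB => //; exact: bounded_mfun_cst.
set D := fun x => _ in bD.
suff /(bintegral_sqr_eq0 bD) : I (fun x => D x * D x) = 0.
  by apply: filterS => x /eqP; rewrite subr_eq0 => /eqP.
have rT x : r (T x) = r x by exact: (birkhoff_lim_invariant T x fle).
(* By invariance [r (J (T x))] is [r (T (J (T x)))], which is [r (J x)] by reversibility. *)
have DT : {ae mu, forall x, D (T x) = D x}.
  by apply: filterS TJT => x TJTx; rewrite /D -(rT (J (T x))) TJTx rT.
(* With [h := D], writing one factor of [D x * D x] as [r (J x) - (1 - r x)] makes the integral
   vanish. *)
suff key h : bounded_mfun h -> {ae mu, forall x, h (T x) = h x} ->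
    I (fun x => h x * r (J x)) = I h - I (fun x => h x * r x).
  have bDr := bounded_mfunM bD br.
  have bDrJ := bounded_mfunM bD (bounded_mfun_comp mJ br).
  have -> : (fun x => D x * D x) = fun x => D x * r (J x) - (D x - D x * r x).
    by apply/funext => x; rewrite /D; ring.
  rewrite /I bintegralB//; last exact: bounded_mfunB.
  by rewrite (bintegralB _ bD bDr) -!/(I _) key// subrr.
move=> bh hT.
have bhJ := bounded_mfun_comp mJ bh.
have bhJr := bounded_mfunM bhJ br; have bhJf := bounded_mfunM bhJ bf.
have mpJT := measure_preserving_comp mpJ mpT.
(* The function [h \o J] is invariant too, as [T \o J \o T] agrees with [J] almost everywhere; so
   the averaging identity also applies to it. *)
have hJT : {ae mu, forall x, h (J (T x)) = h (J x)}.
  have := measure_preserving_ae mpJT hT.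
  by apply: filterS2 TJT => x /= -> ->.
transitivity (I (fun x => h (J x) * r x)).
  rewrite /I -(bintegral_comp mpJ bhJr); congr Rintegral.
  by apply/funext => x; rewrite JJ.
rewrite integral_invariant_avg// integral_invariant_avg//.
have bhf := bounded_mfunM bh bf.
(* Substituting [J (T x)] for [x] turns [h (J x) * f x] into [h (T x) * (1 - f x)], which is
   [h x * (1 - f x)] almost everywhere. *)
rewrite /I -(bintegral_comp mpJT bhJf) -bintegralB//; apply: ae_eq_bintegral.
- exact: (bounded_mfun_comp (proj1 mpJT) bhJf).
- exact: bounded_mfunB.
- by apply: filterS2 hT fJT => x /= hTx fx; rewrite JJ fx hTx; ring.
Qed.

End reversible.

(** * Elementary real analysis *)

Section real_functions.
Variable R : realType.

Lemma derivable_approx (f : R -> R) (a e : R) : derivable f a 1 -> 0 < e ->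
  exists2 d : R, 0 < d & forall s, `|s - a| < d ->
    `|f s - f a - derive1 f a * (s - a)| <= e * `|s - a|.
Proof.
move=> df e0; have : (fun h => h^-1 *: (f (h + a) - f a)) @ 0^' --> derive1 f a.
  have := df; rewrite /derivable [X in X @ _](_ : _ = fun h => h^-1 *: (f (h + a) - f a))//.
  by apply/funext => h /=; rewrite [h%:A]mulr1.
move=> /cvgrPdist_lt/(_ e e0) [d /= d0 H]; exists d => // s sa.
have [->|sa0] := eqVneq s a; first by rewrite !subrr mulr0 subrr normr0 mulr0.
have := H (s - a); rewrite /= sub0r normrN => /(_ sa).
rewrite subr_eq0 => /(_ sa0); rewrite subrK => /ltW.
have n0 : 0 < `|s - a| by rewrite normr_gt0 subr_eq0.
rewrite -(ler_pM2r n0) -normrM; congr (_ <= _); rewrite distrC; congr (`| _ |).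
by rewrite /GRing.scale/=; field; rewrite subr_eq0.
Qed.

Lemma continuous_pos_lower_bound (f : R -> R) a b : continuous f ->
  (forall s, a <= s <= b -> 0 < f s) ->
  exists2 m : R, 0 < m & forall s, a <= s <= b -> m <= f s.
Proof.
move=> cf f0; have [ab|ba] := leP a b; last first.
  by exists 1 => // s /andP[as_ sb]; have := le_lt_trans (le_trans as_ sb) ba; rewrite ltxx.
have [c cab fc] := EVT_min ab (continuous_subspaceT cf).
exists (f c); first by apply: f0; move: cab; rewrite in_itv.
by move=> s sab; apply: fc; rewrite in_itv.
Qed.

Lemma continuous_sqrt_comp (f : R -> R) :
  continuous f -> continuous (fun s => Num.sqrt (f s)).
Proof.
by move=> cf s; exact: (@continuous_comp R R R f Num.sqrt s (cf s) (@sqrt_continuous R _)).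
Qed.

(* Principal square root of the complex number [X + iY] with [X > 0]. *)
Lemma continuous_csqrt (X Y : R -> R) : continuous X -> continuous Y ->
  (forall s, 0 < X s) ->
  let h1 s := Num.sqrt ((Num.sqrt (X s ^+ 2 + Y s ^+ 2) + X s) / 2) in
  let h2 s := Y s / (2 * h1 s) in
  [/\ continuous h1, continuous h2,
      forall s, h1 s ^+ 2 - h2 s ^+ 2 = X s & forall s, 2 * h1 s * h2 s = Y s].
Proof.
move=> cX cY X0 h1 h2.
have ch1 : continuous h1.
  apply: continuous_sqrt_comp => s; apply: cvgM; last exact: cvg_cst.
  apply: cvgD; last exact: cX.
  apply: (@continuous_sqrt_comp (fun s => X s ^+ 2 + Y s ^+ 2)) => {}s.
  by apply: cvgD; rewrite ?expr2; [exact: (cvgM (cX s) (cX s))|exact: (cvgM (cY s) (cY s))].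
have h10 s : 0 < h1 s.
  by rewrite sqrtr_gt0 divr_gt0// ltr_wpDl// sqrtr_ge0.
have e2 s : 2 * h1 s * h2 s = Y s.
  by rewrite /h2; field; exact: lt0r_neq0.
split => //.
  move=> s; apply: cvgM; first exact: cY.
  apply: cvgV; first by rewrite mulf_neq0 ?lt0r_neq0.
  by apply: cvgM; [exact: cvg_cst|exact: ch1].
move=> s; rewrite /h2.
have -> : h1 s ^+ 2 = (Num.sqrt (X s ^+ 2 + Y s ^+ 2) + X s) / 2.
  by rewrite sqr_sqrtr// divr_ge0// addr_ge0 ?sqrtr_ge0// ltW.
rewrite expr_div_n exprMn.
have -> : h1 s ^+ 2 = (Num.sqrt (X s ^+ 2 + Y s ^+ 2) + X s) / 2.
  by rewrite sqr_sqrtr// divr_ge0// addr_ge0 ?sqrtr_ge0// ltW.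
have r2 : Num.sqrt (X s ^+ 2 + Y s ^+ 2) ^+ 2 = X s ^+ 2 + Y s ^+ 2.
  by rewrite sqr_sqrtr// addr_ge0// sqr_ge0.
have r0 := sqrtr_ge0 (X s ^+ 2 + Y s ^+ 2).
move: (Num.sqrt _) r2 r0 => r r2 r0.
have -> : Y s ^+ 2 = r ^+ 2 - X s ^+ 2 by rewrite r2; ring.
by have rX : r + X s != 0 by [rewrite lt0r_neq0// ltr_wpDl]; field.
Qed.

Lemma continuous_same_sign (f : R -> R) a b : continuous f -> a <= b ->
  (forall s, a <= s <= b -> f s != 0) -> 0 < f a * f b.
Proof.
move=> cf ab f0; rewrite ltNge; apply/negP => fab.
have [|c] := @IVT R f a b 0 ab (continuous_subspaceT cf).
  have [fa|fa] := leP 0 (f a); have [fb|fb] := leP 0 (f b).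
  - have fa0 : 0 < f a by rewrite lt_neqAle fa eq_sym f0// lexx.
    have fb0 : 0 < f b by rewrite lt_neqAle fb eq_sym f0// lexx ab.
    by have := mulr_gt0 fa0 fb0; rewrite ltNge fab.
  - by rewrite ge_min le_max fa (ltW fb) orbT.
  - by rewrite ge_min le_max fb (ltW fa) orbT.
  - by have := nmulr_rgt0 (f b) fa; rewrite fb ltNge fab.
by rewrite in_itv/= => /f0 /eqP.
Qed.

End real_functions.

(** * The boundary near a smooth point, and winding numbers modulo 2 *)

Section table.
Variables (R : realType) (L : R) (x y : R -> R) (Om : set (R * R)).
Hypothesis table : billiard_table L x y Om.

Let dx : R -> R := derive1 x.
Let dy : R -> R := derive1 y.
Implicit Types (s t e : R).

(** The base point is left out: [0] and [L] give the same boundary point, whereas a parameter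
    strictly between them is determined by its point within all of [[0, L]]. *)
Definition smooth_at (s : R) : Prop :=
  [/\ 0 < s < L, derivable x s 1, derivable y s 1 & dx s ^+ 2 + dy s ^+ 2 = 1].

Let L0 : 0 < L. Proof. by case: table => -[]. Qed.
Let cx : continuous x. Proof. by case: table => -[]. Qed.
Let cy : continuous y. Proof. by case: table => -[]. Qed.
Let xL s : x (s + L) = x s. Proof. by case: table => -[_ _ _ /(_ s)[]]. Qed.
Let yL s : y (s + L) = y s. Proof. by case: table => -[_ _ _ /(_ s)[]]. Qed.
Let inj s t : 0 <= s < L -> 0 <= t < L -> gamma x y s = gamma x y t -> s = t.
Proof. by case: table => -[_ _ _ _ h _ _ _ _]; exact: h. Qed.
Let openOm : open Om. Proof. by case: table => _ _ []. Qed.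
Let connOm : connected Om. Proof. by case: table => _ _ []. Qed.
Let bdry : closure Om `\` Om = gamma x y @` `[0, L].
Proof. by case: table. Qed.

Lemma curve_not_in s : 0 <= s <= L -> ~ Om (gamma x y s).
Proof.
move=> sL; have : (gamma x y @` `[0, L]) (gamma x y s).
  by exists s => //=; rewrite in_itv.
by rewrite -bdry => -[].
Qed.

Lemma curve_period p s : gamma x y s = p ->
  exists2 t, 0 <= t <= L & gamma x y t = p.
Proof.
have shift k t : gamma x y (t + k%:R * L) = gamma x y t.
  elim: k => [|k IH]; first by rewrite mul0r addr0.
  by rewrite -natr1 mulrDl mul1r addrA /gamma xL yL.
have [s0 sp|s0 sp] := leP 0 s.
  pose k := Num.truncn (s / L).
  have /andP[k1 k2] : k%:R <= s / L < k.+1%:R.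
    by apply: truncn_itv; rewrite divr_ge0// ltW.
  exists (s - k%:R * L); last by rewrite -sp -[in RHS](subrK (k%:R * L) s) shift.
  move: k1 k2; rewrite ler_pdivlMr// ltr_pdivrMr// -natr1 mulrDl mul1r; lra.
pose k := Num.truncn (- s / L).
have /andP[k1 k2] : k%:R <= - s / L < k.+1%:R.
  by apply: truncn_itv; rewrite divr_ge0// ltW// oppr_gt0.
exists (s + k.+1%:R * L); last by rewrite shift.
by move: k1 k2; rewrite ler_pdivlMr// ltr_pdivrMr// -natr1 mulrDl mul1r; lra.
Qed.

Lemma curve_not_in_all s : ~ Om (gamma x y s).
Proof. by have [t tL <-] := @curve_period _ s erefl; exact: curve_not_in. Qed.

Lemma curve_inj s t : 0 < s < L -> 0 <= t <= L -> gamma x y t = gamma x y s -> t = s.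
Proof.
move=> /andP[s0 sL] /andP[t0]; rewrite le_eqVlt => /orP[/eqP ->|tL] st; last first.
  by apply: inj => //; rewrite ?t0 ?tL// (ltW s0).
have gL : gamma x y L = gamma x y 0 by rewrite /gamma -[L]add0r xL yL.
have : s = 0 by apply: inj; rewrite ?lexx ?L0 ?(ltW s0)//= -st gL.
by move=> s00; rewrite s00 ltxx in s0.
Qed.

(** Together with [normal], the coordinates of [gamma s - gamma s0] in the orthonormal frame formed
    by the unit tangent and the left normal at [s0]. *)
Definition tangential s0 s := (x s - x s0) * dx s0 + (y s - y s0) * dy s0.
Definition normal s0 s := (y s - y s0) * dx s0 - (x s - x s0) * dy s0.

Lemma local_curve s0 e : smooth_at s0 -> 0 < e ->
  exists2 r, 0 < r & forall s, 0 <= s <= L ->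
    (x s - x s0) ^+ 2 + (y s - y s0) ^+ 2 < r ->
    `|tangential s0 s - (s - s0)| <= e * `|s - s0| /\
    `|normal s0 s| <= e * `|s - s0|.
Proof.
move=> [sL ex ey unit] e0.
have e2 : 0 < e / 2 by rewrite divr_gt0.
have [d1 d10 h1] := derivable_approx ex e2.
have [d2 d20 h2] := derivable_approx ey e2.
have [dxb dyb] : `|dx s0| <= 1 /\ `|dy s0| <= 1.
  by rewrite !ler_norml; split; apply/andP; split; nra.
pose d := Num.min d1 d2.
pose f s := (x s - x s0) ^+ 2 + (y s - y s0) ^+ 2.
have cf : continuous f.
  move=> s; rewrite /f /continuous_at.
  by apply: cvgD; rewrite ?expr2; apply: cvgM; apply: cvgB;
    [exact: cx|exact: cvg_cst|exact: cx|exact: cvg_cst|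
     exact: cy|exact: cvg_cst|exact: cy|exact: cvg_cst].
have d0 : 0 < d by rewrite lt_min d10.
have f0 s : 0 <= s <= L -> s != s0 -> 0 < f s.
  move=> sL' ss0; rewrite lt_neqAle addr_ge0 ?sqr_ge0// andbT eq_sym.
  apply: contraNN ss0; rewrite paddr_eq0 ?sqr_ge0// !sqrf_eq0 !subr_eq0.
  by move=> /andP[/eqP xs /eqP ys]; apply/eqP/curve_inj => //; rewrite /gamma xs ys.
(* The distance to [gamma s0] is bounded below on the two compact parameter intervals that remain
   after removing a neighbourhood of [s0]; either of them may be empty. *)
have [|m1 m10 hm1] := @continuous_pos_lower_bound _ f 0 (s0 - d) cf.
  by move=> s ?; apply: f0; [lra|apply/eqP; lra].
have [|m2 m20 hm2] := @continuous_pos_lower_bound _ f (s0 + d) L cf.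
  by move=> s ?; apply: f0; [lra|apply/eqP; lra].
exists (Num.min m1 m2); first by rewrite lt_min m10.
move=> s sL'; rewrite lt_min => /andP[fm1 fm2].
have sd : `|s - s0| < d.
  rewrite ltr_norml; apply/andP; split; rewrite ltNge; apply/negP => sd.
    by have := hm1 s ltac:(lra); rewrite leNgt fm1.
  by have := hm2 s ltac:(lra); rewrite leNgt fm2.
have /h1 k1 : `|s - s0| < d1 by apply: lt_le_trans sd _; rewrite ge_min lexx.
have /h2 k2 : `|s - s0| < d2 by apply: lt_le_trans sd _; rewrite ge_min lexx orbT.
rewrite -/(dx s0) in k1; rewrite -/(dy s0) in k2.
set A := x s - x s0 - _ in k1; set B := y s - y s0 - _ in k2.
have key (a b : R) : `|a| <= 1 -> `|b| <= 1 -> `|A * a + B * b| <= e * `|s - s0|.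
  move=> a1 b1; rewrite (le_trans (ler_normD _ _))// !normrM.
  rewrite [X in _ <= X](_ : _ = e / 2 * `|s - s0| * 1 + e / 2 * `|s - s0| * 1); last by field.
  by rewrite lerD// ler_pM.
split.
  rewrite (_ : _ - _ = A * dx s0 + B * dy s0); first exact: key.
  rewrite /tangential /A /B -[X in _ - X]mulr1 -unit; ring.
rewrite (_ : normal _ _ = A * (- dy s0) + B * dx s0); first by apply: key; rewrite ?normrN.
by rewrite /normal /A /B; ring.
Qed.

Lemma continuous_pair (f g : R -> R) : continuous f -> continuous g ->
  continuous (fun l => (f l, g l)).
Proof. by move=> cf cg l; exact: (cvg_pair (cf l) (cg l)). Qed.

(** The path has a connected image. [Om] is open in it, and also closed because the image avoids the
    curve, which is all of [closure Om] outside [Om]. *)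
Lemma path_stays_in (q : R -> R * R) : continuous q -> Om (q 0) ->
  (forall l : R, 0 <= l <= 1 -> forall s, 0 <= s <= L -> gamma x y s <> q l) -> Om (q 1).
Proof.
move=> cq q0 qn; pose B := q @` `[0, 1].
have cB : connected B.
  apply: connected_continuous_connected; last exact: continuous_subspaceT.
  exact: segment_connected.
have BOm : B `&` Om = B.
  apply: cB.
  - by exists (q 0); split => //; exists 0 => //=; rewrite in_itv/= lexx ler01.
  - by exists Om.
  - exists (closure Om); first exact: closed_closure.
    apply/seteqP; split => p [Bp Omp]; split => //; first exact: subset_closure.
    apply: contrapT => nOm; have : (closure Om `\` Om) p by [].
    rewrite bdry => -[s /=]; rewrite in_itv/= => sL ps.
    by case: Bp => l /=; rewrite in_itv/= => l01 lp; apply: (qn l l01 s sL); rewrite ps lp.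
have : B (q 1) by exists 1 => //=; rewrite in_itv/= lexx ler01.
by rewrite -BOm => -[].
Qed.

(* Components of a direction [v] along the unit tangent and the left normal at [s]. *)
Definition dirT s (v : R * R) := v.1 * dx s + v.2 * dy s.
Definition dirN s (v : R * R) := v.2 * dx s - v.1 * dy s.

Definition along s (v : R * R) (t : R) : R * R := (x s + t * v.1, y s + t * v.2).

(** Near [s0] the curve stays in a narrow cone around the tangent, and a direction with enough
    normal component stays outside this cone. The radius depends on the bounds [m] and [k] only, so
    it serves a whole family of directions at once. *)
Lemma transversal_hit_only_at s0 (m k : R) : smooth_at s0 -> 0 < m -> 0 <= k ->
  exists2 r, 0 < r & forall (v : R * R) t s, 0 <= s <= L ->
    m <= `|dirN s0 v| -> `|dirT s0 v| <= k -> 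
    t ^+ 2 * (v.1 ^+ 2 + v.2 ^+ 2) < r ->
    gamma x y s = along s0 v t -> s = s0 /\ t = 0.
Proof.
move=> sm m0 k0.
(* The bound [1 / 2] yields [|s - s0| <= 2 * |t| * k]; the other one yields [2 * e * k < m], which
   then forces [t = 0]. *)
pose e := Num.min (1 / 2) (m / (4 * (k + 1))).
have e0 : 0 < e by rewrite lt_min divr_gt0//= divr_gt0// mulr_gt0//; lra.
have e1 : e <= 1 / 2 by rewrite ge_min lexx.
have e2 : 2 * e * k < m.
  have : e <= m / (4 * (k + 1)) by rewrite ge_min lexx orbT.
  have k1 : 0 < 4 * (k + 1) by rewrite mulr_gt0//; lra.
  by rewrite ler_pdivlMr//; nra.
have [r r0 loc] := local_curve sm e0; exists r => // v t s sL vm vk tr [] xs ys.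
have [] := loc s sL.
  by rewrite xs ys !(addrC _ (t * _)) !addrK !exprMn -mulrDr.
have -> : tangential s0 s = t * dirT s0 v by rewrite /tangential xs ys /dirT; ring.
have -> : normal s0 s = t * dirN s0 v by rewrite /normal xs ys /dirN; ring.
rewrite normrM => h1 h2.
have h3 : `|s - s0| <= 2 * (`|t| * k).
  have := lerB_normD (s - s0) (t * dirT s0 v - (s - s0)).
  rewrite subrKC normrM => h4.
  have : `|t| * `|dirT s0 v| <= `|t| * k by rewrite ler_wpM2l.
  have : e * `|s - s0| <= 1 / 2 * `|s - s0| by rewrite ler_wpM2r.
  by lra.
have t0 : t = 0.
  apply/eqP; rewrite -normr_le0 leNgt; apply/negP => t0.
  have : `|t| * m <= `|t| * `|dirN s0 v| by rewrite ler_wpM2l.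
  have : e * `|s - s0| <= e * (2 * (`|t| * k)) by rewrite ler_wpM2l// ltW.
  have : `|t| * (2 * e * k) < `|t| * m by rewrite ltr_pM2l.
  by lra.
split => //; move: h3; rewrite t0 normr0 mul0r mulr0 normr_le0 subr_eq0 => /eqP//.
Qed.

(** Orientation provides this for the normal direction only. The normal is turned linearly into [v]
    with [t] fixed; the normal component stays bounded below, so the moving point never touches the
    curve and remains in [Om]. *)
Lemma inward_ray_enters s0 (v : R * R) : smooth_at s0 -> 0 < dirN s0 v ->
  exists2 t0, 0 < t0 & forall t, 0 < t < t0 -> Om (along s0 v t).
Proof.
move=> sm vN; have [sL ex ey unit] := sm.
pose N : R * R := (- dy s0, dx s0).
have NN : dirN s0 N = 1 by rewrite /dirN/= -unit; ring.
have NT : dirT s0 N = 0 by rewrite /dirT/=; ring.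
have [t1 t10 HN] : exists2 t1, 0 < t1 & forall t, 0 < t < t1 -> Om (along s0 N t).
  have por : positively_oriented L x y Om by case: table.
  have : (derive1 x s0, derive1 y s0) != (0, 0).
    apply/eqP => -[dx0 dy0]; have := unit; rewrite /dx /dy dx0 dy0 !expr0n addr0.
    by move=> /eqP; rewrite eq_sym oner_eq0.
  have s0L : 0 <= s0 < L by lra.
  move=> /(por s0 s0L ex ey) [t1 /= t10 H]; exists t1 => // t /andP[t0 tt1].
  rewrite /along/= mulrN; apply: H => //=.
  by rewrite sub0r normrN gtr0_norm.
pose m := Num.min 1 (dirN s0 v).
have m0 : 0 < m by rewrite lt_min ltr01.
have [r r0 H] := transversal_hit_only_at sm m0 (normr_ge0 (dirT s0 v)).
(* [C] bounds the squared length of each intermediate direction [w l]; as [t < 1], the condition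
   [t < r / C] gives [t ^ 2 * C < r]. *)
pose C := (1 + `|v.1|) ^+ 2 + (1 + `|v.2|) ^+ 2.
have C1 : 1 <= C.
  by rewrite /C; have := normr_ge0 v.1; have := normr_ge0 v.2; nra.
pose t2 := Num.min t1 (Num.min 1 (r / C)).
have C0 : 0 < C by lra.
exists t2; first by rewrite !lt_min t10 ltr01 divr_gt0.
move=> t /andP[t0]; rewrite !lt_min => /and3P[tt1 tt2 ttr].
pose w (l : R) : R * R := (N.1 + l * (v.1 - N.1), N.2 + l * (v.2 - N.2)).
have w1 : w 1 = v by rewrite /w !mul1r !(addrC N.1) !(addrC N.2) !subrK; case: (v).
have w0 : w 0 = N by rewrite /w !mul0r !addr0.
rewrite -w1; apply: (@path_stays_in (fun l => along s0 (w l) t)).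
- by apply: continuous_pair => l /=;
  (apply: cvgD; first exact: cvg_cst); (apply: cvgM; first exact: cvg_cst);
  (apply: cvgD; first exact: cvg_cst); (apply: cvgM; last exact: cvg_cst); exact: cvg_id.
- by rewrite w0; apply: HN; rewrite t0.
move=> l l01 s sL' gs.
have wN : dirN s0 (w l) = (1 - l) + l * dirN s0 v.
  have -> : dirN s0 (w l) = (1 - l) * dirN s0 N + l * dirN s0 v.
    by rewrite /dirN /w/=; ring.
  by rewrite NN mulr1.
have wT : dirT s0 (w l) = l * dirT s0 v.
  have -> : dirT s0 (w l) = (1 - l) * dirT s0 N + l * dirT s0 v.
    by rewrite /dirT /w/=; ring.
  by rewrite NT mulr0 add0r.
have [] := H (w l) t s sL' _ _ _ gs.
- rewrite wN ger0_norm; last by nra.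
  have m1 : m <= 1 by rewrite ge_min lexx.
  have m2 : m <= dirN s0 v by rewrite ge_min lexx orbT.
  nra.
- rewrite wT normrM ger0_norm; last by lra.
  by rewrite -[X in _ <= X]mul1r ler_wpM2r//; lra.
- have wC : (w l).1 ^+ 2 + (w l).2 ^+ 2 <= C.
    have b1 : `|dx s0| <= 1 by rewrite !ler_norml; apply/andP; split; nra.
    have b2 : `|dy s0| <= 1 by rewrite !ler_norml; apply/andP; split; nra.
    have bnd (a b : R) : `|a| <= 1 -> (a + l * (b - a)) ^+ 2 <= (1 + `|b|) ^+ 2.
      move=> a1; rewrite -[X in X <= _]real_normK ?num_real// ler_sqr ?nnegrE ?addr_ge0//.
      rewrite (_ : _ + _ = (1 - l) * a + l * b); last by ring.
      rewrite (le_trans (ler_normD _ _))// !normrM.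
      rewrite (ger0_norm (_ : 0 <= l)) ?(ger0_norm (_ : 0 <= 1 - l)); [|lra..].
      by have := normr_ge0 a; have := normr_ge0 b; nra.
    by rewrite /C lerD// /w/=; apply: bnd; rewrite ?normrN.
  rewrite (le_lt_trans (ler_wpM2l (sqr_ge0 t) wC))//.
  move: ttr; rewrite ltr_pdivlMr//; apply: le_lt_trans; rewrite ler_wpM2r// ?ltW//.
  nra.
by move=> _ t00; rewrite t00 ltxx in t0.
Qed.

(* [p] and [q] have the same mod 2 winding number: along the curve,
   [(gamma - p) * conj (gamma - q)] has a continuous periodic complex square root. *)
Definition same_winding (p q : R * R) : Prop :=
  exists h1 h2 : R -> R,
    [/\ continuous h1, continuous h2,
        forall s, h1 (s + L) = h1 s /\ h2 (s + L) = h2 s,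
        forall s, h1 s ^+ 2 - h2 s ^+ 2 =
          (x s - p.1) * (x s - q.1) + (y s - p.2) * (y s - q.2) &
        forall s, 2 * h1 s * h2 s =
          (y s - p.2) * (x s - q.1) - (x s - p.1) * (y s - q.2)].

Lemma same_winding_sym p q : same_winding p q -> same_winding q p.
Proof.
move=> [h1 [h2 [c1 c2 per re im]]]; exists h1, (fun s => - h2 s); split => //.
- by move=> s; apply: cvgN; exact: c2.
- by move=> s; have [-> ->] := per s.
- by move=> s; rewrite sqrrN re; ring.
- by move=> s; rewrite mulrN im; ring.
Qed.

Let sqdist (q : R * R) s := (x s - q.1) ^+ 2 + (y s - q.2) ^+ 2.

Let cxB (a : R) : continuous (fun s => x s - a).
Proof. by move=> s; apply: cvgB; [exact: cx|exact: cvg_cst]. Qed.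

Let cyB (a : R) : continuous (fun s => y s - a).
Proof. by move=> s; apply: cvgB; [exact: cy|exact: cvg_cst]. Qed.

Let cM (f g : R -> R) : continuous f -> continuous g -> continuous (fun s => f s * g s).
Proof. by move=> cf cg s; exact: (cvgM (cf s) (cg s)). Qed.

Let cD (f g : R -> R) : continuous f -> continuous g -> continuous (fun s => f s + g s).
Proof. by move=> cf cg s; exact: (cvgD (cf s) (cg s)). Qed.

Let cB (f g : R -> R) : continuous f -> continuous g -> continuous (fun s => f s - g s).
Proof. by move=> cf cg s; exact: (cvgB (cf s) (cg s)). Qed.

Let sqdist_cont q : continuous (sqdist q).
Proof. by rewrite /sqdist; apply: cD; under eq_fun do rewrite expr2; exact: cM. Qed.

Let sqdist_gt0 q s : Om q -> 0 < sqdist q s.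
Proof.
move=> Oq; rewrite lt_neqAle addr_ge0 ?sqr_ge0// andbT eq_sym.
rewrite paddr_eq0 ?sqr_ge0// !sqrf_eq0 !subr_eq0; apply/negP => /andP[/eqP xs /eqP ys].
by apply: (@curve_not_in_all s); rewrite /gamma xs ys; case: (q) Oq.
Qed.

(** The product of the two complex square roots, divided by the distance from the curve to [q], is a
    square root for [p] and [r]. Membership of [q] in [Om] keeps that distance positive. *)
Lemma same_winding_trans p q r : Om q ->
  same_winding p q -> same_winding q r -> same_winding p r.
Proof.
move=> Oq [h1 [h2 [c1 c2 per re im]]] [k1 [k2 [d1 d2 per' re' im']]].
pose n s := Num.sqrt (sqdist q s).
have n0 s : n s != 0 by rewrite /n gt_eqF// sqrtr_gt0 sqdist_gt0.
have n2 s : n s ^+ 2 = sqdist q s by rewrite sqr_sqrtr// ltW// sqdist_gt0.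
have cn : continuous (fun s => (n s)^-1).
  by move=> s; apply: cvgV => //; apply: continuous_sqrt_comp.
have nL s : n (s + L) = n s by rewrite /n /sqdist xL yL.
exists (fun s => (h1 s * k1 s - h2 s * k2 s) / n s),
  (fun s => (h1 s * k2 s + h2 s * k1 s) / n s); split.
- by apply: cM => //; apply: cB; exact: cM.
- by apply: cM => //; apply: cD; exact: cM.
- by move=> s; have [-> ->] := per s; have [-> ->] := per' s; rewrite nL.
- move=> s; rewrite !expr_div_n -mulrBl n2.
  have -> : (h1 s * k1 s - h2 s * k2 s) ^+ 2 - (h1 s * k2 s + h2 s * k1 s) ^+ 2 =
    (h1 s ^+ 2 - h2 s ^+ 2) * (k1 s ^+ 2 - k2 s ^+ 2) -
    (2 * h1 s * h2 s) * (2 * k1 s * k2 s) by ring.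
  rewrite re re' im im'; apply: (canLR (mulfK _)); first by rewrite gt_eqF ?sqdist_gt0.
  by rewrite /sqdist; ring.
- move=> s.
  have -> : 2 * ((h1 s * k1 s - h2 s * k2 s) / n s) * ((h1 s * k2 s + h2 s * k1 s) / n s) =
    ((h1 s ^+ 2 - h2 s ^+ 2) * (2 * k1 s * k2 s) +
    (2 * h1 s * h2 s) * (k1 s ^+ 2 - k2 s ^+ 2)) / n s ^+ 2 by field.
  rewrite re re' im im' n2; apply: (canLR (mulfK _)); first by rewrite gt_eqF ?sqdist_gt0.
  by rewrite /sqdist; ring.
Qed.

(** For [q'] close to [q] the number to be rooted has positive real part, so its principal square
    root is continuous, and it is periodic because the number is. *)
Lemma same_winding_near q : Om q -> \forall q' \near q, same_winding q q'.
Proof.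
move=> Oq.
have [|m m0 hm] := @continuous_pos_lower_bound _ _ 0 L (@sqdist_cont q).
  by move=> s _; exact: sqdist_gt0.
have {}hm s : m <= sqdist q s.
  have [t tL [xt yt]] := @curve_period _ s erefl.
  by rewrite /sqdist -xt -yt; exact: hm.
(* Twice the real part is at least the squared distance from the curve to [q] minus the squared
   distance from [q] to [q']; this [e] keeps the latter below [m]. *)
pose e := Num.min 1 (m / 8).
have e0 : 0 < e by rewrite lt_min ltr01 divr_gt0.
have e4 : 4 * e ^+ 2 < m.
  have : e <= 1 by rewrite ge_min lexx.
  have : e <= m / 8 by rewrite ge_min lexx orbT.
  by nra.
exists (ball q.1 e, ball q.2 e) => /=; first by split; exact: nbhsx_ballx.
move=> [q1 q2] [/= b1 b2].
have {}b1 : `|q.1 - q1| < e by exact: b1.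
have {}b2 : `|q.2 - q2| < e by exact: b2.
pose X s := (x s - q.1) * (x s - q1) + (y s - q.2) * (y s - q2).
pose Y s := (y s - q.2) * (x s - q1) - (x s - q.1) * (y s - q2).
have cX : continuous X by apply: cD; exact: cM.
have cY : continuous Y by apply: cB; exact: cM.
have X0 s : 0 < X s.
  have := hm s; rewrite /sqdist /X; set a := x s - q.1; set b := y s - q.2 => hab.
  have -> : x s - q1 = a + (q.1 - q1) by rewrite /a; ring.
  have -> : y s - q2 = b + (q.2 - q2) by rewrite /b; ring.
  move: b1 b2; rewrite !ltr_norml; move: (q.1 - q1) (q.2 - q2) a b hab => d1 d2 a b hab.
  move=> b1 b2.
  have d1e : d1 ^+ 2 < e ^+ 2 by nra.
  have d2e : d2 ^+ 2 < e ^+ 2 by nra.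
  by have := sqr_ge0 (a + d1); have := sqr_ge0 (b + d2); rewrite !sqrrD !mulrDr; lra.
have [c1 c2 re im] := continuous_csqrt cX cY X0.
do 2 eexists; split; [exact: c1|exact: c2| |exact: re|exact: im].
by move=> s; rewrite /X /Y !xL !yL.
Qed.

Lemma same_winding_Om p q : Om p -> Om q -> same_winding p q.
Proof.
move=> Op Oq; pose C := Om `&` [set q | same_winding p q].
suff CE : C = Om by move: Oq; rewrite -CE => -[].
have refl r : Om r -> same_winding r r.
  by move=> Or; exact: (nbhs_singleton (same_winding_near Or)).
apply: connOm.
- by exists p; split => //; exact: refl.
- exists C; last by rewrite setIA setIid.
  rewrite openE => r [Or pr]; rewrite /interior.
  have h : \forall r' \near r, Om r' by exact: open_nbhs_nbhs.
  near=> r'; split; first by near: r'.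
  apply: (same_winding_trans Or pr); near: r'; exact: same_winding_near.
- exists (closure C); first exact: closed_closure.
  apply/seteqP; split => r; first by move=> [Or pr]; split => //; exact: subset_closure.
  move=> [Or cr]; split => //.
  have [r' [[Or' pr'] rr']] := cr _ (same_winding_near Or).
  exact: (same_winding_trans Or' pr' (same_winding_sym rr')).
Unshelve. all: by end_near. Qed.

(** Were both points in [Om], there would be a periodic square root [h1 + i h2]. Its real part
    vanishes only where the curve meets the segment between the points, that is at [s0], so [h1] has
    the same sign just after and, one period later, just before [s0]. But [h2] keeps its sign near
    [s0], while [h1 * h2] changes sign there because the curve crosses the line transversally. *)
Lemma two_sided_impossible s0 (v : R * R) : smooth_at s0 -> dirN s0 v != 0 ->
  exists2 t0, 0 < t0 &
    forall t, 0 < t < t0 -> Om (along s0 v t) -> Om (along s0 v (- t)) -> False.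
Proof.
move=> sm vN0; have [sL _ _ unit] := sm.
pose V := v.1 ^+ 2 + v.2 ^+ 2.
have V0 : 0 < V.
  rewrite lt_neqAle addr_ge0 ?sqr_ge0// andbT eq_sym; apply: contraNN vN0.
  rewrite paddr_eq0 ?sqr_ge0// !sqrf_eq0 => /andP[/eqP v1 /eqP v2].
  by rewrite /dirN v1 v2 !mul0r subrr.
pose K := dirN s0 v; pose P := dirT s0 v.
have K0 : 0 < `|K| by rewrite normr_gt0.
have [r r0 H] := transversal_hit_only_at sm K0 (normr_ge0 P).
exists (Num.min 1 (r / V)); first by rewrite lt_min ltr01 divr_gt0.
move=> t; rewrite lt_min ltr_pdivlMr// => /and3P[t0 t1 tV] Op Oq.
have {}tV : t ^+ 2 * V < r by apply: le_lt_trans tV; rewrite ler_wpM2r ?(ltW V0)//; nra.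
have [h1 [h2 [c1 c2 per re im]]] := same_winding_Om Op Oq.
pose g1 s := x s - x s0; pose g2 s := y s - y s0.
pose crs s := g1 s * v.2 - g2 s * v.1.
have {}im s : h1 s * h2 s = - t * crs s.
  have := im s; rewrite /along/= => ims.
  suff : 2 * (h1 s * h2 s) = 2 * (- t * crs s) by lra.
  by rewrite mulrA ims /crs /g1 /g2; ring.
have {}re s : h1 s ^+ 2 - h2 s ^+ 2 = g1 s ^+ 2 + g2 s ^+ 2 - t ^+ 2 * V.
  by rewrite re /along/= /g1 /g2 /V; ring.
(* If [h1 s = 0], the number being rooted is real and not positive, which places [gamma s] on the
   segment between the two points. *)
have zero s : 0 <= s <= L -> h1 s = 0 -> s = s0.
  move=> sL' h10.
  have cr0 : crs s = 0.
    have := im s; rewrite h10 mul0r => /esym/eqP; rewrite mulf_eq0 oppr_eq0 gt_eqF//=.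
    by move/eqP.
  have gV : g1 s ^+ 2 + g2 s ^+ 2 <= t ^+ 2 * V.
    by have := re s; rewrite h10; have := sqr_ge0 (h2 s); lra.
  pose u := (g1 s * v.1 + g2 s * v.2) / V.
  have Vn : V != 0 by rewrite gt_eqF.
  have g1E : g1 s = u * v.1.
    have : g1 s * V = (g1 s * v.1 + g2 s * v.2) * v.1.
      by apply/eqP; rewrite -subr_eq0 -(mulr0 v.2) -cr0 /V /crs; apply/eqP; ring.
    by rewrite /u mulrAC => <-; rewrite mulfK.
  have g2E : g2 s = u * v.2.
    have : g2 s * V = (g1 s * v.1 + g2 s * v.2) * v.2.
      by apply/eqP; rewrite -subr_eq0 -(mulr0 (- v.1)) -cr0 /V /crs; apply/eqP; ring.
    by rewrite /u mulrAC => <-; rewrite mulfK.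
  have [||-> //] := H v u s sL' (lexx _) (lexx _).
    apply: le_lt_trans tV; apply: le_trans gV.
    by rewrite g1E g2E !exprMn mulrDr.
  by rewrite /along -g1E -g2E /g1 /g2 /gamma !subrKC.
(* With this tolerance the deviation of the curve from its tangent costs at most half of the main
   term [K ^ 2 * (s - s0) ^ 2]. *)
pose e := `|K| / (2 * (`|K| + `|P|)).
have KP : 0 < `|K| + `|P| by rewrite ltr_wpDr.
have e0 : 0 < e by rewrite divr_gt0// mulr_gt0.
have [r' r'0 loc] := local_curve sm e0.
have crs_sign s : 0 <= s <= L -> g1 s ^+ 2 + g2 s ^+ 2 < r' -> s != s0 ->
    0 < crs s * K * (s - s0).
  move=> sL' /(loc s sL') [la lc] ss0.
  have sq0 : 0 < (s - s0) ^+ 2 by rewrite exprn_even_gt0//= subr_eq0.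
  have -> : crs s * K * (s - s0) = K ^+ 2 * (s - s0) ^+ 2 +
      K * (s - s0) * ((tangential s0 s - (s - s0)) * K - normal s0 s * P).
    have -> : crs s = tangential s0 s * K - normal s0 s * P.
      rewrite /crs -[X in X = _]mulr1 -unit /K /P /dirN /dirT /tangential /normal /g1 /g2.
      by ring.
    by ring.
  set E := _ * K - _; have Eb : `|E| <= `|K| / 2 * `|s - s0|.
    rewrite (le_trans (ler_normB _ _))// !normrM.
    rewrite (_ : `|K| / 2 * _ = e * `|s - s0| * `|K| + e * `|s - s0| * `|P|).
      by rewrite lerD// ler_wpM2r.
    by rewrite /e; field; rewrite gt_eqF.
  have : `|K * (s - s0) * E| <= K ^+ 2 * (s - s0) ^+ 2 / 2.
    rewrite !normrM -(real_normK (num_real K)) -(real_normK (num_real (s - s0))).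
    have /(ler_wpM2l (mulr_ge0 (normr_ge0 K) (normr_ge0 (s - s0)))) := Eb.
    by move=> /le_trans; apply; rewrite le_eqVlt; apply/orP; left; apply/eqP; field.
  rewrite ler_norml => /andP[+ _].
  by have : 0 < K ^+ 2 * (s - s0) ^+ 2 by [rewrite mulr_gt0// exprn_even_gt0]; lra.
have h20 : h2 s0 != 0.
  apply/eqP => h20; have := re s0; rewrite h20 /g1 /g2 !subrr !expr0n/= subr0 addr0 sub0r.
  by have := sqr_ge0 (h1 s0); have : 0 < t ^+ 2 * V by [rewrite mulr_gt0// exprn_gt0]; lra.
have nears : \forall s \near s0, 0 < h2 s * h2 s0 /\ g1 s ^+ 2 + g2 s ^+ 2 < r'.
  apply: filterI.
    have : (fun s => h2 s * h2 s0) @ s0 --> h2 s0 * h2 s0.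
      by apply: cvgM; [exact: c2|exact: cvg_cst].
    move=> /cvgr_gt; apply.
    by rewrite -expr2 exprn_even_gt0.
  have : sqdist (x s0, y s0) @ s0 --> sqdist (x s0, y s0) s0 by exact: sqdist_cont.
  move=> /cvgr_lt; apply.
  by rewrite /sqdist/= !subrr expr0n/= addr0.
case: nears => d /= d0 hd.
pose n := Num.min d (Num.min s0 (L - s0)) / 2.
have n0 : 0 < n by rewrite divr_gt0// !lt_min d0; lra.
have [nd ns nL] : [/\ n < d, n < s0 & n < L - s0].
  have : Num.min d (Num.min s0 (L - s0)) <= d by rewrite ge_min lexx.
  have : Num.min d (Num.min s0 (L - s0)) <= s0 by rewrite !ge_min lexx orbT.
  have : Num.min d (Num.min s0 (L - s0)) <= L - s0 by rewrite !ge_min lexx !orbT.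
  by move: n0; rewrite /n; split; lra.
have [a2 ar] : 0 < h2 (s0 + n) * h2 s0 /\ g1 (s0 + n) ^+ 2 + g2 (s0 + n) ^+ 2 < r'.
  by apply: hd; rewrite /= opprD addrA subrr sub0r normrN gtr0_norm.
have [b2 br] : 0 < h2 (s0 - n) * h2 s0 /\ g1 (s0 - n) ^+ 2 + g2 (s0 - n) ^+ 2 < r'.
  by apply: hd; rewrite /= subKr gtr0_norm.
have ca := crs_sign (s0 + n) ltac:(lra) ar ltac:(apply/eqP; lra).
have cb := crs_sign (s0 - n) ltac:(lra) br ltac:(apply/eqP; lra).
(* Going once around the curve, from just after [s0] to just before [s0 + L], [h1] has no zero. *)
have : 0 < h1 (s0 + n) * h1 (s0 - n + L).
  apply: continuous_same_sign => //; first by lra.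
  move=> s sn; apply/eqP => h1s; have [sL'|sL'] := leP s L.
    by have := zero s ltac:(lra) h1s; lra.
  have h1s' : h1 (s - L) = 0 by rewrite -h1s -[in RHS](subrK L s); have [-> _] := per (s - L).
  by have := zero (s - L) ltac:(lra) h1s'; lra.
have [-> _] := per (s0 - n) => h11.
have ia := im (s0 + n); have ib := im (s0 - n).
rewrite addrAC subrr add0r in ca.
rewrite addrAC subrr add0r mulrN oppr_gt0 in cb.
have ca' : 0 < crs (s0 + n) * K by rewrite -(pmulr_lgt0 _ n0).
have cb' : crs (s0 - n) * K < 0 by rewrite -(pmulr_llt0 _ n0).
have pos : 0 < (h1 (s0 + n) * h1 (s0 - n)) * ((h2 (s0 + n) * h2 s0) * (h2 (s0 - n) * h2 s0)).
  by rewrite mulr_gt0// mulr_gt0.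
have neg : (crs (s0 + n) * K) * (crs (s0 - n) * K) < 0 by rewrite pmulr_rlt0.
have K2 : 0 < K ^+ 2 by rewrite exprn_even_gt0.
have hh : 0 < h2 s0 ^+ 2 by rewrite exprn_even_gt0.
have e1 : (h1 (s0 + n) * h1 (s0 - n)) * ((h2 (s0 + n) * h2 s0) * (h2 (s0 - n) * h2 s0)) =
   (h1 (s0 + n) * h2 (s0 + n)) * (h1 (s0 - n) * h2 (s0 - n)) * h2 s0 ^+ 2 by ring.
rewrite e1 ia ib (pmulr_lgt0 _ hh) in pos.
have e2 : (- t * crs (s0 + n)) * (- t * crs (s0 - n)) * K ^+ 2 =
  t ^+ 2 * (crs (s0 + n) * K * (crs (s0 - n) * K)) by ring.
have : 0 < (- t * crs (s0 + n)) * (- t * crs (s0 - n)) * K ^+ 2 by rewrite mulr_gt0.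
by rewrite e2 pmulr_rgt0 ?exprn_gt0// ltNge (ltW neg).
Qed.

End table.

(** * Reversal of a single chord *)

Section reflection.
Variables (R : realType) (L : R) (x y : R -> R) (Om : set (R * R)).
Hypothesis table : billiard_table L x y Om.

Let dx : R -> R := derive1 x.
Let dy : R -> R := derive1 y.
Implicit Types (s t th : R) (v z : R * R).

Notation smooth := (smooth_at L x y).
Notation ray := (along x y).
Notation phi := (billiard_map L x y Om).

Let L0 : 0 < L. Proof. by case: table => -[]. Qed.
Let inj s t : 0 <= s < L -> 0 <= t < L -> gamma x y s = gamma x y t -> s = t.
Proof. by case: table => -[_ _ _ _ h _ _ _ _]; exact: h. Qed.
Let openOm : open Om. Proof. by case: table => _ _ []. Qed.

Let unitE s : smooth s -> dx s ^+ 2 + dy s ^+ 2 = 1.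
Proof. by case. Qed.

Lemma dirT_bdir s th : smooth s -> dirT x y s (bdir x y (s, th)) = cos th.
Proof.
move=> /unitE unit; rewrite /dirT /bdir/= -/dx -/dy -[RHS]mulr1 -unit; ring.
Qed.

Lemma dirN_bdir s th : smooth s -> dirN x y s (bdir x y (s, th)) = sin th.
Proof.
move=> /unitE unit; rewrite /dirN /bdir/= -/dx -/dy -[RHS]mulr1 -unit; ring.
Qed.

Lemma bdir_unit s th : smooth s ->
  (bdir x y (s, th)).1 ^+ 2 + (bdir x y (s, th)).2 ^+ 2 = 1.
Proof.
move=> /unitE unit; rewrite /bdir/= -/dx -/dy -[RHS]mulr1 -{1}unit -(cos2Dsin2 th); ring.
Qed.

Lemma dirTN_eq s v w : smooth s ->
  dirT x y s v = dirT x y s w -> dirN x y s v = dirN x y s w -> v = w.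
Proof.
move=> /unitE unit eT eN.
have rec u : u = (dirT x y s u * dx s - dirN x y s u * dy s,
                  dirT x y s u * dy s + dirN x y s u * dx s).
  case: u => a b; rewrite /dirT /dirN/= -/dx -/dy; congr pair.
    by rewrite -[LHS]mulr1 -unit; ring.
  by rewrite -[LHS]mulr1 -unit; ring.
by rewrite (rec v) (rec w) eT eN.
Qed.

Lemma bcoordK s : 0 <= s < L -> bcoord L x y (gamma x y s) = s.
Proof.
move=> sL; rewrite /bcoord; apply: xget_unique => // t [tL ts].
exact: inj.
Qed.

Lemma bcoord_boundary p : (closure Om `\` Om) p ->
  0 <= bcoord L x y p < L /\ gamma x y (bcoord L x y p) = p.
Proof.
have -> : closure Om `\` Om = gamma x y @` `[0, L] by case: table.
move=> [s /=]; rewrite in_itv/= => /andP[s0]; rewrite le_eqVlt => /orP[/eqP ->|sL] <-.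
  have -> : gamma x y L = gamma x y 0.
    rewrite -[L]add0r /gamma; have [_ _ _ per _] : simple_closed_curve L x y by case: table.
    by have [-> ->] := per 0.
  by rewrite bcoordK lexx.
by rewrite bcoordK s0.
Qed.

Lemma continuous_ray s v : continuous (ray s v).
Proof.
apply: continuous_pair => t /=; (apply: cvgD; first exact: cvg_cst);
  (apply: cvgM; last exact: cvg_cst); exact: cvg_id.
Qed.

Lemma ray_exits s v : v.1 ^+ 2 + v.2 ^+ 2 = 1 -> exists2 t, 0 < t & ~ Om (ray s v t).
Proof.
move=> v1; have [M OM] : bounded2 Om by case: table => _ _ [].
(* A unit vector satisfies [|v.1| + |v.2| >= 1], so a ray point inside the bounding box has time at
   most [2 * |M| + |x s| + |y s|]. *)
exists (2 * `|M| + `|x s| + `|y s| + 1) => [|/OM [/=]].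
  by rewrite ltr_wpDl// !addr_ge0// mulr_ge0.
set t := _ + 1 => b1 b2.
have t0 : 0 <= t by rewrite /t !addr_ge0// mulr_ge0.
have n1 : 1 <= `|v.1| + `|v.2|.
  have := real_normK (num_real v.1); have := real_normK (num_real v.2).
  by have := normr_ge0 v.1; have := normr_ge0 v.2; nra.
have c1 : t * `|v.1| <= `|M| + `|x s|.
  have := lerB_normD (t * v.1) (x s); rewrite (addrC (t * v.1)) normrM (ger0_norm t0).
  by have := ler_norm M; lra.
have c2 : t * `|v.2| <= `|M| + `|y s|.
  have := lerB_normD (t * v.2) (y s); rewrite (addrC (t * v.2)) normrM (ger0_norm t0).
  by have := ler_norm M; lra.
have : t * 1 <= t * (`|v.1| + `|v.2|) by rewrite ler_wpM2l.
by rewrite mulrDr; rewrite {1}/t; lra.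
Qed.

(** Openness of [Om] puts the point at the infimum outside [Om], and the points just before it put
    it into the closure. *)
Lemma first_exit s v t0 : v.1 ^+ 2 + v.2 ^+ 2 = 1 -> 0 < t0 ->
  (forall t, 0 < t < t0 -> Om (ray s v t)) ->
  let T := inf [set t : R | 0 < t /\ ~ Om (ray s v t)] in
  [/\ 0 < T, forall t, 0 < t < T -> Om (ray s v t) & (closure Om `\` Om) (ray s v T)].
Proof.
move=> v1 t00 H; set A := [set t | _] => T.
have A0 : A !=set0 by have [t ? ?] := ray_exits s v1; exists t.
have lbA : lbound A t0.
  by move=> t [t0' nO]; rewrite leNgt; apply/negP => tt0; apply/nO/H; rewrite t0'.
have hlA : has_lbound A by exists t0.
have T0 : 0 < T by apply: lt_le_trans t00 _; exact: lb_le_inf.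
have TO t : 0 < t < T -> Om (ray s v t).
  move=> /andP[t0' tT]; apply: contrapT => nO.
  have : T <= t by apply: ge_inf => //; split.
  by rewrite leNgt tT.
split => //; split.
  move=> B /(@continuous_ray s v T _) [d /= d0 hd].
  pose t := T - Num.min T d / 2.
  have m0 : 0 < Num.min T d by rewrite lt_min T0.
  have mT : Num.min T d <= T by rewrite ge_min lexx.
  have md : Num.min T d <= d by rewrite ge_min lexx orbT.
  exists (ray s v t); split; first by apply: TO; rewrite /t; lra.
  by apply: hd; rewrite /= /t subKr gtr0_norm; lra.
move=> OT; have : nbhs (ray s v T) Om by exact: open_nbhs_nbhs.
move=> /(@continuous_ray s v T _) [d /= d0 hd].
have [a [a0 aO] aT] := inf_adherent d0 (conj A0 hlA).
have Ta : T <= a by apply: ge_inf.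
apply/aO/hd; rewrite /= distrC ger0_norm; rewrite -/T in aT; lra.
Qed.

Definition reverse z : R * R := (z.1, pi - z.2).

Lemma hit_spec s th (z := (s, th)) (v := bdir x y z) (T := hit_time x y Om z) :
  smooth s -> 0 < th < pi ->
  [/\ 0 < T, forall t, 0 < t < T -> Om (ray s v t),
      0 <= (phi z).1 < L & gamma x y (phi z).1 = ray s v T].
Proof.
move=> sm th0.
have [t0 t00 H] : exists2 t0, 0 < t0 & forall t, 0 < t < t0 -> Om (ray s v t).
  by apply: (inward_ray_enters table sm); rewrite dirN_bdir// sin_gt0_pi.
have [T0 TO bd] := first_exit (bdir_unit th sm) t00 H.
by have [b1 b2] := bcoord_boundary bd; split.
Qed.

Lemma phiE z (s := bcoord L x y (hit_point x y Om z)) :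
  phi z = (s, acos (dirT x y s (bdir x y z))).
Proof. by []. Qed.

(** The chord leaves [Om] at its endpoint, so the reversed reflected ray has direction [- v]. It
    runs back through points of [Om] until time [T], when it reaches [gamma s]; hence it has the
    same hit time. *)
Lemma billiard_reversal s th (z := (s, th)) : smooth s -> 0 < th < pi ->
  smooth (phi z).1 -> dirN x y (phi z).1 (bdir x y z) != 0 ->
  [/\ 0 < (reverse (phi z)).2 < pi, phi (reverse (phi z)) = reverse z,
      bdir x y (reverse (phi z)) = (- (bdir x y z).1, - (bdir x y z).2) &
      (phi z).1 != s].
Proof.
move=> sm th0 sm' vN0; set v := bdir x y z in vN0 *.
have [T0 TO s'L gs'] := hit_spec sm th0.
set s' := (phi z).1 in sm' vN0 gs' s'L *; rewrite -/z -/v in T0 TO gs'.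
set T := hit_time x y Om z in T0 TO gs' *.
have v1 : v.1 ^+ 2 + v.2 ^+ 2 = 1 by exact: bdir_unit.
have dTv : dirT x y s v = cos th by exact: dirT_bdir.
have phiz : phi z = (s', acos (dirT x y s' v)) by [].
clearbody T s' v.
have xs' : x s' = x s + T * v.1 := congr1 fst gs'.
have ys' : y s' = y s + T * v.2 := congr1 snd gs'.
have back t : ray s' v (- t) = ray s v (T - t).
  by rewrite /along xs' ys'; congr pair; ring.
(* If [v] pointed inward at the endpoint, the line would have points of [Om] on both sides of a
   transversal boundary point. *)
have vN : dirN x y s' v < 0.
  rewrite lt_neqAle vN0 leNgt/=; apply/negP => vN.
  have [t1 t10 H1] := inward_ray_enters table sm' vN.
  have [t2 t20 H2] := two_sided_impossible table sm' vN0.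
  pose t := Num.min T (Num.min t1 t2) / 2.
  have m0 : 0 < Num.min T (Num.min t1 t2) by rewrite !lt_min T0 t10.
  have mT : Num.min T (Num.min t1 t2) <= T by rewrite ge_min lexx.
  have m1 : Num.min T (Num.min t1 t2) <= t1 by rewrite !ge_min lexx orbT.
  have m2 : Num.min T (Num.min t1 t2) <= t2 by rewrite !ge_min lexx !orbT.
  apply: (H2 t); [rewrite /t; lra| |].
    by apply: H1; rewrite /t; lra.
  by rewrite back; apply: TO; rewrite /t; lra.
pose th' := acos (dirT x y s' v).
rewrite -/th' in phiz.
have TN : dirT x y s' v ^+ 2 + dirN x y s' v ^+ 2 = 1.
  rewrite -v1; have unit := unitE sm'; rewrite /dirT /dirN -/dx -/dy.
  by rewrite -[RHS]mulr1 -unit; ring.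
have c1 : -1 < dirT x y s' v < 1 by apply/andP; split; nra.
have c1' : -1 <= dirT x y s' v <= 1 by lra.
have th'0 : 0 < th' < pi by rewrite /th' acos_gt0 ?acos_ltpi; lra.
have cth' : cos th' = dirT x y s' v by rewrite acosK// in_itv.
(* The reflected angle records only the tangential component through [acos]; the sign of the normal
   component is recovered from [v] pointing outward. *)
have sth' : sin th' = - dirN x y s' v.
  rewrite /th' sin_acos//.
  have -> : 1 - dirT x y s' v ^+ 2 = (- dirN x y s' v) ^+ 2 by rewrite -TN; ring.
  by rewrite sqrtr_sqr ger0_norm// oppr_ge0 ltW.
have bw : bdir x y (reverse (phi z)) = (- v.1, - v.2).
  rewrite phiz /reverse/=; apply: (dirTN_eq sm').
    rewrite dirT_bdir// cosB cospi sinpi mulN1r mul0r addr0 cth' /dirT/=; ring.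
  rewrite dirN_bdir// sinB cospi sinpi mul0r mulN1r sub0r opprK sth' /dirN/=; ring.
have [sL ex ey unit] := sm.
have htw : hit_time x y Om (reverse (phi z)) = T.
  rewrite /hit_time bw phiz/=.
  set A := [set t | _].
  have AE t : A t <-> 0 < t /\ ~ Om (ray s v (T - t)).
    by rewrite -back /A/= /along/= !mulrN !mulNr.
  apply/eqP; rewrite eq_le; apply/andP; split.
    apply: ge_inf.
      by exists 0 => t /AE[/ltW].
    apply/AE; split => //; rewrite subrr /along !mul0r !addr0.
    exact: (curve_not_in_all table).
  apply: lb_le_inf.
    exists T; apply/AE; split => //; rewrite subrr /along !mul0r !addr0.
    exact: (curve_not_in_all table).
  move=> t /AE[t0 nO]; rewrite leNgt; apply/negP => tT; apply: nO; apply: TO; lra.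
have hpw : hit_point x y Om (reverse (phi z)) = gamma x y s.
  transitivity (x s' + T * - v.1, y s' + T * - v.2).
    by rewrite /hit_point htw bw phiz.
  by rewrite xs' ys' /gamma; congr pair; ring.
split; [| |exact: bw|].
- by rewrite phiz /reverse/=; lra.
- have phiw w : bdir x y w = (- v.1, - v.2) -> hit_point x y Om w = gamma x y s ->
      phi w = (s, acos (dirT x y s (- v.1, - v.2))).
    by move=> e1 e2; rewrite phiE e2 e1 bcoordK//; lra.
  rewrite (phiw _ bw hpw) /reverse; congr pair.
  rewrite (_ : dirT x y s _ = - dirT x y s v); last by rewrite /dirT/=; ring.
  rewrite dTv acosN ?cosK//; first by rewrite in_itv/=; lra.
  by rewrite cos_geN1 cos_le1.
apply/eqP => ss'; have : gamma x y s = ray s v T by rewrite -gs' ss'.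
move=> e; have xs := congr1 fst e; have ys := congr1 snd e; rewrite /= in xs ys.
have [a0 b0] : T * v.1 = 0 /\ T * v.2 = 0 by split; lra.
have Tn : T != 0 by rewrite gt_eqF.
have v10 : v.1 = 0 by apply/eqP; move/eqP: a0; rewrite mulf_eq0 (negbTE Tn).
have v20 : v.2 = 0 by apply/eqP; move/eqP: b0; rewrite mulf_eq0 (negbTE Tn).
by move: v1; rewrite v10 v20 expr0n addr0 => /eqP; rewrite eq_sym oner_eq0.
Qed.

(** The two gains lead from [s] to [s'] and from [s'] back to [s]. They add up to one full turn
    because [s] and [s'] differ; for equal footpoints both would be [0]. *)
Lemma fgain_reversal s th (z := (s, th)) : smooth s -> 0 < th < pi ->
  smooth (phi z).1 -> dirN x y (phi z).1 (bdir x y z) != 0 ->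
  fgain L x y Om (reverse (phi z)) = L - fgain L x y Om z.
Proof.
move=> sm th0 sm' vN0; have [_ e _ ne] := billiard_reversal sm th0 sm' vN0.
have [/andP[_ sL] _ _ _] := sm; have [/andP[_ sL'] _ _ _] := sm'.
rewrite /fgain -/z e /= sL sL'.
case: (ltgtP s (phi z).1) ne => [h|h|->]; rewrite ?eqxx// => _; ring.
Qed.

End reflection.

(** * Measurability on the line and in the plane *)

Section plane_measurability.
Variable R : realType.

Lemma near_rat (a d : R) : 0 < d -> exists q : rat, `|ratr q - a| < d.
Proof.
move=> d0; have [q] := @rat_in_itvoo R (a - d) (a + d) ltac:(lra).
by rewrite in_itv/= => qa; exists q; rewrite ltr_norml; lra.
Qed.

(** The plane carries the product sigma-algebra; an open set is a union of boxes with rational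
    centres and radii [1 / (k + 1)], of which there are countably many. *)
Lemma open_measurable_plane (U : set (R * R)) : open U -> measurable U.
Proof.
move=> oU.
pose box (i : rat * rat * nat) : set (R * R) :=
  ball (ratr i.1.1 : R) (i.2.+1%:R^-1) `*` ball (ratr i.1.2 : R) (i.2.+1%:R^-1).
have -> : U = \bigcup_(i in [set i | box i `<=` U]) box i.
  apply/seteqP; split => [p Up|p [i iU ip]]; last exact: iU.
  have [[A B] /= [pA pB] AB] : nbhs p U by exact: open_nbhs_nbhs.
  have [e1 /= e10 eA] := pA; have [e2 /= e20 eB] := pB.
  have e0 : 0 < Num.min e1 e2 / 2 by rewrite divr_gt0// lt_min e10.
  have [k] := ltr_add_invr e0; rewrite add0r => ke.
  have k0 : 0 < k.+1%:R^-1 :> R by rewrite invr_gt0.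
  have [q1 h1] := near_rat p.1 k0; have [q2 h2] := near_rat p.2 k0.
  have m1 : Num.min e1 e2 <= e1 by rewrite ge_min lexx.
  have m2 : Num.min e1 e2 <= e2 by rewrite ge_min lexx orbT.
  exists (q1, q2, k); last by rewrite /box; split; [exact: h1|exact: h2].
 
  move=> q [/= b1 b2]; apply: AB; split => /=.
    apply: eA => /=; rewrite -(subrKA (ratr q1)) (le_lt_trans (ler_normD _ _))//.
    have := b1 : `|ratr q1 - q.1| < k.+1%:R^-1.
    by move: h1 ke; rewrite (distrC (ratr q1) p.1); move: (k.+1%:R^-1) => d; lra.
  apply: eB => /=; rewrite -(subrKA (ratr q2)) (le_lt_trans (ler_normD _ _))//.
  have := b2 : `|ratr q2 - q.2| < k.+1%:R^-1.
  by move: h2 ke; rewrite (distrC (ratr q2) p.2); move: (k.+1%:R^-1) => d; lra.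
rewrite bigcup_mkcond; apply: countable_bigcupT_measurable; first exact: countableP.
move=> i.
by case: ifP => // _; apply: measurableX; exact: measurable_ball.
Qed.

Lemma closed_measurable_plane (F : set (R * R)) : closed F -> measurable F.
Proof.
by move=> cF; rewrite -(setCK F); apply: measurableC; apply: open_measurable_plane;
  exact: closed_openC.
Qed.

Lemma acos_junk (a : R) : ~~ (-1 <= a <= 1) -> acos a = 0.
Proof.
move=> a1; rewrite unlock; apply: xgetPN => t [_ ta].
by move: a1; rewrite -ta cos_geN1 cos_le1.
Qed.

Lemma acos_bounds (a : R) : 0 <= acos a <= pi.
Proof.
have [a1|a1] := boolP (-1 <= a <= 1); first by rewrite acos_ge0 ?acos_lepi.
by rewrite acos_junk// lexx pi_ge0.
Qed.

(** On [[-1, 1]] the function agrees with its composition with a clipping map, which is monotone on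
    the whole line; elsewhere it has the constant default [0]. *)
Lemma measurable_acos : measurable_fun setT (@acos R).
Proof.
have -> : [set: R] = `[-1, 1] `|` ~` `[-1, 1] by rewrite setUv.
apply/measurable_funU => //; first exact: measurableC.
split.
  pose clip (a : R) := Num.max (-1) (Num.min 1 a).
  apply: (eq_measurable_fun (acos \o clip)).
    move=> a; rewrite inE/= in_itv/= => /andP[a1 a2].
    by rewrite /clip min_r// max_r.
  apply: measurable_funTS; apply: nonincreasing_measurable => // a b ab /=.
  have cb c : -1 <= clip c <= 1 by rewrite /clip le_max lexx/= ge_max ge_min lexx !andbT/=; lra.
  have cab : clip a <= clip b by rewrite /clip ge_max le_max lexx/= le_max; apply/orP; right;
    rewrite le_min !ge_min lexx ab orbT.
  rewrite leNgt; apply/negP => lt.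
  have : cos (acos (clip b)) < cos (acos (clip a)).
    by rewrite ltr_cos// in_itv/= acos_bounds.
  by rewrite !acosK ?in_itv ?cb// ltNge cab.
apply: (eq_measurable_fun (fun _ : R => 0 : R)); last exact: measurable_cst.
by move=> a; rewrite inE/= in_itv/= => /negP a1; rewrite acos_junk.
Qed.

Lemma near_eq_derive1 (f g : R -> R) s : {near s, f =1 g} -> derive1 f s = derive1 g s.
Proof. by move=> fg; rewrite !derive1E; exact: near_eq_derive. Qed.

Lemma measurable_except_countable (f g : R -> R) (F : set R) :
  measurable_fun setT f -> countable F -> (forall s, ~ F s -> f s = g s) ->
  measurable_fun setT g.
Proof.
move=> mf cF fg _ B mB; rewrite setTI.
have -> : g @^-1` B = (F `&` g @^-1` B) `|` (~` F `&` f @^-1` B).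
  apply/seteqP; split => s /=.
    move=> Bs; have [Fs|Fs] := pselect (F s); first by left.
    by right; split => //; rewrite fg.
  by move=> [[]//|[Fs]]; rewrite fg.
have mF C : C `<=` F -> measurable C.
  by move=> CF; apply: countable_measurable; last exact: (sub_countable (subset_card_le CF) cF).
apply: measurableU; first by apply: mF => s [].
apply: measurableI; first by apply: measurableC; exact: mF.
by rewrite -[X in measurable X]setTI; exact: mf.
Qed.

(** Off [F] the derivative is the limit of the difference quotients with step [1 / (n + 1)], and a
    countable set does not affect measurability. *)
Lemma measurable_derive1 (f : R -> R) (F : set R) : continuous f -> countable F ->
  (forall s, ~ F s -> derivable f s 1) -> measurable_fun setT (derive1 f).
Proof.
move=> cf cF df.
pose q n s : R := (f (s + n.+1%:R^-1) - f s) * n.+1%:R.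
apply: (@measurable_except_countable (fun s => limn (q ^~ s)) _ F) => //.
  apply: measurable_limn => n; apply: continuous_measurable_fun => s.
  apply: cvgM; last exact: cvg_cst.
  apply: cvgB; last exact: cf.
  have cs : continuous (fun s : R => s + n.+1%:R^-1).
    by move=> t; apply: cvgD; [exact: cvg_id|exact: cvg_cst].
  exact: (@continuous_comp R R R (fun s => s + n.+1%:R^-1) f s (cs s) (cf _)).
move=> s /df {}df; apply: (cvg_lim (@Rhausdorff R)); apply/cvgrPdist_le => e e0.
have [d d0 hd] := derivable_approx df e0.
have /cvgrPdist_lt/(_ _ d0) : @harmonic R @ \oo --> (0 : R) by exact: cvg_harmonic.
apply: filterS => n; rewrite sub0r normrN /= => nd.
have n0 : 0 < n.+1%:R :> R by rewrite ltr0n.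
have i0 : 0 < n.+1%:R^-1 :> R by rewrite invr_gt0.
have := hd (s + n.+1%:R^-1); rewrite (addrC s) addrK => /(_ nd).
rewrite (ger0_norm (ltW i0)) -(ler_pM2r n0) -mulrA mulVf ?gt_eqF// mulr1.
rewrite -(ger0_norm (ltW n0)) -[X in _ * `| X |](ger0_norm (ltW n0)) -normrM distrC.
apply: le_trans; rewrite le_eqVlt; apply/orP; left; apply/eqP; congr (`| _ |).
by rewrite /q (addrC s) (ger0_norm (ltW n0)); field; rewrite gt_eqF.
Qed.

Lemma compact_image_measurable (g : R -> R * R) a b : continuous g ->
  measurable (g @` `[a, b]).
Proof.
move=> cg; apply: closed_measurable_plane; apply: compact_closed.
  by apply: norm_hausdorff.
apply: continuous_compact; first exact: continuous_subspaceT.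
exact: segment_compact.
Qed.

End plane_measurability.

(* The existential of [piecewise_smooth_arclength], with the breakpoints named. *)
Definition smooth_pieces (R : realType) (L : R) (x y : R -> R) (n : nat) (b : nat -> R) :=
  [/\ b 0%N = 0, b n = L,
      (forall i, (i < n)%N -> b i < b i.+1) &
      (forall i, (i < n)%N -> exists gx gy : R -> R,
         [/\ smooth_fun gx, smooth_fun gy &
             forall s, b i <= s <= b i.+1 ->
               [/\ gx s = x s, gy s = y s &
                   (derive1 gx s) ^+ 2 + (derive1 gy s) ^+ 2 = 1]])].

(** * Measurability of the billiard map *)

Section billiard_measurability.
Variables (R : realType) (L : R) (x y : R -> R) (Om : set (R * R)).
Hypothesis table : billiard_table L x y Om.
Notation phi := (billiard_map L x y Om).

Let dx : R -> R := derive1 x.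
Let dy : R -> R := derive1 y.
Let L0 : 0 < L. Proof. by case: table => -[]. Qed.
Let cx : continuous x. Proof. by case: table => -[]. Qed.
Let cy : continuous y. Proof. by case: table => -[]. Qed.
Let xL s : x (s + L) = x s. Proof. by case: table => -[_ _ _ /(_ s)[]]. Qed.
Let yL s : y (s + L) = y s. Proof. by case: table => -[_ _ _ /(_ s)[]]. Qed.
Let inj s t : 0 <= s < L -> 0 <= t < L -> gamma x y s = gamma x y t -> s = t.
Proof. by case: table => -[_ _ _ _ h _ _ _ _]; exact: h. Qed.
Let openOm : open Om. Proof. by case: table => _ _ []. Qed.

Lemma bcoord_bounds p : 0 <= bcoord L x y p < L.
Proof.
rewrite /bcoord; case: xgetP => [s _ []//|_].
by rewrite lexx.
Qed.

Lemma billiard_map_Phi z : Phi L (phi z).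
Proof.
split => /=; rewrite in_itv/=; last exact: acos_bounds.
by have /andP[-> /ltW ->] := bcoord_bounds (hit_point x y Om z).
Qed.

Let continuous_gamma : continuous (gamma x y).
Proof. exact: continuous_pair. Qed.

(** For [0 <= c < L] the set where the coordinate exceeds [c] is the compact curve minus the compact
    arc over [[0, c]]. Points off the curve have the default coordinate [0], and [gamma L] is
    removed because it is [gamma 0]. *)
Lemma measurable_bcoord : measurable_fun setT (bcoord L x y).
Proof.
apply: (measurability (@RGenOInfty.G R)) => [|/= _ [_] [c] -> <-].
  exact: RGenOInfty.measurableE.
rewrite setTI; have [c0|c0] := ltP c 0.
  rewrite (_ : _ @^-1` _ = setT)//; apply/seteqP; split => // p _ /=.
  by rewrite in_itv/= andbT (lt_le_trans c0)//; case/andP: (bcoord_bounds p).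
have [cL|cL] := ltP c L; last first.
  rewrite (_ : _ @^-1` _ = set0)//; apply/seteqP; split => // p /=.
  rewrite in_itv/= andbT => cp; have /andP[_] := bcoord_bounds p.
  by rewrite ltNge (ltW (le_lt_trans cL cp)).
rewrite (_ : _ @^-1` _ = gamma x y @` `[0, L] `\` gamma x y @` `[0, c]).
  by apply: measurableD; exact: compact_image_measurable.
apply/seteqP; split => p /=; rewrite in_itv/= andbT.
  rewrite /bcoord; case: xgetP => [s _ [/andP[s0 sL] sp] cs|_]; last first.
    by rewrite ltNge c0.
  split; first by exists s => //=; rewrite in_itv/= s0 ltW.
  move=> [t /=]; rewrite in_itv/= => /andP[t0 tc] tp.
  have ts : t = s by apply: inj; rewrite ?t0 ?s0 ?(le_lt_trans tc)// tp sp.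
  by move: cs; rewrite -ts ltNge tc.
move=> [[s /=]]; rewrite in_itv/= => /andP[s0 sL] sp np.
have {sL}sL : s < L.
  rewrite lt_neqAle sL andbT; apply/eqP => sE; apply: np; exists 0.
    by rewrite /= in_itv/= lexx.
  by rewrite -sp sE /gamma -[in RHS](add0r L) xL yL.
rewrite /bcoord; case: xgetP => [t _ [/andP[t0 tL] tp]|/(_ s)]; last first.
  by move=> h; exfalso; apply: h; split => //; rewrite s0 sL.
by rewrite ltNge; apply/negP => tc; apply: np; exists t => //=; rewrite in_itv/= t0.
Qed.

Let decomp (s : R) : exists k : int, 0 <= s - k%:~R * L < L.
Proof.
exists (Num.floor (s / L)).
have /andP[] := floor_itv (s / L); rewrite ler_pdivlMr// ltr_pdivrMr// intrD mulrDl mul1r.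
by lra.
Qed.

Let derivable_shift (f : R -> R) : (forall s, f (s + L) = f s) ->
  forall (k : int) s, derivable f (s - k%:~R * L) 1 -> derivable f s 1.
Proof.
move=> fL.
have fk (k : int) s : f (s - k%:~R * L) = f s.
  have fn (n : nat) t : f (t + n%:R * L) = f t.
    elim: n t => [|n IH] t; first by rewrite mul0r addr0.
    by rewrite -natr1 mulrDl mul1r addrA fL.
  case: k => k; first by rewrite -(fn k) subrK.
  by rewrite NegzE mulrNz mulNr opprK fn.
move=> k s; rewrite /derivable.
rewrite [X in cvg (X @ _) -> _](_ : _ = fun h => h^-1 *: ((f \o shift s) (h *: 1) - f s))//.
by apply/funext => h /=; rewrite addrA !fk.
Qed.

Variables (n : nat) (b : nat -> R).
Hypothesis pieces : smooth_pieces L x y n b.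

(** Strictly inside a smooth piece. Both [0] and [L] are breakpoints, so regular points satisfy the
    bounds that [smooth_at] demands. *)
Definition regular (s : R) : Prop := exists2 i, (i < n)%N & b i < s < b i.+1.

Lemma break_le i j : (i <= j <= n)%N -> b i <= b j.
Proof.
move=> /andP[ij jn]; rewrite -(subnKC ij) in jn *.
elim: (j - i)%N jn => [|k IH] kn; first by rewrite addn0.
rewrite addnS in kn *; have [_ _ bi _] := pieces.
by rewrite (le_trans (IH (ltnW kn)))// ltW// bi.
Qed.

Lemma regular_bounds s : regular s -> 0 < s < L.
Proof.
move=> [i ni /andP[bs sb]]; have [b0 bn _ _] := pieces.
rewrite -{1}b0 -bn (le_lt_trans _ bs) ?(lt_le_trans sb)//; apply: break_le; rewrite ?leqnn ?andbT//.
by rewrite leq0n ltnW.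
Qed.

Lemma regular_smooth s : regular s -> smooth_at L x y s.
Proof.
move=> rs; have sL := regular_bounds rs; case: rs => i ni /andP[bs sb].
have [_ _ _ /(_ i ni) [gx [gy [sx sy g]]]] := pieces.
have near_piece : \forall t \near s, b i <= t <= b i.+1.
  have : nbhs s `]b i, b i.+1[%classic.
    apply: open_nbhs_nbhs; split; first exact: interval_open.
    by rewrite /= in_itv/= bs.
  by apply: filterS => t /=; rewrite in_itv/= => /andP[/ltW -> /ltW ->].
have nx : {near s, gx =1 x}.
  by apply: filterS near_piece => t /g[].
have ny : {near s, gy =1 y}.
  by apply: filterS near_piece => t /g[].
split => //.
- exact: (near_eq_derivable nx (sx 0%N s)).
- exact: (near_eq_derivable ny (sy 0%N s)).
- rewrite -(near_eq_derive1 nx) -(near_eq_derive1 ny).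
  by have [|_ _ ->] := g s; first by rewrite (ltW bs) (ltW sb).
Qed.

Lemma not_break_regular s : 0 <= s <= L -> (forall i, (i <= n)%N -> s != b i) ->
  regular s.
Proof.
move=> /andP[s0 sL] sb; have [b0 bn _ _] := pieces.
have : s < b n by rewrite lt_neqAle sb//= bn.
have : (n <= n)%N by [].
elim: {1 3}n => [|k IH] kn sk; first by rewrite b0 ltNge s0 in sk.
have [sbk|bks] := ltP s (b k); first exact: IH (ltnW kn) sbk.
by exists k => //; rewrite sk lt_neqAle eq_sym sb ?bks// ltnW.
Qed.

(** Measurability of the derivatives is claimed on the whole line, so the breakpoints are translated
    by all multiples of the period. Only countability of the result matters. *)
Let breaks : set R := (fun p : nat * int => b p.1 + p.2%:~R * L) @` setT.

Let countable_breaks : countable breaks.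
Proof. by apply: sub_countable (card_image_le _ _) _; exact: countableP. Qed.

Let derivable_off_breaks s : ~ breaks s -> derivable x s 1 /\ derivable y s 1.
Proof.
move=> ns; have [k kL] := decomp s.
have [|_ d1 d2 _] := @regular_smooth (s - k%:~R * L).
  apply: not_break_regular => [|i ni]; first by have /andP[-> /ltW ->] := kL.
  apply/eqP => e; apply: ns; exists (i, k) => //=; by rewrite -e subrK.
by split; apply: derivable_shift; [exact: xL|exact: d1|exact: yL|exact: d2].
Qed.

Lemma measurable_dx : measurable_fun setT dx.
Proof.
by apply: (measurable_derive1 cx countable_breaks) => s /derivable_off_breaks[].
Qed.

Lemma measurable_dy : measurable_fun setT dy.
Proof.
by apply: (measurable_derive1 cy countable_breaks) => s /derivable_off_breaks[].
Qed.

Lemma measurable_bdir :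
  measurable_fun setT (fun z => (bdir x y z).1) /\
  measurable_fun setT (fun z => (bdir x y z).2).
Proof.
have mdx : measurable_fun [set: R * R] (fun z => dx z.1).
  exact: (measurableT_comp measurable_dx measurable_fst).
have mdy : measurable_fun [set: R * R] (fun z => dy z.1).
  exact: (measurableT_comp measurable_dy measurable_fst).
have mc : measurable_fun [set: R * R] (fun z => cos z.2).
  apply: (@measurableT_comp _ _ _ _ _ _ (@cos R) _ snd); last exact: measurable_snd.
  exact: (continuous_measurable_fun (@continuous_cos R)).
have ms : measurable_fun [set: R * R] (fun z => sin z.2).
  apply: (@measurableT_comp _ _ _ _ _ _ (@sin R) _ snd); last exact: measurable_snd.
  exact: (continuous_measurable_fun (@continuous_sin R)).
split; rewrite /bdir/=; first by apply: measurable_funB; exact: measurable_funM.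
by apply: measurable_funD; exact: measurable_funM.
Qed.

Let pt (t : R) (z : R * R) : R * R :=
  (x z.1 + t * (bdir x y z).1, y z.1 + t * (bdir x y z).2).

Let measurable_pt t : measurable_fun setT (pt t).
Proof.
have [m1 m2] := measurable_bdir.
have mx : measurable_fun [set: R * R] (fun z => x z.1).
  exact: (measurableT_comp (continuous_measurable_fun cx) measurable_fst).
have my : measurable_fun [set: R * R] (fun z => y z.1).
  exact: (measurableT_comp (continuous_measurable_fun cy) measurable_fst).
by apply/measurable_fun_pairP; split => /=; apply: measurable_funD => //;
  apply: measurable_funM => //; exact: measurable_cst.
Qed.

(** Open neighbourhoods shrinking to the closed complement of [Om]. A ray that meets one of them
    does so at a rational time, which need not be the case for the complement itself. *)
Let thick (k : nat) : set (R * R) := \bigcup_(f in ~` Om) (ball f (k.+1%:R^-1 : R)).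

Let open_thick k : open (thick k).
Proof.
by apply: bigcup_open => f _; apply: ball_open; rewrite invr_gt0.
Qed.

(** Times at which the ray is within [1 / (k + 1)] of the complement accumulate in the compact
    interval, and at a cluster point the ray cannot be in the open set [Om]. *)
Let thick_meets z (a c : R) :
  (forall k, exists2 t, a <= t <= c & thick k (pt t z)) ->
  exists2 t, a <= t <= c & ~ Om (pt t z).
Proof.
move=> H; apply: contrapT => nH.
pose tk k := projT1 (cid2 (H k)).
have tkP k : a <= tk k <= c /\ thick k (pt (tk k) z).
  by rewrite /tk; case: (cid2 (H k)).
have [t [/= tac clt]] : exists t, t \in `[a, c] /\ cluster (tk @ \oo) t.
  have := @segment_compact R a c (tk @ \oo) _ _.
  case=> [|t [tac clt]]; last by exists t.
  by exists 0%N => // k _ /=; rewrite in_itv/=; case: (tkP k).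
rewrite in_itv/= in tac.
have Ot : Om (pt t z) by apply: contrapT => nO; apply: nH; exists t.
have cpt : continuous (fun t => pt t z).
  by apply: continuous_pair => u /=; (apply: cvgD; first exact: cvg_cst);
    (apply: cvgM; last exact: cvg_cst); exact: cvg_id.
have [e /= e0 eOm] : nbhs_ball (pt t z) Om by apply/nbhs_ballP/open_nbhs_nbhs.
have e20 : 0 < e / 2 by rewrite divr_gt0.
have nt : nbhs t [set u | ball (pt t z) (e / 2) (pt u z)].
  by apply: (cpt t); exact: nbhsx_ballx.
have [K] := ltr_add_invr e20; rewrite add0r => Ke.
have nk : (tk @ \oo) [set u | exists2 k, (K <= k)%N & tk k = u].
  by exists K => // k /= Kk; exists k.
have [u [[k Kk <-] /= b1]] := clt _ _ nk nt.
have [_ [f nf b2]] := tkP k; apply: nf; apply: eOm.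
rewrite (splitr e); apply: ball_triangle b1 _; apply: ball_sym.
apply: le_ball b2; apply: ltW; apply: le_lt_trans Ke.
by rewrite lef_pV2 ?posrE// ler_nat ltnS.
Qed.

(** The uncountable union over [t] becomes a countable operation: rational times against thickened
    obstacles. The margin [1 / (m + 1)] confines the times to a compact interval, so that
    [thick_meets] leads back to an actual hit. *)
Let measurable_blocked (c : R) :
  measurable [set z | exists2 t, 0 < t < c & ~ Om (pt t z)].
Proof.
have -> : [set z | exists2 t, 0 < t < c & ~ Om (pt t z)] =
  \bigcup_m \bigcap_k \bigcup_(q in [set q : rat |
     (m.+1%:R^-1 : R) <= ratr q <= c - m.+1%:R^-1]) (pt (ratr q) @^-1` thick k).
  apply/seteqP; split => z.
    move=> [t /andP[t0 tc] nO].
    have [m m1] : exists m : nat, m.+1%:R^-1 < Num.min t (c - t).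
      have h : 0 < Num.min t (c - t) by rewrite lt_min t0 subr_gt0.
      by have [m] := ltr_add_invr h; rewrite add0r => ?; exists m.
    exists m => // k _.
    have [m2 m3] : m.+1%:R^-1 < t /\ m.+1%:R^-1 < c - t.
      by move: m1; rewrite lt_min => /andP.
    have cpt : continuous (fun t => pt t z).
      by apply: continuous_pair => u /=; (apply: cvgD; first exact: cvg_cst);
        (apply: cvgM; last exact: cvg_cst); exact: cvg_id.
    have : nbhs t [set u | thick k (pt u z)].
      apply: (cpt t); apply: open_nbhs_nbhs; split => //.
      by exists (pt t z) => //; apply: ballxx; rewrite invr_gt0.
    move=> [d /= d0 hd].
    move: (m.+1%:R^-1) m2 m3 => w m2 m3.
    pose d' := Num.min d (Num.min (t - w) (c - t - w)).
    have d'0 : 0 < d' by rewrite !lt_min d0; lra.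
    have [q qt] := near_rat t d'0.
    move: qt; rewrite !lt_min => /and3P[q1 q2 q3].
    exists q; last by apply: hd; rewrite /= distrC.
    by move: q2 q3; rewrite /= !ltr_norml; lra.
  move=> [m _ h]; have [|t tm nO] := @thick_meets z (m.+1%:R^-1) (c - m.+1%:R^-1).
    by move=> k; have [q qm tq] := h k Logic.I; exists (ratr q).
  exists t => //; have : 0 < m.+1%:R^-1 :> R by rewrite invr_gt0.
  by move: (m.+1%:R^-1) tm => w; lra.
apply: bigcupT_measurable => m; apply: bigcapT_measurable => k.
rewrite bigcup_mkcond; apply: countable_bigcupT_measurable; first exact: countableP.
move=> q; case: ifP => // _; rewrite -[X in measurable X]setTI.
by apply: measurable_pt => //; exact: open_measurable_plane.
Qed.

Lemma measurable_hit_time : measurable_fun setT (hit_time x y Om).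
Proof.
apply: (measurability (@RGenInftyO.G R)) => [|/= _ [_] [c] -> <-].
  exact: RGenInftyO.measurableE.
rewrite setTI.
have hE z : hit_time x y Om z = inf [set t | 0 < t /\ ~ Om (pt t z)] by [].
have lb z : has_lbound [set t | 0 < t /\ ~ Om (pt t z)].
  by exists 0 => t [/ltW].
have [c0|c0] := leP c 0.
  rewrite (_ : _ @^-1` _ = set0)//; apply/seteqP; split => // z /=.
  rewrite in_itv/= hE ltNge; apply/negP; rewrite negbK (le_trans c0)//.
  have [->|/set0P A0] := eqVneq [set t | 0 < t /\ ~ Om (pt t z)] set0; first by rewrite inf0.
  by apply: lb_le_inf => // t [/ltW].
(* The second set consists of the rays that never leave [Om]; for them the infimum of the empty set
   is [0], which is below [c]. *)
rewrite (_ : _ @^-1` _ = [set z | exists2 t, 0 < t < c & ~ Om (pt t z)] `|`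
   ~` \bigcup_m [set z | exists2 t, 0 < t < m.+1%:R & ~ Om (pt t z)]).
  apply: measurableU; first exact: measurable_blocked.
  by apply: measurableC; apply: bigcupT_measurable => m; exact: measurable_blocked.
apply/seteqP; split => z /=; rewrite in_itv/= hE.
  have [A0 _|/set0P A0 ic] := eqVneq [set t | 0 < t /\ ~ Om (pt t z)] set0.
    right => -[m _ [t /andP[t0 _] nO]].
    by have : [set t | 0 < t /\ ~ Om (pt t z)] t by []; rewrite A0.
  have [t [t0 nO] tc] := inf_lt A0 ic.
  by left; exists t => //; rewrite t0.
move=> [[t /andP[t0 tc] nO]|h].
  by apply: le_lt_trans tc; apply: ge_inf.
rewrite (_ : [set t | _] = set0) ?inf0//; apply/seteqP; split => // t [t0 nO].
apply: h; exists (Num.truncn t) => //; exists t => //.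
by rewrite t0 truncnS_gt.
Qed.

Lemma measurable_billiard_map : measurable_fun setT phi.
Proof.
have [m1 m2] := measurable_bdir.
have mt := measurable_hit_time.
have mx : measurable_fun [set: R * R] (fun z => x z.1).
  exact: (measurableT_comp (continuous_measurable_fun cx) measurable_fst).
have my : measurable_fun [set: R * R] (fun z => y z.1).
  exact: (measurableT_comp (continuous_measurable_fun cy) measurable_fst).
have mh : measurable_fun setT (hit_point x y Om).
  by apply/measurable_fun_pairP; split => /=; apply: measurable_funD => //;
    apply: measurable_funM.
have mc : measurable_fun setT (fun z => bcoord L x y (hit_point x y Om z)).
  exact: (measurableT_comp measurable_bcoord mh).
apply/measurable_fun_pairP; split => //=.
apply: (measurableT_comp (@measurable_acos R)).
apply: measurable_funD; apply: measurable_funM => //.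
  exact: (measurableT_comp measurable_dx mc).
exact: (measurableT_comp measurable_dy mc).
Qed.

Lemma measurable_fgain : measurable_fun setT (fgain L x y Om).
Proof.
have ms2 : measurable_fun setT (fun z => (phi z).1).
  exact: (measurableT_comp measurable_fst measurable_billiard_map).
have ms1 : measurable_fun [set: R * R] (fun z => if z.1 < L then z.1 else 0).
  apply: measurable_fun_ifT; [|exact: measurable_fst|exact: measurable_cst].
  by apply: measurable_fun_ltr; [exact: measurable_fst|exact: measurable_cst].
apply: measurable_fun_ifT; first exact: measurable_fun_ler.
  exact: measurable_funB.
by apply: measurable_funD; [exact: measurable_funB|exact: measurable_cst].
Qed.

Lemma fgain_bounds (z : R * R) : 0 <= z.1 -> 0 <= fgain L x y Om z <= L.
Proof.
move=> z0; rewrite /fgain/=; have /andP[] := bcoord_bounds (hit_point x y Om z).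
move: (bcoord _ _ _ _) => B B0 BL; have := L0.
by case: (ltP z.1 L) => h; case: ifPn; rewrite -?ltNge => h2; lra.
Qed.

End billiard_measurability.

(** * Measures given by a density *)

Section density.
Context d (X : measurableType d) (R : realType).
Variables (mu : {measure set X -> \bar R}) (w : X -> R).
Hypotheses (mw : measurable_fun setT w) (w0 : forall x, 0 <= w x).

(** The proofs are arguments of the definition so that a measure structure can be attached to it. *)
Definition density of measurable_fun setT w & (forall x, 0 <= w x) :=
  fun A : set X => (\int[mu]_(x in A) (w x)%:E)%E.

Let density0 : density mw w0 set0 = 0%E.
Proof. exact: integral_set0. Qed.

Let density_ge0 A : (0 <= density mw w0 A)%E.
Proof. by apply: integral_ge0 => x _; rewrite lee_fin. Qed.

Let density_sigma_additive : semi_sigma_additive (density mw w0).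
Proof.
move=> F mF tF mUF; rewrite /density ge0_integral_bigcup//.
- apply: is_cvg_ereal_nneg_natsum_cond => n _ _.
  by apply: integral_ge0 => x _; rewrite lee_fin.
- by apply/measurable_EFinP; exact: measurable_funTS.
- by move=> x _; rewrite lee_fin.
Qed.

HB.instance Definition _ := isMeasure.Build _ _ _ (density mw w0)
  density0 density_ge0 density_sigma_additive.

End density.

(** * Lebesgue measure on the line *)

Section lebesgue_facts.
Variable R : realType.
Notation mu := (@lebesgue_measure R).

Lemma ocitv_measure_unique (m1 m2 : {measure set (measurableTypeR R) -> \bar R}) :
  (forall p q : R, p < q -> m1 `]p, q]%classic = m2 `]p, q]%classic) ->
  (forall p q : R, (m1 `]p, q]%classic < +oo)%E) ->
  forall A, measurable A -> m1 A = m2 A.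
Proof.
move=> m12 fin; apply: (@measure_unique _ R (measurableTypeR R) (@ocitv R) (fun k : nat => `](- k%:R), k%:R]%classic)).
- by [].
- exact: ocitvI.
- by move=> k; exact: is_ocitv.
- apply/seteqP; split => // t _; exists (Num.truncn `|t|).+1 => //=.
  rewrite in_itv/=; have := truncnS_gt `|t|; rewrite ltr_norml => /andP[-> /ltW ->].
  by [].
- move=> _ /ocitvP[->|[[p q] /= pq ->]]; last exact: m12.
  by rewrite !measure0.
- by move=> k; exact: fin.
Qed.

Lemma lebesgue_oc (p q : R) : p < q -> mu `]p, q]%classic = (q - p)%:E.
Proof. by move=> pq; rewrite lebesgue_measure_itv/= lte_fin pq -EFinB. Qed.

Lemma lebesgue_oc_lty (p q : R) : (mu `]p, q]%classic < +oo)%E.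
Proof. by rewrite lebesgue_measure_itv/=; case: ifP => // _; rewrite -EFinB ltry. Qed.

Lemma measurable_addr (t : R) : measurable_fun [set: R] (fun u => u + t).
Proof. by apply: measurable_funD; [exact: measurable_id|exact: measurable_cst]. Qed.

Lemma lebesgue_measure_shift (t : R) (A : set R) : measurable A ->
  mu ((fun u => u + t) @^-1` A) = mu A.
Proof.
move=> mA; have mt : measurable_fun [set: measurableTypeR R]
    (fun u : measurableTypeR R => u + t : measurableTypeR R) by exact: measurable_addr.
pose f : {mfun measurableTypeR R >-> measurableTypeR R} :=
  HB.pack (fun u : measurableTypeR R => u + t : measurableTypeR R) (isMeasurableFun.Build _ _ _ _ _ mt).
rewrite -[LHS]/(pushforward mu f A); apply/esym.
apply: (@ocitv_measure_unique mu (pushforward mu f)) => // p q.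
- move=> pq; rewrite -[RHS]/(mu (f @^-1` `]p, q]%classic)) (_ : f @^-1` _ = `]p - t, q - t]%classic); last first.
    by apply/seteqP; split => u /=; rewrite !in_itv/=; lra.
  transitivity (q - p)%:E; first exact: lebesgue_oc.
  by rewrite lebesgue_oc ?ltrD2r//; congr EFin; ring.
- exact: lebesgue_oc_lty.
Qed.

Lemma lebesgue_measure_opp (A : set R) : measurable A -> mu ((fun u => - u) @^-1` A) = mu A.
Proof.
move=> mA; have mt : measurable_fun [set: measurableTypeR R]
    (fun u : measurableTypeR R => - u : measurableTypeR R) by exact: oppr_measurable.
pose f : {mfun measurableTypeR R >-> measurableTypeR R} :=
  HB.pack (fun u : measurableTypeR R => - u : measurableTypeR R) (isMeasurableFun.Build _ _ _ _ _ mt).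
rewrite -[LHS]/(pushforward mu f A); apply/esym.
apply: (@ocitv_measure_unique mu (pushforward mu f)) => // p q.
- move=> pq; rewrite -[RHS]/(mu (f @^-1` `]p, q]%classic)) (_ : f @^-1` _ = `[- q, - p[%classic); last first.
    by apply/seteqP; split => u /=; rewrite !in_itv/=; lra.
  transitivity (q - p)%:E; first exact: lebesgue_oc.
  rewrite lebesgue_measure_itv/= lte_fin ltrN2 pq -EFinB.
  by congr EFin; ring.
- exact: lebesgue_oc_lty.
Qed.

(** * Area formula for an increasing function *)

Section increasing.
Variables (f : R -> R) (a c : R).
Hypothesis ac : a < c.
Hypothesis df : forall s, a <= s <= c -> derivable f s 1.
Hypothesis f'_gt0 : forall s, a <= s <= c -> 0 < derive1 f s.
Hypothesis cf' : {within `[a, c], continuous (derive1 f)}.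

Let cf : {within `[a, c], continuous f}.
Proof. by apply: derivable_within_continuous => s; rewrite in_itv/= => /df. Qed.

Let f_lt s t : a <= s <= c -> a <= t <= c -> s < t -> f s < f t.
Proof.
move=> sac tac st.
have sub u : u \in `]s, t[ -> a <= u <= c by rewrite in_itv/=; lra.
have [||u] := @MVT R f (derive1 f) s t st.
- by move=> u /sub uac; split; [exact: df|rewrite derive1E].
- by apply: continuous_subspaceW cf => u /=; rewrite !in_itv/=; lra.
- move=> /sub uac e; rewrite -subr_gt0 e mulr_gt0 ?subr_gt0//; exact: f'_gt0.
Qed.

Let f_le s t : a <= s <= c -> a <= t <= c -> s <= t -> f s <= f t.
Proof.
by move=> sac tac; rewrite le_eqVlt => /orP[/eqP -> //|/f_lt]; move=> /(_ sac tac)/ltW.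
Qed.

(** A generalized inverse of [f] that is monotone on the whole line and therefore measurable. Adding
    the point [a] keeps the set nonempty for every [p]. *)
Let g (p : R) : R := sup (a |` [set s | a <= s <= c /\ f s <= p]).

Let g_sup p : has_sup (a |` [set s | a <= s <= c /\ f s <= p]).
Proof.
split; first by exists a; left.
by exists c => s [->|[/andP[]]]//; exact: ltW.
Qed.

Let g_nd : nondecreasing_fun g.
Proof.
move=> p q pq; apply: ge_sup; first by exists a; left.
move=> s sp; apply: sup_upper_bound => //.
by case: sp => [->|[sac fs]]; [left|right; split => //; exact: le_trans fs pq].
Qed.

Let gK s : a <= s <= c -> g (f s) = s.
Proof.
move=> sac; apply/eqP; rewrite eq_le; apply/andP; split.
  apply: ge_sup; first by exists a; left.
  move=> t [->|[tac ft]]; first by case/andP: sac.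
  by rewrite leNgt; apply/negP => /(f_lt sac tac); rewrite ltNge ft.
by apply: sup_upper_bound => //; right.
Qed.

Let f_onto p q u : a <= p <= c -> a <= q <= c -> p <= q -> f p <= u <= f q ->
  exists2 s, p <= s <= q & f s = u.
Proof.
move=> pac qac pq upq.
have [|||s] := @IVT R f p q u.
- by [].
- by apply: continuous_subspaceW cf => t /=; rewrite !in_itv/=; lra.
- by have := f_le pac qac pq; rewrite ge_min le_max; lra.
- by rewrite in_itv/= => spq fs; exists s.
Qed.

Let w : R -> R := (derive1 f) \_ `]a, c].

Let mw : measurable_fun setT w.
Proof.
apply/(measurable_restrictT _ (measurable_itv _)).
apply: (@measurable_funS _ _ _ _ `[a, c]) => //; first exact: subset_itv_oc_cc.
exact: subspace_continuous_measurable_fun.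
Qed.

Let w0 s : 0 <= w s.
Proof.
rewrite /w patchE; case: ifPn => //; rewrite inE/= in_itv/= => sac.
by apply/ltW/f'_gt0; lra.
Qed.

Let w_itv p q : a <= p -> p < q -> q <= c ->
  (\int[mu]_(s in `]p, q]) (w s)%:E = (f q - f p)%:E)%E.
Proof.
move=> ap pq qc.
have mdf : measurable_fun `]p, q] (fun s => (derive1 f s)%:E).
  apply/measurable_EFinP; apply: (@measurable_funS _ _ _ _ `[a, c]) => //.
    by move=> s /=; rewrite !in_itv/=; lra.
  exact: subspace_continuous_measurable_fun.
transitivity (\int[mu]_(s in `]p, q]) (derive1 f s)%:E)%E.
  apply: eq_integral => s; rewrite inE/= in_itv/= => spq; rewrite /w patchE mem_set//=.
  by rewrite in_itv/=; lra.
rewrite integral_itv_obnd_cbnd// (@continuous_FTC2 _ _ f)//.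
- by apply: continuous_subspaceW cf' => s /=; rewrite !in_itv/=; lra.
- have cpq : {within `[p, q], continuous f}.
    by apply: continuous_subspaceW cf => s /=; rewrite !in_itv/=; lra.
  have [_ fp fq] := (continuous_within_itvP f pq).1 cpq.
  by split => // s; rewrite in_itv/= => spq; apply: df; lra.
Qed.

Let img B : f @` (B `&` `]a, c]) = `]f a, f c]%classic `&` g @^-1` B.
Proof.
apply/seteqP; split => u.
  move=> [s [Bs]]; rewrite /= in_itv/= => sac <-.
  split; last by rewrite /= gK//; lra.
  by rewrite /= in_itv/= f_lt ?f_le//; lra.
move=> [/=]; rewrite in_itv/= => ufac gA.
have aac : a <= a <= c by rewrite lexx ltW.
have cac : a <= c <= c by rewrite lexx ltW.
have ufac' : f a <= u <= f c by lra.
have [s sac fs] := f_onto aac cac (ltW ac) ufac'.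
exists s => //; split; first by rewrite -(gK sac) fs.
rewrite /= in_itv/=; case/andP: sac => + ->; rewrite le_eqVlt => /orP[/eqP as_|->//].
by move: ufac; rewrite -fs -as_ ltxx.
Qed.

Let mg : measurable_fun [set: measurableTypeR R] (g : measurableTypeR R -> measurableTypeR R).
Proof. exact: nondecreasing_measurable. Qed.


(** By [img], the measure of [f @] (B [&] []a, c])] is the pushforward under [g] of Lebesgue measure
    on []f a, f c]]. It agrees with the measure of density [f'] on half-open intervals by the
    fundamental theorem of calculus, hence on all measurable sets. *)
Lemma increasing_area A : measurable A -> A `<=` `]a, c] ->
  measurable (f @` A) /\ mu (f @` A) = (\int[mu]_(s in A) (derive1 f s)%:E)%E.
Proof.
move=> mA Aac; have AE : A `&` `]a, c] = A by apply/setIidPl.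
have mfA : measurable (f @` A).
  rewrite -AE img; apply: measurableI; first exact: measurable_itv.
  by rewrite -[X in measurable X]setTI; exact: mg.
split => //.
transitivity (\int[mu]_(s in A) (w s)%:E)%E; last first.
  by apply: eq_integral => s; rewrite inE => As; rewrite /w patchE mem_set//; exact: Aac.
pose gm : {mfun measurableTypeR R >-> measurableTypeR R} :=
  HB.pack (g : measurableTypeR R -> measurableTypeR R) (isMeasurableFun.Build _ _ _ _ _ mg).
pose m2 := pushforward (mrestr mu (measurable_itv `]f a, f c])) gm.
have m2E B : m2 B = mu (f @` (B `&` `]a, c])).
  by rewrite img /m2 /pushforward /mrestr setIC.
have m1E p q : (\int[mu]_(s in `]p, q]) (w s)%:E)%E =
    (\int[mu]_(s in `]p, q] `&` `]a, c]) (w s)%:E)%E.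
  rewrite integral_mkcondr; apply: eq_integral => s _; rewrite patchE; case: ifPn => //.
  by move=> nac; rewrite /w patchE (negbTE nac).
have val p q : p < q -> (\int[mu]_(s in `]p, q]) (w s)%:E)%E = m2 `]p, q]%classic.
  move=> pq; pose p' := Num.max a p; pose q' := Num.min c q; rewrite m1E m2E.
  have -> : `]p, q]%classic `&` `]a, c]%classic = `]p', q']%classic.
    apply/seteqP; split => s /=; rewrite !in_itv/= /p' /q' gt_max le_min; last by lra.
    by move=> []; lra.
  have [p1 p2] : a <= p' /\ p <= p' by rewrite /p' !le_max !lexx orbT.
  have [q1 q2] : q' <= c /\ q' <= q by rewrite /q' !ge_min !lexx orbT.
  have [pq'|qp'] := ltP p' q'; last first.
    by rewrite set_itv_ge ?bnd_simp -?leNgt// image_set0 measure0 integral_set0.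
  rewrite w_itv//.
  have -> : f @` `]p', q'] = `]f p', f q']%classic.
    apply/seteqP; split => u.
      by move=> [s]; rewrite /= in_itv/= => s1 <-; rewrite in_itv/= f_lt ?f_le//; lra.
    rewrite /= in_itv/= => /andP[u1 u2].
    have [|||s s1 su] := @f_onto p' q' u _ _ (ltW pq'); [lra|lra|lra|].
    exists s => //; rewrite in_itv/=; case/andP: s1 => + ->.
    by rewrite le_eqVlt => /orP[/eqP e|->//]; move: u1; rewrite -su -e ltxx.
  by rewrite lebesgue_measure_itv/= lte_fin f_lt//; lra.
rewrite -{1}AE -m2E.
apply/esym; rewrite -[LHS]/(density mu mw w0 A).
apply: (@ocitv_measure_unique (density mu mw w0)
  (pushforward (mrestr mu (measurable_itv `]f a, f c])) gm)) => // p q.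
have [pq|qp] := ltP p q; last by rewrite set_itv_ge ?bnd_simp -?leNgt// measure0 ltry.
rewrite /= -[X in (X < _)%E]/(\int[mu]_(s in `]p, q]) (w s)%:E)%E val// m2E img.
apply: le_lt_trans (_ : mu `]f a, f c]%classic < +oo)%E.
  apply: measureIl; first exact: measurable_itv.
  by rewrite -[X in measurable X]setTI; apply: mg => //; exact: measurable_itv.
exact: lebesgue_oc_lty.
Qed.

End increasing.

End lebesgue_facts.

(** * Area formula over countably many monotone pieces, and Sard's theorem *)

Section area.
Variable R : realType.
Notation mu := (@lebesgue_measure R).

Lemma lebesgue_cc (p q : R) : p < q -> mu `[p, q]%classic = (q - p)%:E.
Proof. by move=> pq; rewrite lebesgue_measure_itv/= lte_fin pq -EFinB. Qed.

Lemma monotone_area (f : R -> R) (a c : R) (A : set R) : a < c ->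
  (forall s, a <= s <= c -> derivable f s 1) ->
  {within `[a, c], continuous (derive1 f)} ->
  (forall s, a <= s <= c -> 0 < derive1 f s) \/
  (forall s, a <= s <= c -> derive1 f s < 0) ->
  measurable A -> A `<=` `]a, c] ->
  measurable (f @` A) /\ mu (f @` A) = (\int[mu]_(s in A) `|derive1 f s|%:E)%E.
Proof.
move=> ac df cf' sgn mA Aac.
have sub s : A s -> a <= s <= c by move=> /Aac; rewrite /= in_itv/=; lra.
case: sgn => [pos|neg].
  have [mfA ->] := increasing_area ac df pos cf' mA Aac; split => //.
  by apply: eq_integral => s; rewrite inE => /sub/pos/gtr0_norm ->.
pose h s := - f s.
have dh s : a <= s <= c -> derivable h s 1 by move=> /df; exact: derivableN.
have h'E s : a <= s <= c -> derive1 h s = - derive1 f s.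
  by move=> /df dfs; rewrite !derive1E deriveN.
have h'0 s : a <= s <= c -> 0 < derive1 h s.
  by move=> sac; rewrite h'E// oppr_gt0 neg.
have ch' : {within `[a, c], continuous (derive1 h)}.
  apply: (@subspace_eq_continuous _ _ _ (fun s => - derive1 f s)).
    by move=> s; rewrite inE/= in_itv/= => sac; exact/esym/h'E.
  by move=> s; apply: cvgN; exact: cf'.
have [mhA hA] := increasing_area ac dh h'0 ch' mA Aac.
have fh : f @` A = (fun u => - u) @^-1` (h @` A).
  apply/seteqP; split => u /=.
    by move=> [s As <-]; exists s.
  by move=> [s As /oppr_inj <-]; exists s.
rewrite fh lebesgue_measure_opp//; split.
  rewrite -[X in measurable X]setTI; apply: oppr_measurable => //.
rewrite hA; apply: eq_integral => s; rewrite inE => /sub sac.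
by rewrite h'E// ltr0_norm ?neg.
Qed.

Section fibres.
Variables (f w : R -> R) (I : nat -> set R).
Hypothesis mI : forall k, measurable (I k).
Hypothesis mw : measurable_fun setT w.
Hypothesis w0 : forall s, 0 <= w s.
Hypothesis area : forall k A, measurable A -> A `<=` I k ->
  measurable (f @` A) /\ mu (f @` A) = (\int[mu]_(s in A) (w s)%:E)%E.

Let mwE D : measurable_fun D (fun s => (w s)%:E).
Proof. by apply/measurable_EFinP; exact: measurable_funTS. Qed.

Let J := seqDU I.
Let mJ k : measurable (J k). Proof. exact: seqDU_measurable. Qed.
Let JI k : J k `<=` I k. Proof. exact: subset_seqDU. Qed.
Let trivJ i j s : J i s -> J j s -> i = j.
Proof. by move=> Ji Jj; apply: (@trivIset_seqDU _ I) => //; exists s. Qed.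

(** On each disjoint piece the weight integrates to the measure of the image, and this image lies in
    the null set [Z]. *)
Lemma fibre_null (E Z : set R) : measurable E -> E `<=` \bigcup_k I k ->
  measurable Z -> mu Z = 0%E -> f @` E `<=` Z ->
  (\int[mu]_(s in E) (w s)%:E = 0)%E.
Proof.
move=> mE EI mZ Z0 fE.
have -> : E = \bigcup_k (E `&` J k) by rewrite -setI_bigcupr -seqDU_bigcup_eq; apply/esym/setIidPl.
have mEk k : measurable (E `&` J k) by exact: measurableI.
rewrite ge0_integral_bigcup.
- rewrite eseries0// => k _ _.
  have [mfk <-] := @area k (E `&` J k) (mEk k) (subIset (or_intror (@JI k))).
  apply/eqP; rewrite eq_le measure_ge0 andbT -Z0; apply: le_measure; rewrite ?inE//.
  by move=> _ [s [Es _] <-]; apply: fE; exists s.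
- exact: mEk.
- exact: mwE.
- by move=> s _; rewrite lee_fin.
- by apply/trivIsetP => i j _ _ ij; apply/seteqP; split => // s [[_ Ji] [_ Jj]];
    move: ij; rewrite (trivJ Ji Jj) eqxx.
Qed.

(* Cut both sets so that source and target lie in single intervals of injectivity;
   corresponding pieces have the same image under [f]. *)
Lemma fibre_bijection (E E' : set R) (g g' : R -> R) :
  measurable E -> measurable E' -> measurable_fun setT g -> measurable_fun setT g' ->
  E `<=` \bigcup_k I k -> E' `<=` \bigcup_k I k ->
  (forall s, E s -> [/\ E' (g s), g' (g s) = s & f (g s) = f s]) ->
  (forall s, E' s -> [/\ E (g' s), g (g' s) = s & f (g' s) = f s]) ->
  (\int[mu]_(s in E) (w s)%:E = \int[mu]_(s in E') (w s)%:E)%E.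
Proof.
move=> mE mE' mg mg' EI E'I Eg E'g'.
pose P (m : nat) : set R := if (pickle_inv m : option (nat * nat)) is Some (i, j)
  then E `&` J i `&` g @^-1` J j else set0.
pose P' (m : nat) : set R := if (pickle_inv m : option (nat * nat)) is Some (i, j)
  then E' `&` J j `&` g' @^-1` J i else set0.
have pre (h : R -> R) k : measurable_fun setT h -> measurable (h @^-1` J k).
  by move=> mh; rewrite -[X in measurable X]setTI; exact: mh.
have mP m : measurable (P m).
  rewrite /P; case: (pickle_inv m) => [[i j]|] //.
  by apply: measurableI; [exact: measurableI|exact: pre].
have mP' m : measurable (P' m).
  rewrite /P'; case: (pickle_inv m) => [[i j]|] //.
  by apply: measurableI; [exact: measurableI|exact: pre].
have inJ s : (\bigcup_k I k) s -> exists k, J k s.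
  by rewrite seqDU_bigcup_eq => -[k _ Jk]; exists k.
have EP : E = \bigcup_m P m.
  apply/seteqP; split => s.
    move=> Es; have [i Ji] := inJ _ (EI _ Es); have [E's _ _] := Eg _ Es.
    by have [j Jj] := inJ _ (E'I _ E's); exists (pickle (i, j)) => //; rewrite /P pickleK_inv.
  by move=> [m _]; rewrite /P; case: (pickle_inv m) => [[i j] [[]]|].
have E'P : E' = \bigcup_m P' m.
  apply/seteqP; split => s.
    move=> E's; have [j Jj] := inJ _ (E'I _ E's); have [Es _ _] := E'g' _ E's.
    by have [i Ji] := inJ _ (EI _ Es); exists (pickle (i, j)) => //; rewrite /P' pickleK_inv.
  by move=> [m _]; rewrite /P'; case: (pickle_inv m) => [[i j] [[]]|].
have tP : trivIset setT P.
  apply/trivIsetP => m1 m2 _ _ /eqP ne; apply/seteqP; split => // s []; rewrite /P.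
  case e1: (pickle_inv m1) => [[i j]|]//; case e2: (pickle_inv m2) => [[i' j']|]//.
  move=> [[_ Ji] Jj] [[_ Ji'] Jj']; apply: ne.
  have := @pickle_invK (nat * nat)%type m1; have := @pickle_invK (nat * nat)%type m2; rewrite e1 e2 /= => <- <-.
  by rewrite (trivJ Ji Ji') (trivJ Jj Jj').
have tP' : trivIset setT P'.
  apply/trivIsetP => m1 m2 _ _ /eqP ne; apply/seteqP; split => // s []; rewrite /P'.
  case e1: (pickle_inv m1) => [[i j]|]//; case e2: (pickle_inv m2) => [[i' j']|]//.
  move=> [[_ Jj] Ji] [[_ Jj'] Ji']; apply: ne.
  have := @pickle_invK (nat * nat)%type m1; have := @pickle_invK (nat * nat)%type m2; rewrite e1 e2 /= => <- <-.
  by rewrite (trivJ Ji Ji') (trivJ Jj Jj').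
rewrite {1}EP [in RHS]E'P !ge0_integral_bigcup//; try by move=> s _; rewrite lee_fin.
- apply: eq_eseriesr => m _.
  have fPP' : f @` P m = f @` P' m.
  rewrite /P /P'; case: (pickle_inv m) => [[i j]|]//; apply/seteqP; split => u [s].
    by move=> [[Es Ji] Jj] <-; have [E's gK fs] := Eg _ Es; exists (g s) => //; split => //=;
      rewrite ?gK.
  by move=> [[E's Jj] Ji] <-; have [Es gK fs] := E'g' _ E's; exists (g' s) => //; split => //=;
    rewrite ?gK.
have [k kP] : exists k, P m `<=` I k.
  rewrite /P; case: (pickle_inv m) => [[i j]|]; last by exists 0%N.
  by exists i => s [[_ /JI]].
have [k' kP'] : exists k, P' m `<=` I k.
  rewrite /P'; case: (pickle_inv m) => [[i j]|]; last by exists 0%N.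
  by exists j => s [[_ /JI]].
  by have [_ <-] := area (mP m) kP; have [_ <-] := area (mP' m) kP'; rewrite fPP'.
- exact: mwE.
- exact: mwE.
Qed.

End fibres.

(** On a cell of length [l] that contains a critical point [s], the derivative between the left grid
    point and [s] is at most [C * l], so [f s] lies within [C * l ^ 2] of the value at the grid
    point. About [1 / l] such intervals have total length of order [l]. *)
Lemma sard_interval (f : R -> R) (a c : R) : a < c ->
  (forall s : R, derivable f s 1) -> (forall s : R, derivable (derive1 f) s 1) ->
  continuous (derive1 (derive1 f)) ->
  exists Z : set R, [/\ measurable Z, mu Z = 0%E &
    forall s, a <= s <= c -> derive1 f s = 0 -> Z (f s)].
Proof.
move=> ac df ddf cddf.
have [C C0 hC] : exists2 C : R, 0 < C & forall s, a <= s <= c -> `|derive1 (derive1 f) s| <= C.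
  have [|m _ hm] := @EVT_max R (fun s => `|derive1 (derive1 f) s|) a c (ltW ac).
    by apply: continuous_subspaceT => s; apply: cvg_norm; exact: cddf.
  exists (`|derive1 (derive1 f) m| + 1); first by rewrite ltr_wpDl.
  by move=> s sac; rewrite (le_trans (hm s _)) ?in_itv// lerDl.
pose l N : R := (c - a) / N.+1%:R.
pose t N k : R := a + k%:R * l N.
(* One interval more than there are cells, because [s = c] sits on the last grid point. *)
pose Z_ N := \big[setU/set0]_(k < N.+2)
  `[f (t N k) - C * l N ^+ 2, f (t N k) + C * l N ^+ 2]%classic.
have l0 N : 0 < l N by rewrite divr_gt0// subr_gt0.
have mZ_ N : measurable (Z_ N) by apply: bigsetU_measurable => k _; exact: measurable_itv.
exists (\bigcap_N Z_ N); split.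
- exact: bigcapT_measurable.
- apply/eqP; rewrite eq_le measure_ge0 andbT.
  (* There are [N + 2] intervals of length [2 * C * l ^ 2]; the factor [4] comes from
     [N + 2 <= 2 * (N + 1)]. *)
  have bnd N : (mu (\bigcap_N Z_ N) <= (4 * C * (c - a) ^+ 2 * harmonic N)%:E)%E.
    apply: le_trans (_ : mu (Z_ N) <= _)%E.
      apply: le_measure; [by rewrite inE; exact: bigcapT_measurable|by rewrite inE; exact: mZ_|].
      exact: bigcap_inf.
    apply: le_trans (@Boole_inequality _ _ _ mu (fun k => `[f (t N k) - C * l N ^+ 2,
      f (t N k) + C * l N ^+ 2]%classic) N.+2 (fun _ _ => measurable_itv _)) _.
    rewrite (eq_bigr (fun=> (2 * (C * l N ^+ 2))%:E)); last first.
      move=> k _; have h : 0 < C * l N ^+ 2 by rewrite mulr_gt0// exprn_gt0.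
      apply: (etrans (lebesgue_cc _)); [lra|congr EFin; ring].
    rewrite sumEFin lee_fin sumr_const card_ord /l /harmonic/= -[X in X <= _]mulr_natl.
    have n0 : 0 < N.+1%:R :> R by rewrite ltr0n.
    have -> : 4 * C * (c - a) ^+ 2 / N.+1%:R =
      (2 * N.+1%:R) * (2 * (C * ((c - a) / N.+1%:R) ^+ 2)) by field; rewrite gt_eqF.
    rewrite ler_wpM2r//; first by apply: mulr_ge0 => //; apply: mulr_ge0; [exact: ltW|exact: sqr_ge0].
    by rewrite -natrM ler_nat mul2n -addnn addSn ltnS addnS ltnS leq_addr.
  have fin : mu (\bigcap_N Z_ N) \is a fin_num.
    by rewrite ge0_fin_numE// (le_lt_trans (bnd 0%N)) ?ltry.
  rewrite -(fineK fin) lee_fin leNgt; apply/negP => r0.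
  have K0 : 0 < 4 * C * (c - a) ^+ 2.
    by apply: mulr_gt0; [exact: mulr_gt0|rewrite exprn_gt0// subr_gt0].
  have [N] := ltr_add_invr (divr_gt0 r0 K0); rewrite add0r ltr_pdivlMr// mulrC => hN.
  by have := bnd N; rewrite -(fineK fin) lee_fin leNgt hN.
- move=> s sac f's N _.
  suff : (\bigcup_(k in `I_N.+2)
      `[f (t N k) - C * l N ^+ 2, f (t N k) + C * l N ^+ 2]%classic) (f s).
    by rewrite bigcup_mkord.
  pose k := Num.truncn ((s - a) / l N).
  have /andP[k1 k2] : k%:R <= (s - a) / l N < k.+1%:R.
    by apply: truncn_itv; apply: divr_ge0; [lra|exact: ltW].
  have kN : (k < N.+2)%N.
    rewrite -(ltr_nat R) (le_lt_trans k1)// ltr_pdivrMr// /l.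
    have n0 : 0 < N.+1%:R :> R by rewrite ltr0n.
    have -> : N.+2%:R * ((c - a) / N.+1%:R) = (c - a) + (c - a) / N.+1%:R :> R.
      by rewrite -natr1; field; rewrite gt_eqF.
    have : 0 < (c - a) / N.+1%:R :> R by exact: l0.
    by move: ((c - a) / N.+1%:R) => e; lra.
  exists k => //=; rewrite in_itv/=.
  move: k1 k2; rewrite ler_pdivlMr// ltr_pdivrMr// -natr1 mulrDl mul1r => k1 k2.
  have t1 : a <= t N k by rewrite /t lerDl mulr_ge0// ltW.
  have t2 : t N k <= s by rewrite /t; lra.
  have t3 : s - t N k <= l N by rewrite /t; lra.
  have cf : continuous f by move=> u; apply/differentiable_continuous/derivable1_diffP.
  have cf' : continuous (derive1 f).
    by move=> u; apply/differentiable_continuous/derivable1_diffP; exact: ddf.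
  have [|u] := @MVT_segment R f (derive1 f) (t N k) s t2 _ (continuous_subspaceT cf).
    by move=> u _; split; [exact: df|rewrite derive1E].
  rewrite in_itv/= => /andP[u1 u2] fE.
  have [|v] := @MVT_segment R (derive1 f) (derive1 (derive1 f)) u s u2 _ (continuous_subspaceT cf').
    by move=> v _; split; [exact: ddf|rewrite derive1E].
  rewrite in_itv/= f's sub0r => /andP[v1 v2] f'E.
  have f'u : `|derive1 f u| <= C * l N.
    rewrite -normrN f'E normrM ler_pM// ?hC//; first by lra.
    by rewrite ger0_norm; lra.
  have : `|f s - f (t N k)| <= C * l N ^+ 2.
    rewrite fE normrM expr2 mulrA ler_pM// ger0_norm; lra.
  by rewrite ler_norml; lra.
Qed.

End area.

Lemma same_sign_close (R : realType) (a c : R) : `|a - c| < `|a| ->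
  (0 < a -> 0 < c) /\ (a < 0 -> c < 0).
Proof.
rewrite ltr_norml => /andP[h1 h2]; split=> a0.
  by rewrite gtr0_norm// in h2; lra.
by rewrite ltr0_norm// in h1; lra.
Qed.

(** * The chords of a fixed direction *)

Section direction.
Variables (R : realType) (L : R) (x y : R -> R) (Om : set (R * R)).
Hypothesis table : billiard_table L x y Om.
Variables (n : nat) (b : nat -> R).
Hypothesis pieces : smooth_pieces L x y n b.
Notation regular := (regular n b).
Notation mu := (@lebesgue_measure R).
Variable v : R * R.

Definition offset (s : R) : R := x s * v.2 - y s * v.1.

(** The offset built from the smooth extension of one boundary piece. It is smooth on the whole
    line, as the Sard argument asks, and agrees with [offset] on the piece. *)
Let comb (gx gy : R -> R) (s : R) : R := gx s * v.2 - gy s * v.1.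

Let comb_derive (gx gy : R -> R) s : derivable gx s 1 -> derivable gy s 1 ->
  derivable (comb gx gy) s 1 /\ derive1 (comb gx gy) s = comb (derive1 gx) (derive1 gy) s.
Proof.
move=> dgx dgy.
have -> : comb gx gy = (v.2 \*: gx \- v.1 \*: gy).
  by apply/funext => t; rewrite /comb /= !(mulrC (gx t)) (mulrC (gy t)).
have d1 := derivableZ (k := v.2) dgx.
have d2 := derivableZ (k := v.1) dgy.
split; first exact: (derivableB d1 d2).
rewrite /comb !derive1E; have -> := deriveB d1 d2.
rewrite (deriveZ _ dgx) (deriveZ _ dgy).
by congr (_ - _); exact: mulrC.
Qed.

Let comb_eq i gx gy s : (forall s, b i <= s <= b i.+1 -> gx s = x s /\ gy s = y s) ->
  b i < s < b i.+1 -> {near s, comb gx gy =1 offset} /\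
    (derive1 gx s = derive1 x s /\ derive1 gy s = derive1 y s).
Proof.
move=> g /andP[bs sb].
have np : nbhs s `]b i, b i.+1[%classic.
  by apply: open_nbhs_nbhs; split; [exact: interval_open|rewrite /= in_itv/= bs].
have h t : `]b i, b i.+1[%classic t -> gx t = x t /\ gy t = y t.
  by rewrite /= in_itv/= => /andP[/ltW t1 /ltW t2]; apply: g; rewrite t1.
split; last by split; apply: near_eq_derive1; apply: filterS np => t /h[].
by apply: filterS np => t /h[e1 e2]; rewrite /comb /offset e1 e2.
Qed.

Let smooth_comb gx gy : smooth_fun gx -> smooth_fun gy ->
  [/\ forall s, derivable (comb gx gy) s 1,
      forall s, derivable (derive1 (comb gx gy)) s 1 &
      continuous (derive1 (derive1 (comb gx gy)))].
Proof.
move=> sx sy.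
have e1 : derive1 (comb gx gy) = comb (derive1 gx) (derive1 gy).
  by apply/funext => s; apply: (comb_derive (sx 0%N s) (sy 0%N s)).2.
have e2 : derive1 (comb (derive1 gx) (derive1 gy)) =
    comb (derive1 (derive1 gx)) (derive1 (derive1 gy)).
  by apply/funext => s; apply: (comb_derive (sx 1%N s) (sy 1%N s)).2.
split => s; first exact: (comb_derive (sx 0%N s) (sy 0%N s)).1.
  by rewrite e1; exact: (comb_derive (sx 1%N s) (sy 1%N s)).1.
rewrite e1 e2; apply/differentiable_continuous/derivable1_diffP.
exact: (comb_derive (sx 2%N s) (sy 2%N s)).1.
Qed.

(** The derivative of the offset is the normal component of [v]: this is why the Liouville measure
    at fixed direction has the form to which the area formula applies. *)
Lemma regular_offset s : regular s ->
  [/\ derivable offset s 1, derive1 offset s = dirN x y s v &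
      {for s, continuous (fun s => dirN x y s v)}].
Proof.
move=> [i ni sb]; have [_ _ _ /(_ i ni)[gx [gy [sx sy g]]]] := pieces.
have g' t : b i <= t <= b i.+1 -> gx t = x t /\ gy t = y t by move=> /g[].
have [nc [ex ey]] := comb_eq g' sb.
have [d1 d2 _] := smooth_comb sx sy.
split; first exact: (near_eq_derivable nc (d1 s)).
  rewrite -(near_eq_derive1 nc) (comb_derive (sx 0%N s) (sy 0%N s)).2 /comb ex ey /dirN.
  by rewrite !(mulrC v.1) !(mulrC v.2).
have cc : {for s, continuous (derive1 (comb gx gy))}.
  by apply/differentiable_continuous/derivable1_diffP.
have np : nbhs s `]b i, b i.+1[%classic.
  by apply: open_nbhs_nbhs; split; [exact: interval_open|rewrite /= in_itv/=].
have eqn : {near s, derive1 (comb gx gy) =1 (fun s => dirN x y s v)}.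
  apply: filterS np => t /=; rewrite in_itv/= => tb.
  have [_ [ex' ey']] := comb_eq g' tb.
  rewrite (comb_derive (sx 0%N t) (sy 0%N t)).2 /comb ex' ey' /dirN.
  by rewrite !(mulrC v.1) !(mulrC v.2).
have e := nbhs_singleton eqn.
suff : (fun s => dirN x y s v) @ s --> derive1 (comb gx gy) s by rewrite e.
apply: cvg_trans cc; apply: near_eq_cvg.
by apply: filterS eqn => t ->.
Qed.

(** Besides the critical values supplied by Sard's theorem on each piece, the set contains the
    finitely many offsets of breakpoints, so chords into a corner are discarded together with the
    tangent ones. *)
Lemma critical_offsets_null : exists Z : set R, [/\ measurable Z, mu Z = 0%E,
  (forall s, regular s -> dirN x y s v = 0 -> Z (offset s)) &
  (forall i, (i <= n)%N -> Z (offset (b i)))].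
Proof.
have H (i : nat) : exists Z : set R, [/\ measurable Z, mu Z = 0%E &
    ((i < n)%N -> forall s, b i < s < b i.+1 -> dirN x y s v = 0 -> Z (offset s))].
  have [ni|ni] := ltnP i n; last by exists set0; split => //; rewrite measure0.
  have [_ _ /(_ i ni) bi /(_ i ni)[gx [gy [sx sy g]]]] := pieces.
  have g' t : b i <= t <= b i.+1 -> gx t = x t /\ gy t = y t by move=> /g[].
  have [d1 d2 d3] := smooth_comb sx sy.
  have [Z [mZ Z0 hZ]] := sard_interval bi d1 d2 d3.
  exists Z; split => // _ s sb dN.
  have [nc [ex ey]] := comb_eq g' sb.
  rewrite -(nbhs_singleton nc); apply: hZ; first by lra.
  rewrite (comb_derive (sx 0%N s) (sy 0%N s)).2 /comb ex ey -dN /dirN.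
  by rewrite !(mulrC v.1) !(mulrC v.2).
have [Z hZ] := choice H.
pose F := offset @` (b @` [set i | (i <= n)%N]).
have cF : countable F.
  by apply: sub_countable (card_image_le _ _) _; apply: sub_countable (card_image_le _ _) _.
have mF : measurable F by apply: countable_measurable => //.
have mZ i : measurable (Z i) by case: (hZ i).
have mU : measurable (\bigcup_i Z i) := bigcupT_measurable Z mZ.
have U0 : mu (\bigcup_i Z i) = 0%E.
  apply/eqP; rewrite eq_le measure_ge0 andbT.
  apply: le_trans (@measure_sigma_subadditive _ _ _ mu _ Z mZ mU (@subset_refl _ _)) _.
  by rewrite eseries0// => i _ _; case: (hZ i).
exists (F `|` \bigcup_i Z i); split.
- exact: measurableU.
- by apply: null_set_setU => //; exact: countable_lebesgue_measure0.
- move=> s [i ni sb] dN; right; exists i => //; have [_ _ h] := hZ i; exact: h.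
- by move=> i ni; left; exists (b i) => //; exists i.
Qed.

Let speed (s : R) : R := `|dirN x y s v|.

(** Rational intervals of regular points on which the derivative of the offset keeps its sign. There
    are countably many of them, the area formula holds on each, and by continuity they cover all
    regular points where this derivative is nonzero. *)
Let good (q : rat * rat) : Prop := [/\ (ratr q.1 : R) < ratr q.2,
  (forall s, ratr q.1 <= s <= ratr q.2 -> regular s) &
  (forall s, ratr q.1 <= s <= ratr q.2 -> 0 < dirN x y s v) \/
  (forall s, ratr q.1 <= s <= ratr q.2 -> dirN x y s v < 0)].

Let I (k : nat) : set R := if (pickle_inv k : option (rat * rat)) is Some q then
  (if asbool (good q) then `]ratr q.1, ratr q.2]%classic else set0) else set0.

Let mI k : measurable (I k).
Proof.
by rewrite /I; case: (pickle_inv k) => [q|]//; case: ifP => // _; exact: measurable_itv.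
Qed.

Let measurable_speed : measurable_fun setT speed.
Proof.
apply: measurableT_comp => //; apply: measurable_funB; apply: measurable_funM => //.
  exact: (measurable_dx table pieces).
exact: (measurable_dy table pieces).
Qed.

Let speed_area k A : measurable A -> A `<=` I k ->
  measurable (offset @` A) /\ mu (offset @` A) = (\int[mu]_(s in A) (speed s)%:E)%E.
Proof.
have triv B : B `<=` set0 -> measurable (offset @` B) /\
    mu (offset @` B) = (\int[mu]_(s in B) (speed s)%:E)%E.
  rewrite subset0 => ->; rewrite image_set0 integral_set0 measure0.
  by split => //; exact: measurable0.
move=> mA; rewrite /I; case: (pickle_inv k) => [q|]; last exact: triv.
case: ifPn => [/asboolP[q12 reg sgn] AI|_]; last exact: triv.
have dE s : ratr q.1 <= s <= ratr q.2 -> derive1 offset s = dirN x y s v.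
  by move=> /reg/regular_offset[].
have [|||mO ->] := @monotone_area R offset (ratr q.1) (ratr q.2) A q12 _ _ _ mA AI.
- by move=> s /reg/regular_offset[].
- apply: (@subspace_eq_continuous _ _ _ (fun s => dirN x y s v)).
    by move=> s; rewrite inE/= in_itv/= => /dE.
  apply: continuous_in_subspaceT => s; rewrite inE/= in_itv/=.
  by move=> /reg/regular_offset[].
- case: sgn => h; [left|right] => s sq; rewrite dE//; exact: h.
- split => //; apply: eq_integral => s; rewrite inE => /AI /=; rewrite in_itv/= => sq.
  by rewrite dE//; lra.
Qed.

Let cover s : regular s -> dirN x y s v != 0 -> (\bigcup_k I k) s.
Proof.
move=> rs dN; have [_ _ cN] := regular_offset rs; case: (rs) => i ni /andP[bs sb].
have near_rats (d : R) : 0 < d -> exists q : rat * rat, ratr q.1 < s < ratr q.2 /\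
    forall t, ratr q.1 <= t <= ratr q.2 -> `|s - t| < d.
  move=> d0; have [q1] := @rat_in_itvoo R (s - d) s ltac:(lra).
  have [q2] := @rat_in_itvoo R s (s + d) ltac:(lra).
  rewrite !in_itv/= => h2 h1; exists (q1, q2) => /=; split; first by lra.
  by move=> t tq; rewrite ltr_norml; lra.
have [d1 d10 hd1] : exists2 d, 0 < d & forall t, `|s - t| < d -> regular t.
  exists (Num.min (s - b i) (b i.+1 - s)); first by rewrite lt_min; lra.
  move=> t; rewrite lt_min !ltr_norml => ht; exists i => //; lra.
have [d2 d20 hd2] : exists2 d, 0 < d & forall t, `|s - t| < d ->
    `|dirN x y s v - dirN x y t v| < `|dirN x y s v|.
  have n0 : 0 < `|dirN x y s v| by rewrite normr_gt0.
  by move: cN => /cvgrPdist_lt/(_ _ n0)[d /= d0 hd]; exists d => // t /hd.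
have [|q [qs hq]] := near_rats (Num.min d1 d2); first by rewrite lt_min d10.
exists (pickle q); first exact: Logic.I.
rewrite /I pickleK_inv ifT.
  by rewrite /= in_itv/=; lra.
apply/asboolP; split; first by lra.
  by move=> t /hq; rewrite lt_min => /andP[/hd1].
have [dp|dn|d0] := ltgtP 0 (dirN x y s v); last by rewrite d0 eqxx in dN.
  left => t /hq; rewrite lt_min => /andP[_ /hd2 h].
  exact: (same_sign_close h).1.
right => t /hq; rewrite lt_min => /andP[_ /hd2 h].
exact: (same_sign_close h).2.
Qed.

Lemma offset_null (E Z : set R) : measurable E ->
  (forall s, E s -> regular s /\ dirN x y s v != 0) ->
  measurable Z -> mu Z = 0%E -> (forall s, E s -> Z (offset s)) ->
  (\int[mu]_(s in E) (`|dirN x y s v|)%:E = 0)%E.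
Proof.
move=> mE Er mZ Z0 EZ; apply: (fibre_null mI measurable_speed _ speed_area mE _ mZ Z0).
- by move=> s; exact: normr_ge0.
- by move=> s /Er[]; exact: cover.
- by move=> _ [s Es <-]; exact: EZ.
Qed.

Lemma offset_exchange (E E' : set R) (g g' : R -> R) :
  measurable E -> measurable E' -> measurable_fun setT g -> measurable_fun setT g' ->
  (forall s, E s -> regular s /\ dirN x y s v != 0) ->
  (forall s, E' s -> regular s /\ dirN x y s v != 0) ->
  (forall s, E s -> [/\ E' (g s), g' (g s) = s & offset (g s) = offset s]) ->
  (forall s, E' s -> [/\ E (g' s), g (g' s) = s & offset (g' s) = offset s]) ->
  (\int[mu]_(s in E) (`|dirN x y s v|)%:E = \int[mu]_(s in E') (`|dirN x y s v|)%:E)%E.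
Proof.
move=> mE mE' mg mg' Er E'r h h'.
apply: (fibre_bijection mI measurable_speed _ speed_area mE mE' mg mg').
- by move=> s; exact: normr_ge0.
- by move=> s /Er[]; exact: cover.
- by move=> s /E'r[]; exact: cover.
- exact: h.
- exact: h'.
Qed.

End direction.

(** * Integrals over angles *)

Section angular_integrals.
Variable R : realType.
Notation mu := (@lebesgue_measure R).

Lemma integral_preserved (phi : R -> R) : measurable_fun setT phi ->
  (forall A, measurable A -> mu (phi @^-1` A) = mu A) ->
  forall (D : set R) (h : R -> \bar R), measurable D -> measurable_fun setT h ->
  (forall u, 0 <= h u)%E ->
  (\int[mu]_(u in phi @^-1` D) h (phi u) = \int[mu]_(u in D) h u)%E.
Proof.
move=> mphi pres D h mD mh h0.
have mphi' : measurable_fun [set: measurableTypeR R]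
    (phi : measurableTypeR R -> measurableTypeR R) by exact: mphi.
pose f : {mfun measurableTypeR R >-> measurableTypeR R} :=
  HB.pack (phi : measurableTypeR R -> measurableTypeR R)
    (isMeasurableFun.Build _ _ _ _ _ mphi').
have mh' : measurable_fun (D : set (measurableTypeR R)) h by exact: measurable_funTS.
have := @ge0_integral_pushforward _ _ _ _ R f mphi' mu D h mD mh'.
move=> /(_ (fun u _ => h0 u)) e.
transitivity (\int[mu]_(x in f @^-1` D) (h \o f) x)%E; first by [].
rewrite -e; apply: eq_measure_integral => B mB _.
exact: pres.
Qed.

Lemma integral_shift t (D : set R) (h : R -> \bar R) :
  measurable D -> measurable_fun setT h -> (forall u, 0 <= h u)%E ->
  (\int[mu]_(u in (fun u => u + t)%R @^-1` D) h (u + t)%R = \int[mu]_(u in D) h u)%E.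
Proof.
apply: (integral_preserved (measurable_addr t)) => A; exact: lebesgue_measure_shift.
Qed.

Lemma periodic_integral_shift (h : R -> \bar R) (P t : R) : measurable_fun setT h ->
  (forall u, 0 <= h u)%E -> (forall u, h (u + P) = h u) -> 0 <= t <= P ->
  (\int[mu]_(u in `]0%R, P]) h (u + t)%R = \int[mu]_(u in `]0%R, P]) h u)%E.
Proof.
move=> mh h0 per tP.
have split (a b c : R) : a <= b <= c -> (\int[mu]_(u in `]a, c]) h u =
    \int[mu]_(u in `]a, b]) h u + \int[mu]_(u in `]b, c]) h u)%E.
  move=> abc; rewrite -ge0_integral_setU.
  - congr (integral _ _ _); apply/seteqP; split => u /=; rewrite !in_itv/=; first lra.
    by case; lra.
  - exact: measurable_itv.
  - exact: measurable_itv.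
  - exact: measurable_funTS.
  - by move=> u _.
  - apply/disj_setPS => u [/=]; rewrite !in_itv/=; lra.
have sh a b c : (\int[mu]_(u in `]a, b]) h (u + c)%R =
    \int[mu]_(u in `](a + c)%R, (b + c)%R]) h u)%E.
  rewrite -(@integral_shift c `]a + c, b + c]%classic h (measurable_itv _) mh h0).
  suff -> : (fun u => u + c) @^-1` `]a + c, b + c]%classic = `]a, b]%classic by [].
  by apply/seteqP; split => u /=; rewrite !in_itv/=; lra.
rewrite sh add0r (split t P (P + t)); last by lra.
rewrite (split 0 t P)// addeC; congr (_ + _)%E.
rewrite addrC -{1}(add0r P) -sh; apply: eq_integral => u _.
by rewrite per.
Qed.

Lemma unit_vector_angle (a b : R) : a ^+ 2 + b ^+ 2 = 1 ->
  exists2 t : R, 0 <= t <= pi *+ 2 & cos t = a /\ sin t = b.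
Proof.
move=> ab.
have a1 : -1 <= a <= 1 by apply/andP; split; nra.
have sa : sin (acos a) = `|b|.
  by rewrite sin_acos// -sqrtr_sqr; congr Num.sqrt; lra.
have /andP[t0 tpi] := acos_bounds a.
have [b0|b0] := leP 0 b.
  exists (acos a); first by rewrite mulr2n; lra.
  by split; [rewrite acosK// in_itv/=|rewrite sa ger0_norm].
exists (pi *+ 2 - acos a); first by rewrite mulr2n; lra.
rewrite addrC cosD2pi sinD2pi cosN sinN; split; first by rewrite acosK// in_itv/=.
by rewrite sa ltr0_norm// opprK.
Qed.

(** Passage from the angle with the tangent to the absolute direction [u]. Writing [a = cos t] and
    [b = sin t], the right side is the left one extended by zero to a full period, the cut-off being
    [Num.max 0], and then rotated by [t]. *)
Lemma angle_integral (k : R -> R) (a b : R) : measurable_fun setT k ->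
  (forall u, 0 <= k u) -> a ^+ 2 + b ^+ 2 = 1 ->
  (\int[mu]_(u in `[0%R, pi]) (k u * sin u)%:E =
   \int[mu]_(u in `]0%R, (pi *+ 2)%R])
     (k (acos (cos u * a - sin u * b)) * Num.max 0 (sin u * a + cos u * b))%:E)%E.
Proof.
move=> mk k0 /unit_vector_angle[t t2 [<- <-]].
pose h u := k (acos (cos u)) * Num.max 0 (sin u) : R.
have mh : measurable_fun setT h.
  apply: measurable_funM.
    apply: (measurableT_comp mk); apply: (measurableT_comp (@measurable_acos R)).
    exact: continuous_measurable_fun (@continuous_cos R).
  apply: measurable_maxr; first exact: measurable_cst.
  exact: continuous_measurable_fun (@continuous_sin R).
transitivity (\int[mu]_(u in `]0%R, (pi *+ 2)%R]) (h u)%:E)%E; last first.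
  rewrite -(@periodic_integral_shift (EFin \o h) (pi *+ 2) t)//.
  - by apply: eq_integral => u _; rewrite /= /h cosD sinD.
  - exact/measurable_EFinP.
  - by move=> u; rewrite /= lee_fin mulr_ge0// le_max lexx.
  - by move=> u; rewrite /= /h sinD2pi cosD2pi.
rewrite integral_mkcond [RHS]integral_mkcond; apply: eq_integral => u _.
have pi0 := @pi_gt0 R.
rewrite !patchE; case: ifPn; rewrite ?inE ?notin_setE/= in_itv/=.
  move=> u0; case: ifPn; rewrite ?inE ?notin_setE/= in_itv/=.
    move=> u1; rewrite /h cosK ?in_itv//=; congr EFin; congr (_ * _).
    by apply/esym/max_idPr; apply: sin_ge0_pi.
  rewrite mulr2n => u1; have -> : u = 0 by move/negP: u1; lra.
  by rewrite sin0 mulr0.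
move=> u0; case: ifPn => //; rewrite inE/= in_itv/= => u1.
rewrite /h; congr EFin.
suff s0 : sin u <= 0 by rewrite (max_idPl s0) mulr0.
have -> : u = (u - pi) + pi by ring.
rewrite sinDpi oppr_le0; apply: sin_ge0_pi.
by move/negP: u0; rewrite mulr2n in u1; lra.
Qed.

End angular_integrals.

(** * Disintegration of the Liouville measure over directions *)

Section invariance.
Variables (R : realType) (L : R) (x y : R -> R) (Om : set (R * R)).
Hypothesis table : billiard_table L x y Om.
Variables (n : nat) (b : nat -> R).
Hypothesis pieces : smooth_pieces L x y n b.
Notation regular := (regular n b).
Notation mu := (@lebesgue_measure R).
Notation phi := (billiard_map L x y Om).

Definition direction (a : R) : R * R := (cos a, sin a).

(** The footpoints of those points of [A] whose ray has the unit direction [v]. The angle is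
    recovered by [acos], which forgets the sign of the normal component; the second condition
    restores it. *)
Definition beam (A : set (R * R)) (v : R * R) : set R :=
  [set s | A (s, acos (dirT x y s v)) /\ 0 < dirN x y s v].

Let mdx := measurable_dx table pieces.
Let mdy := measurable_dy table pieces.

Let measurable_cos : measurable_fun setT (@cos R).
Proof. exact: continuous_measurable_fun (@continuous_cos R). Qed.

Let measurable_sin : measurable_fun setT (@sin R).
Proof. exact: continuous_measurable_fun (@continuous_sin R). Qed.

Let measurable_fst_snd : [/\ measurable_fun [set: R * R] (fun p => derive1 x p.1),
  measurable_fun [set: R * R] (fun p => derive1 y p.1),
  measurable_fun [set: R * R] (fun p => cos p.2) &
  measurable_fun [set: R * R] (fun p => sin p.2)].
Proof.
split; [exact: (measurableT_comp mdx measurable_fst)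
       |exact: (measurableT_comp mdy measurable_fst)
       |exact: (measurableT_comp measurable_cos measurable_snd)
       |exact: (measurableT_comp measurable_sin measurable_snd)].
Qed.

Let measurable_dirT : measurable_fun setT
  (fun p : R * R => dirT x y p.1 (direction p.2)).
Proof.
have [m1 m2 m3 m4] := measurable_fst_snd.
by apply: measurable_funD; exact: measurable_funM.
Qed.

Let measurable_dirN : measurable_fun setT
  (fun p : R * R => dirN x y p.1 (direction p.2)).
Proof.
have [m1 m2 m3 m4] := measurable_fst_snd.
by apply: measurable_funB; exact: measurable_funM.
Qed.

Lemma measurable_dirT_v v : measurable_fun setT (fun s => dirT x y s v).
Proof. by apply: measurable_funD; apply: measurable_funM. Qed.

Lemma measurable_dirN_v v : measurable_fun setT (fun s => dirN x y s v).
Proof. by apply: measurable_funB; apply: measurable_funM. Qed.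

Let measurable_lift (v : R * R) : measurable_fun setT
  (fun s => (s, acos (dirT x y s v)) : R * R).
Proof.
apply: measurable_fun_pair; first exact: measurable_id.
by apply: (measurableT_comp (@measurable_acos R)); exact: measurable_dirT_v.
Qed.

Lemma measurable_beam (A : set (R * R)) v : measurable A -> measurable (beam A v).
Proof.
move=> mA; have m1 := @measurable_lift v measurableT _ mA.
have m2 : measurable ((fun s => dirN x y s v) @^-1` `]0, +oo[).
  have := @measurable_dirN_v v measurableT `]0, +oo[%classic (measurable_itv _).
  by rewrite setTI.
rewrite setTI in m1.
have -> : beam A v = (fun s => (s, acos (dirT x y s v))) @^-1` A `&`
    (fun s => dirN x y s v) @^-1` `]0, +oo[.
  by apply/seteqP; split => s [] /=; rewrite ?in_itv/= ?andbT.
exact: measurableI.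
Qed.

Let K (A : set (R * R)) (p : R * R) : R :=
  \1_A (p.1, acos (dirT x y p.1 (direction p.2))) *
  Num.max 0 (dirN x y p.1 (direction p.2)).

Let K_ge0 A p : 0 <= K A p.
Proof. by rewrite mulr_ge0// le_max lexx. Qed.

Let measurable_K (A : set (R * R)) : measurable A -> measurable_fun setT (K A).
Proof.
move=> mA; have mA1 : measurable_fun setT (\1_A : R * R -> R) := measurable_indic mA.
apply: measurable_funM; last by apply: measurable_maxr.
apply: (@measurableT_comp _ _ _ _ _ _ (\1_A : R * R -> R)) => //.
apply: measurable_fun_pair => //.
exact: (measurableT_comp (@measurable_acos R)).
Qed.

Definition beam_flux (A : set (R * R)) (v : R * R) : \bar R :=
  (\int[mu]_(s in beam A v) (`|dirN x y s v|)%:E)%E.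

Let beam_fluxE A a : (\int[mu]_s (K A (s, a))%:E = beam_flux A (direction a))%E.
Proof.
rewrite /beam_flux [RHS]integral_mkcond; apply: eq_integral => s _.
rewrite /K/= patchE; case: ifPn; rewrite ?inE ?notin_setE => h.
  by case: h => As dN; rewrite indicE mem_set// mul1r max_r ?ltW// gtr0_norm.
congr EFin; have [dN|dN] := leP (dirN x y s (direction a)) 0.
  by rewrite mulr0.
by rewrite indicE memNset ?mul0r// => As; apply: h.
Qed.

Lemma measurable_beam_flux (A : set (R * R)) : measurable A ->
  measurable_fun setT (fun a => beam_flux A (direction a)).
Proof.
move=> mA; have mK : measurable_fun setT (EFin \o K A).
  by apply/measurable_EFinP; exact: measurable_K.
have K0 p : (0 <= (EFin \o K A) p)%E by rewrite /= lee_fin.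
have -> : (fun a => beam_flux A (direction a)) = fubini_G mu (EFin \o K A).
  by apply/funext => a; rewrite -beam_fluxE.
exact: (@measurable_fun_fubini_tonelli_G _ _
  (measurableTypeR R) (measurableTypeR R) R mu (EFin \o K A) mK K0).
Qed.

(** Fubini is used twice: over each footpoint the inner angle is replaced by the absolute direction,
    and then the order of integration is exchanged. The factor [sin] becomes the normal component of
    the direction. *)
Lemma liouville_beam (A : set (R * R)) : measurable A ->
  (forall z, A z -> regular z.1) ->
  (liouville L A = \int[mu]_(a in `]0%R, (pi *+ 2)%R]) beam_flux A (direction a))%E.
Proof.
move=> mA Areg; have pi0 := @pi_gt0 R.
pose F (z : R * R) : R := \1_A z * (\1_`[0%R, pi] z.2 * sin z.2).
have mA1 : measurable_fun setT (\1_A : R * R -> R) := measurable_indic mA.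
have mF : measurable_fun setT F.
  apply: measurable_funM => //; apply: measurable_funM.
    by apply: (@measurableT_comp _ _ _ _ _ _ (\1_`[0%R, pi] : R -> R)).
  exact: (measurableT_comp measurable_sin).
have F0 z : 0 <= F z.
  rewrite /F mulr_ge0// indicE; case: (boolP (_ \in _)) => [|_]; last by rewrite mul0r.
  by rewrite inE/= in_itv/= => z2; rewrite mul1r sin_ge0_pi.
pose H (p : R * R) : R := \1_`]0%R, pi *+ 2] p.2 * K A p.
have mH : measurable_fun setT H.
  apply: measurable_funM.
    by apply: (@measurableT_comp _ _ _ _ _ _ (\1_`]0%R, pi *+ 2] : R -> R)).
  exact: measurable_K.
have H0 p : 0 <= H p by rewrite mulr_ge0.
transitivity (\int[mu \x mu]_z (F z)%:E)%E.
  rewrite /liouville integral_mkcond; apply: eq_integral => z _.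
  rewrite patchE /F !indicE; case: ifPn; rewrite ?inE ?notin_setE/=.
    by move=> [Az [/= _ z2]]; rewrite !mem_set// !mul1r.
  move=> nA; case: (boolP (z \in A)) => zA; last by rewrite mul0r.
  rewrite mul1r; case: (boolP (z.2 \in _)) => z2; last by rewrite mul0r.
  exfalso; apply: nA; rewrite inE in zA; rewrite inE in z2; split => //; split => //.
  by have := regular_bounds pieces (Areg _ zA); rewrite /= in_itv/=; lra.
rewrite fubini_tonelli1; [|exact/measurable_EFinP|by move=> z; rewrite lee_fin].
transitivity (\int[mu]_s \int[mu]_a (H (s, a))%:E)%E.
  apply: eq_integral => s _; rewrite /fubini_F.
  have [rs|nrs] := pselect (regular s); last first.
    have A0 t : \1_A (s, t) = 0 :> R.
      by rewrite indicE memNset// => /Areg.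
    rewrite !integral0_eq// => t _; first by rewrite /H /K A0 mul0r mulr0.
    by rewrite /F A0 mul0r.
  have [_ _ _ unit] := regular_smooth pieces rs.
  have ms : measurable_fun setT (fun t : R => \1_A (s, t) : R).
    by apply: (@measurableT_comp _ _ _ _ _ _ (\1_A : R * R -> R)).
  transitivity (\int[mu]_(t in `[0%R, pi]) (\1_A (s, t) * sin t)%:E)%E.
    rewrite [RHS]integral_mkcond; apply: eq_integral => t _.
    rewrite patchE /F/= indicE indicE; case: ifPn => _; first by rewrite mul1r.
    by rewrite mul0r mulr0.
  rewrite (@angle_integral _ _ (derive1 x s) (- derive1 y s))//; last by rewrite sqrrN.
  rewrite integral_mkcond; apply: eq_integral => t _.
  rewrite patchE /H [X in X * K _ _]indicE/=; case: ifPn => _; last by rewrite mul0r.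
  by rewrite /K /dirT /dirN/= mul1r !mulrN opprK.
have := @fubini_tonelli _ _ _ _ R mu mu (EFin \o H).
rewrite /= => ->; [|exact/measurable_EFinP|by move=> z; rewrite lee_fin].
rewrite [RHS]integral_mkcond; apply: eq_integral => a _.
rewrite patchE; case: ifPn => [a0|/negbTE a0]; last first.
  by rewrite integral0_eq// => s _; rewrite /H/= indicE a0 mul0r.
rewrite -beam_fluxE; apply: eq_integral => s _.
by rewrite /H /= indicE a0 mul1r.
Qed.

End invariance.

(** * The Liouville measure and time reversal *)

Section liouville_measure.
Variables (R : realType) (L : R).
Notation mu := (@lebesgue_measure R).

(** The indicator makes the weight nonnegative on the whole plane, so that the Liouville measure
    becomes a finite measure there, with all of its mass on [Phi L]. *)
Definition liouville_density (z : R * R) : R := \1_(Phi L) z * sin z.2.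
Notation w := liouville_density.

Lemma measurable_liouville_density : measurable_fun setT w.
Proof.
apply: measurable_funM.
  by apply: measurable_indic; apply: measurableX; exact: measurable_itv.
have ms : measurable_fun setT (@sin R) := continuous_measurable_fun (@continuous_sin R).
exact: (measurableT_comp ms measurable_snd).
Qed.

Lemma liouville_density_ge0 z : 0 <= w z.
Proof.
rewrite /w indicE; case: (boolP (_ \in _)) => [|_]; last by rewrite mul0r.
by rewrite inE => -[_ /=]; rewrite in_itv/= => z2; rewrite mul1r sin_ge0_pi.
Qed.

Definition liouville_measure := density (mu \x mu)%E
  measurable_liouville_density liouville_density_ge0.
HB.instance Definition _ := Measure.on liouville_measure.

Lemma liouville_measureE (A : set (R * R)) : liouville_measure A = liouville L A.
Proof.
rewrite /liouville_measure /density /liouville integral_mkcondr.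
apply: eq_integral => z _; rewrite patchE /w indicE.
by case: ifPn => _; rewrite ?mul1r ?mul0r.
Qed.

Lemma integral_sin : (\int[mu]_(t in `[0%R, pi]) (sin t)%:E = 2%:E)%E.
Proof.
have pi0 := @pi_gt0 R.
rewrite (@continuous_FTC2 R (@sin R) (fun t => - cos t) 0 pi)//.
- by rewrite cospi cos0 -EFinB; congr EFin; ring.
- by apply: continuous_subspaceT; exact: continuous_sin.
- split.
  + move=> t _; apply: derivableN; exact: derivable_cos.
  + apply: cvg_at_right_filter; apply: cvgN; exact: continuous_cos.
  + apply: cvg_at_left_filter; apply: cvgN; exact: continuous_cos.
- move=> t _; rewrite derive1E deriveN; last exact: derivable_cos.
  by rewrite derive_val opprK.
Qed.

Let liouville_PhiE : (liouville L (Phi L) = 2%:E * mu `[0%R, L]%classic)%E.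
Proof.
have mI : measurable_fun setT (\1_(Phi L) : R * R -> R).
  by apply: measurable_indic; apply: measurableX; exact: measurable_itv.
transitivity (\int[mu \x mu]_z (w z)%:E)%E.
  rewrite /liouville setIid integral_mkcond; apply: eq_integral => z _.
  by rewrite patchE /w indicE; case: ifPn => _; rewrite ?mul1r ?mul0r.
rewrite fubini_tonelli1; first last.
- by move=> z; rewrite lee_fin liouville_density_ge0.
- by apply/measurable_EFinP; exact: measurable_liouville_density.
transitivity (\int[mu]_(s in `[0%R, L]) (cst 2%:E) s)%E.
  rewrite [RHS]integral_mkcond; apply: eq_integral => s _; rewrite patchE /fubini_F.
  case: ifPn => sL.
    rewrite -[RHS]integral_sin [RHS]integral_mkcond; apply: eq_integral => t _.
    rewrite patchE /w indicE /=; case: ifPn; rewrite ?inE ?notin_setE => t0.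
      by rewrite mem_set ?mul1r//; split => //; rewrite inE in sL.
    by rewrite memNset ?mul0r// => -[].
  rewrite integral0_eq// => t _; rewrite /w indicE memNset ?mul0r// => -[s0 _].
  by rewrite notin_setE in sL.
by rewrite integral_cst.
Qed.

Lemma liouville_Phi : 0 < L -> liouville L (Phi L) = (2 * L)%:E.
Proof. by move=> L0; rewrite liouville_PhiE lebesgue_cc// subr0. Qed.

Let liouville_finite : fin_num_fun liouville_measure.
Proof.
have h : liouville_measure setT = liouville L (Phi L).
  by rewrite liouville_measureE /liouville setTI setIid.
apply: lty_fin_num_fun; rewrite -[X in (X < _)%E]/(liouville_measure setT) h.
rewrite liouville_PhiE lebesgue_measure_itv/=; case: ifP => _; last by rewrite mule0 ltry.
by rewrite -EFinB -EFinM ltry.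
Qed.

HB.instance Definition _ := Measure_isFinite.Build _ _ _ liouville_measure liouville_finite.

Lemma measurable_reverse : measurable_fun [set: R * R] (@reverse R).
Proof.
apply: measurable_fun_pair; first exact: measurable_fst.
by apply: measurable_funB; [exact: measurable_cst|exact: measurable_snd].
Qed.

Lemma reverse_integral (h : R * R -> R) : measurable_fun setT h -> (forall z, 0 <= h z) ->
  (\int[mu \x mu]_z (h (reverse z) * w z)%:E = \int[mu \x mu]_z (h z * w z)%:E)%E.
Proof.
move=> mh h0; have w0 := liouville_density_ge0; have mw := measurable_liouville_density.
have fubini (k : R * R -> R) : measurable_fun setT k -> (forall z, 0 <= k z) ->
    (\int[mu \x mu]_z (k z * w z)%:E = \int[mu]_s \int[mu]_t (k (s, t) * w (s, t))%:E)%E.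
  move=> mk k0; rewrite -(@fubini_tonelli1 _ _ _ _ R mu mu (fun z => (k z * w z)%:E))//.
  - by apply/measurable_EFinP; exact: measurable_funM.
  - by move=> z; rewrite lee_fin mulr_ge0.
have mhr := measurableT_comp mh measurable_reverse.
rewrite (fubini _ mh h0) (fubini _ mhr (fun z => h0 (reverse z))).
apply: eq_integral => s _.
have mf : measurable_fun setT (fun t : R => (h (s, t) * w (s, t))%:E).
  apply/measurable_EFinP.
  apply: (@measurableT_comp _ _ _ _ _ _ (fun z => h z * w z) _ (pair s)) => //.
  exact: measurable_funM.
have mp : measurable_fun [set: R] (fun t => pi - t).
  by apply: measurable_funB; [exact: measurable_cst|exact: measurable_id].
have pres (B : set R) : measurable B -> mu ((fun t => pi - t) @^-1` B) = mu B.
  move=> mB; rewrite -(lebesgue_measure_shift pi mB) -lebesgue_measure_opp; last first.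
    by rewrite -[X in measurable X]setTI; exact: mp.
  by congr (mu _); apply/seteqP; split => t /=; rewrite opprK addrC.
have f0 t : (0 <= (h (s, t) * w (s, t))%:E)%E by rewrite lee_fin mulr_ge0.
rewrite -(integral_preserved mp pres measurableT mf f0) preimage_setT.
apply: eq_integral => t _; congr (_ * _)%:E.
have -> : w (s, pi - t) = \1_(Phi L) (s, pi - t) * sin t.
  by rewrite /w /= (addrC pi) sinDpi sinN opprK.
rewrite /w !indicE; congr (_%:R * _); congr nat_of_bool.
by apply/idP/idP; rewrite !inE => -[/= h1]; rewrite in_itv/= => h2; split => //=;
  rewrite in_itv/=; lra.
Qed.

Lemma liouville_reverse (A : set (R * R)) : measurable A ->
  liouville L (@reverse R @^-1` A) = liouville L A.
Proof.
move=> mA; have E B : (liouville L B = \int[mu \x mu]_z (\1_B z * w z)%:E)%E.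
  rewrite -liouville_measureE /liouville_measure /density integral_mkcond.
  apply: eq_integral => z _; rewrite patchE indicE.
  by case: ifPn => _; rewrite ?mul1r ?mul0r.
rewrite !E -(reverse_integral (measurable_indic mA))//.
Qed.

End liouville_measure.

Lemma reverseK (R : realType) : involutive (@reverse R).
Proof. by case=> s t; rewrite /reverse/= opprB addrC subrK. Qed.

(** * Invariance of the Liouville measure *)

Section bounce.
Variables (R : realType) (L : R) (x y : R -> R) (Om : set (R * R)).
Hypothesis table : billiard_table L x y Om.
Variables (n : nat) (b : nat -> R).
Hypothesis pieces : smooth_pieces L x y n b.
Notation regular := (regular n b).
Notation mu := (@lebesgue_measure R).
Notation phi := (billiard_map L x y Om).

Let smooth s : regular s -> smooth_at L x y s.
Proof. exact: regular_smooth. Qed.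

Let opp (v : R * R) : R * R := (- v.1, - v.2).

Let dirN_opp s v : dirN x y s (opp v) = - dirN x y s v.
Proof. by rewrite /dirN /= !mulNr opprD. Qed.

Definition bounce (z : R * R) : R * R := reverse (phi z).

(** The hypotheses of [billiard_reversal], with smoothness strengthened to regularity. They are
    symmetric in the two ends of the chord, which is why [bounce] maps this set to itself and is an
    exact involution on it. *)
Definition transversal : set (R * R) := [set z | [/\ regular z.1, 0 < z.2 < pi,
  regular (phi z).1 & dirN x y (phi z).1 (bdir x y z) != 0]].

Lemma bounce_transversal z : transversal z ->
  [/\ transversal (bounce z), bounce (bounce z) = z &
      bdir x y (bounce z) = (- (bdir x y z).1, - (bdir x y z).2)].
Proof.
case: z => s th [rs th0 rs' dN].
have [h1 h2 h3 _] := billiard_reversal table (smooth rs) th0 (smooth rs') dN.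
have e : bounce (bounce (s, th)) = (s, th).
  by rewrite /bounce h2 reverseK.
split; [split|exact: e|exact: h3].
- exact: rs'.
- exact: h1.
- by rewrite /bounce h2; exact: rs.
- rewrite /bounce h2 h3 dirN_opp (dirN_bdir _ (smooth rs)) oppr_eq0 gt_eqF//.
  exact: sin_gt0_pi.
Qed.

Lemma bdir_acos s v : regular s -> v.1 ^+ 2 + v.2 ^+ 2 = 1 -> 0 < dirN x y s v ->
  0 < acos (dirT x y s v) < pi /\ bdir x y (s, acos (dirT x y s v)) = v.
Proof.
move=> rs v1 dN; have [_ _ _ unit] := smooth rs.
have e : dirT x y s v ^+ 2 + dirN x y s v ^+ 2 = 1.
  rewrite -[RHS]mulr1 -{1}v1 -unit /dirT /dirN; ring.
have T1 : -1 < dirT x y s v < 1 by apply/andP; split; nra.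
have T2 : -1 <= dirT x y s v <= 1 by lra.
split; first by rewrite acos_gt0 ?acos_ltpi//; lra.
apply: (dirTN_eq (smooth rs)).
  by rewrite (dirT_bdir _ (smooth rs)) acosK// in_itv/=.
rewrite (dirN_bdir _ (smooth rs)) sin_acos// -e addrC addKr sqrtr_sqr gtr0_norm//.
Qed.

Lemma hit_offset s th (v := bdir x y (s, th)) : regular s -> 0 < th < pi ->
  0 <= (phi (s, th)).1 < L /\ offset x y v (phi (s, th)).1 = offset x y v s.
Proof.
move=> rs th0; have [_ _ s' g] := hit_spec table (smooth rs) th0.
split => //; have xs := congr1 fst g; have ys := congr1 snd g; rewrite /= in xs ys.
rewrite /offset /= xs ys -/v; ring.
Qed.

Let landing v s := (bounce (s, acos (dirT x y s v))).1.

(** For a fixed direction [bounce] reduces to a map of footpoints: [landing v] carries one beam to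
    the beam of the opposite direction, [landing (opp v)] undoes it, and both ends of a chord have
    the same offset. *)
Let landing_spec v (A B : set (R * R)) : v.1 ^+ 2 + v.2 ^+ 2 = 1 ->
  A `<=` transversal -> (forall z, A z -> B (bounce z)) ->
  forall s, beam x y A v s -> [/\ beam x y B (opp v) (landing v s),
    landing (opp v) (landing v s) = s & offset x y v (landing v s) = offset x y v s].
Proof.
move=> v1 Ag AB s [As dN]; have [/= rs th0 rs' dN'] := Ag _ As.
have [_ ev] := bdir_acos rs v1 dN.
have [h1 h2 h3] := bounce_transversal (Ag _ As).
have [_ ho] := hit_offset rs th0; rewrite ev in ho h3.
have [_ th0' _ _] := h1.
have th' : 0 <= (bounce (s, acos (dirT x y s v))).2 <= pi by lra.
have e : (landing v s, acos (dirT x y (landing v s) (opp v))) =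
    bounce (s, acos (dirT x y s v)).
  have := dirT_bdir (bounce (s, acos (dirT x y s v))).2 (smooth rs').
  rewrite -[X in bdir _ _ X]/(bounce (s, acos (dirT x y s v))) h3 -/(opp v) => ->.
  by rewrite cosK.
split.
- split; first by rewrite e; exact: AB.
  have := dirN_bdir (bounce (s, acos (dirT x y s v))).2 (smooth rs').
  rewrite -[X in bdir _ _ X]/(bounce (s, acos (dirT x y s v))) h3 -/(opp v) => ->.
  exact: sin_gt0_pi.
- rewrite -[LHS]/(bounce (landing v s, acos (dirT x y (landing v s) (opp v)))).1.
  by rewrite e h2.
- exact: ho.
Qed.

Lemma measurable_regular : measurable [set s | regular s].
Proof.
have -> : [set s | regular s] = \bigcup_(i in [set i | (i < n)%N]) `]b i, b i.+1[%classic.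
  by apply/seteqP; split => s [i ni si]; exists i => //; rewrite /= in_itv/= in si *.
by apply: bigcup_measurable => i _; exact: measurable_itv.
Qed.

Let measurable_pre d d' (X : measurableType d) (Y : measurableType d') (f : X -> Y) B :
  measurable_fun setT f -> measurable B -> measurable (f @^-1` B).
Proof. by move=> mf mB; rewrite -[X in measurable X]setTI; exact: mf. Qed.

Let mphi := measurable_billiard_map table pieces.

Let mphi1 : measurable_fun [set: R * R] (fun z => (phi z).1).
Proof. exact: (measurableT_comp measurable_fst mphi). Qed.

Lemma measurable_bounce : measurable_fun setT bounce.
Proof. exact: (measurableT_comp (@measurable_reverse R) mphi). Qed.

Let off_breaks : set (R * R) := [set z | regular z.1 /\ 0 < z.2 < pi].

Let measurable_off_breaks : measurable off_breaks.
Proof.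
have m1 : measurable (fst @^-1` [set s | regular s] : set (R * R)).
  exact: (measurable_pre measurable_fst measurable_regular).
have m2 : measurable (snd @^-1` `]0, pi[ : set (R * R)).
  exact: (measurable_pre measurable_snd (measurable_itv _)).
have -> : off_breaks = fst @^-1` [set s | regular s] `&` snd @^-1` `]0, pi[.
  by apply/seteqP; split => z [] /= h1; rewrite ?in_itv/=.
exact: measurableI.
Qed.

Lemma measurable_transversal : measurable transversal.
Proof.
have [mb1 mb2] := measurable_bdir table pieces.
have mN : measurable_fun setT (fun z => dirN x y (phi z).1 (bdir x y z)).
  apply: measurable_funB; apply: measurable_funM => //.
    exact: (measurableT_comp (measurable_dx table pieces) mphi1).
  exact: (measurableT_comp (measurable_dy table pieces) mphi1).
have m3 := measurable_pre mphi1 measurable_regular.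
have m4 := measurable_pre mN (measurableC (measurable_set1 0)).
have -> : transversal = off_breaks `&` ((fun z => (phi z).1) @^-1` [set s | regular s] `&`
    (fun z => dirN x y (phi z).1 (bdir x y z)) @^-1` ~` [set 0]).
  apply/seteqP; split => z; first by move=> [? ? ? /eqP ?].
  by move=> [[? ?] [? /eqP ?]].
exact: (measurableI _ _ measurable_off_breaks (measurableI _ _ m3 m4)).
Qed.

Let unit_direction a : (direction a).1 ^+ 2 + (direction a).2 ^+ 2 = 1 :> R.
Proof. exact: cos2Dsin2. Qed.

Let opp_direction a : direction (a + pi) = opp (direction a).
Proof. by rewrite /direction cosDpi sinDpi. Qed.

(** The maps [landing v] and [landing (opp v)] are mutually inverse between the two beams and
    preserve the offset, so [offset_exchange] applies. Reversing [v] changes only the sign of the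
    normal component. *)
Let bounce_flux (B : set (R * R)) v : v.1 ^+ 2 + v.2 ^+ 2 = 1 ->
  measurable B -> B `<=` transversal ->
  beam_flux x y (transversal `&` bounce @^-1` B) v = beam_flux x y B (opp v).
Proof.
move=> v1 mB Bg; set A := transversal `&` _.
have mA : measurable A.
  exact: measurableI measurable_transversal (measurable_pre measurable_bounce mB).
have ov1 : (opp v).1 ^+ 2 + (opp v).2 ^+ 2 = 1 by rewrite /= !sqrrN.
have AB z : A z -> B (bounce z) by case.
have BA z : B z -> A (bounce z).
  by move=> Bz; have [h1 h2 _] := bounce_transversal (Bg _ Bz); split => //=; rewrite h2.
have ooE : opp (opp v) = v by rewrite /opp /= !opprK; case: (v).
have mb1 := measurableT_comp measurable_fst measurable_bounce.
have mland u : measurable_fun setT (landing u).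
  apply: (measurableT_comp mb1); apply: measurable_fun_pair => //.
  apply: (measurableT_comp (@measurable_acos R)).
  exact: (measurable_dirT_v table pieces).
transitivity (\int[mu]_(s in beam x y B (opp v)) (`|dirN x y s v|)%:E)%E; last first.
  by apply: eq_integral => s _; rewrite dirN_opp normrN.
apply: (offset_exchange table pieces (measurable_beam table pieces _ mA)
  (measurable_beam table pieces _ mB) (mland v) (mland (opp v))).
- by move=> s [[[? _ _ _] _] /gt_eqF ->].
- move=> s [/Bg[? _ _ _]]; rewrite dirN_opp oppr_gt0 => /lt_eqF ->; by [].
- exact: landing_spec v1 (@subIsetl _ _ _) AB.
- move=> s Es; have [] := landing_spec ov1 Bg BA Es.
  rewrite ooE => h1 h2 h3; split => //.
  by move: h3; rewrite /offset /= !mulrN; lra.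
Qed.

Lemma liouville_bounce_transversal (B : set (R * R)) : measurable B -> B `<=` transversal ->
  liouville L (transversal `&` bounce @^-1` B) = liouville L B.
Proof.
move=> mB Bg.
have mA : measurable (transversal `&` bounce @^-1` B).
  exact: measurableI measurable_transversal (measurable_pre measurable_bounce mB).
have regA z : (transversal `&` bounce @^-1` B) z -> regular z.1 by case=> -[].
have regB z : B z -> regular z.1 by move=> /Bg[].
rewrite (liouville_beam table pieces mA regA) (liouville_beam table pieces mB regB).
have pi0 := @pi_gt0 R.
(* Reversing a chord turns direction [a] into [a + pi], and a half turn does not change the integral
   over all directions. *)
rewrite -(@periodic_integral_shift _ (fun a => beam_flux x y B (direction a)) (pi *+ 2) pi).
- apply: eq_integral => a _; rewrite opp_direction; exact: bounce_flux.
- exact: (measurable_beam_flux table pieces mB).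
- by move=> a; apply: integral_ge0 => s _; rewrite lee_fin.
- by move=> a; rewrite /direction cosD2pi sinD2pi.
- by rewrite mulr2n; lra.
Qed.

(** A chord has the same offset at both ends, so a bad landing puts the offset of the starting
    footpoint into the null set of critical offsets. In the beam itself the derivative of the offset
    is nonzero, hence these footpoints carry no flux. *)
Let tangent_null : liouville L (off_breaks `\` transversal) = 0%E.
Proof.
have mD := measurableD measurable_off_breaks measurable_transversal.
rewrite (liouville_beam table pieces)//; last by move=> z [[]].
apply: integral0_eq => a _; set v := direction a.
have [Z [mZ Z0 Zc Zb]] := critical_offsets_null pieces v.
apply: (offset_null table pieces (measurable_beam table pieces v mD) _ mZ Z0).
  by move=> s [[[? _] _] /gt_eqF ->].
move=> s [[[/= rs th0] nT] dN].
have [_ ev] := bdir_acos rs (unit_direction a) dN.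
have [s'L] := hit_offset rs th0; rewrite ev => <-.
have [rs'|nr] := pselect (regular (phi (s, acos (dirT x y s v))).1).
  apply: Zc => //; apply/eqP/negPn/negP => ne; apply: nT; split => //=.
  by rewrite ev.
have [i ni ->] : exists2 i, (i <= n)%N & (phi (s, acos (dirT x y s v))).1 = b i.
  apply: contrapT => h; apply: nr; apply: (not_break_regular pieces); first by lra.
  by move=> i ni; apply/eqP => e; apply: h; exists i.
exact: Zb.
Qed.

Let breaks_null : liouville L (Phi L `\` off_breaks) = 0%E.
Proof.
pose F := b @` [set i | (i <= n)%N].
have cF : countable F by apply: sub_countable (card_image_le _ _) _.
have mF : measurable F by exact: countable_measurable.
have F0 : mu F = 0%E by exact: countable_lebesgue_measure0.
pose E : set R := [set 0; pi].
have mE : measurable E by apply: measurableU; exact: measurable_set1.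
have E0 : mu E = 0%E.
  by apply: countable_lebesgue_measure0; apply: finite_set_countable; exact: finite_set2.
have m1 : measurable (F `*` [set: R]) by exact: measurableX.
have m2 : measurable ([set: R] `*` E) by exact: measurableX.
have N1 : ((mu \x mu) (F `*` [set: R]) = 0)%E.
  by transitivity (mu F * mu [set: R])%E; [exact: product_measure1E|rewrite F0 mul0e].
have N2 : ((mu \x mu) ([set: R] `*` E) = 0)%E.
  by transitivity (mu [set: R] * mu E)%E; [exact: product_measure1E|rewrite E0 mule0].
have mP : measurable (Phi L) by apply: measurableX; exact: measurable_itv.
have mD : measurable (Phi L `\` off_breaks) := measurableD mP measurable_off_breaks.
have sub : Phi L `\` off_breaks `<=` F `*` [set: R] `|` [set: R] `*` E.
  move=> [s t] [[/=]]; rewrite !in_itv/= => sL tpi no.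
  have [[i ni e]|nb] := pselect (exists2 i, (i <= n)%N & s = b i).
    by left; split => //; exists i.
  right; split => //=; apply: contrapT => nE; apply: no; split => /=.
    by apply: (not_break_regular pieces) => // i ni; apply/eqP => e; apply: nb; exists i.
  have t0 : t != 0 by apply/eqP => e; apply: nE; left.
  have tp : t != pi by apply/eqP => e; apply: nE; right.
  by rewrite !lt_neqAle eq_sym t0 tp.
rewrite /liouville setIidl; last by move=> z [].
apply: null_set_integral.
- exact: mD.
- apply: measurable_funTS; apply/measurable_EFinP.
  have ms : measurable_fun setT (@sin R) := continuous_measurable_fun (@continuous_sin R).
  exact: (measurableT_comp ms measurable_snd).
- apply: (@subset_measure0 _ _ _ (mu \x mu)%E _ (F `*` [set: R] `|` [set: R] `*` E)).
  + exact: mD.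
  + exact: (measurableU _ _ m1 m2).
  + exact: sub.
  + by apply: null_set_setU; [exact: m1|exact: m2|exact: N1|exact: N2].
Qed.

Lemma almost_all_transversal : liouville L (~` transversal) = 0%E.
Proof.
have mC := measurableC measurable_transversal.
have mP : measurable (Phi L) by apply: measurableX; exact: measurable_itv.
have mD1 := measurableD measurable_off_breaks measurable_transversal.
have mD2 := measurableD mP measurable_off_breaks.
transitivity (liouville_measure L (Phi L `\` transversal)).
  rewrite liouville_measureE /liouville; congr (integral _ _ _).
  by apply/seteqP; split => z; [move=> [h1 h2]|move=> [[h1 h2] h3]].
apply: (@subset_measure0 _ _ _ (liouville_measure L) _
    ((off_breaks `\` transversal) `|` (Phi L `\` off_breaks))).
- exact: measurableD mP measurable_transversal.
- exact: measurableU.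
- move=> z [Pz nz]; have [h|h] := pselect (off_breaks z); [by left|by right].
- apply: null_set_setU => //.
    by have := tangent_null; rewrite -liouville_measureE.
  by have := breaks_null; rewrite -liouville_measureE.
Qed.

Lemma liouville_billiard_map (A : set (R * R)) : measurable A ->
  liouville L (phi @^-1` A) = liouville L A.
Proof.
move=> mA.
have mr (B : set (R * R)) : measurable B -> measurable (@reverse R @^-1` B).
  exact: (measurable_pre (@measurable_reverse R)).
have ae (B : set (R * R)) : measurable B -> liouville L (transversal `&` B) = liouville L B.
  move=> mB; have mI := measurableI _ _ measurable_transversal mB.
  have mC := measurableC measurable_transversal.
  rewrite -!liouville_measureE; apply/eqP; rewrite eq_le; apply/andP; split.
    by apply: le_measure; rewrite ?inE//; exact: subIsetr.
  have <- : (liouville_measure L (transversal `&` B) +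
      liouville_measure L (~` transversal) = liouville_measure L (transversal `&` B))%E.
    by rewrite [X in (_ + X)%E]liouville_measureE almost_all_transversal adde0.
  apply: le_trans (@measureU2 _ _ _ (liouville_measure L) _ _ mI mC).
  apply: le_measure; rewrite ?inE//; first exact: (measurableU _ _ mI mC).
  by move=> z Bz; have [t|t] := pselect (transversal z); [left|right].
(* As [reverse] is an involution, [phi] is [reverse] after [bounce]; its invariance follows from
   that of the two factors. *)
have e : phi @^-1` A = bounce @^-1` (@reverse R @^-1` A).
  by apply/funext => z; rewrite /preimage/= /bounce reverseK.
rewrite e -(liouville_reverse L mA); move: (mr A mA); move: (_ @^-1` A) => B mB.
have mbB : measurable (bounce @^-1` B) := measurable_pre measurable_bounce mB.
have mgB : measurable (transversal `&` B) := measurableI _ _ measurable_transversal mB.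
rewrite -(ae _ mbB) -(ae _ mB) -(liouville_bounce_transversal mgB)//.
(* Points of [transversal] bounce into [transversal], so intersecting [B] with it makes no
   difference here. *)
congr (liouville _ _); apply/seteqP; split => z [tz].
  by move=> Bz; have [tz' _ _] := bounce_transversal tz; exact: (conj tz (conj tz' Bz)).
by move=> [_ Bz]; exact: (conj tz Bz).
Qed.

End bounce.

Lemma measurable_one_sub (R : realType) : measurable_fun setT (fun t : R => 1 - t).
Proof. by apply: measurable_funB; [exact: measurable_cst|exact: measurable_id]. Qed.

(** * The rotation number as a Birkhoff limit *)

Section rotation.
Variables (R : realType) (L : R) (x y : R -> R) (Om : set (R * R)).
Hypothesis table : billiard_table L x y Om.
Variables (n : nat) (b : nat -> R).
Hypothesis pieces : smooth_pieces L x y n b.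
Notation mu := (@lebesgue_measure R).
Notation phi := (billiard_map L x y Om).
Notation nu := (liouville_measure L).

Let L0 : 0 < L. Proof. by case: table => -[]. Qed.

Let X := (measurableTypeR R * measurableTypeR R)%type.

Let T : X -> X := phi.
Let J : X -> X := @reverse R.

(* The junk value off [0 <= z.1] makes the bound hold everywhere. *)
Let f (z : X) : R := if 0 <= z.1 then fgain L x y Om z / L else 0.

(** A version of [rotation_number] whose values lie in [[0, 1]] on the whole plane, as the abstract
    theorem on reversible systems requires. *)
Definition rotation : R * R -> R := birkhoff_lim T f.

Let mpT : measure_preserving nu T.
Proof.
split; first exact: (measurable_billiard_map table pieces).
move=> A mA; apply: (etrans (liouville_measureE L _)).
apply: (etrans _ (esym (liouville_measureE L _))).
exact: (liouville_billiard_map table pieces mA).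
Qed.

Let mpJ : measure_preserving nu J.
Proof.
split; first exact: (@measurable_reverse R).
move=> A mA; apply: (etrans (liouville_measureE L _)).
apply: (etrans _ (esym (liouville_measureE L _))).
exact: (liouville_reverse L mA).
Qed.

Let ae_transversal (P : R * R -> Prop) :
  (forall z, transversal L x y Om n b z -> P z) -> {ae nu, forall z, P z}.
Proof.
move=> H; exists (~` transversal L x y Om n b); split.
- exact: (measurableC (measurable_transversal table pieces)).
- by rewrite [LHS]liouville_measureE (almost_all_transversal table pieces).
- by move=> z nP tz; apply: nP; exact: H.
Qed.

Let TJT : {ae nu, forall z, T (J (T z)) = J z}.
Proof.
apply: ae_transversal => z /(bounce_transversal table pieces)[_ e _].
by rewrite -[LHS]reverseK -[X in _ = reverse X]e.
Qed.

Let mf : measurable_fun setT f.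
Proof.
apply: measurable_fun_ifT; last exact: measurable_cst.
  by apply: measurable_fun_ler; [exact: measurable_cst|exact: measurable_fst].
by apply: measurable_funM; [exact: (measurable_fgain table pieces)|exact: measurable_cst].
Qed.

Let f01 z : 0 <= f z <= 1.
Proof.
rewrite /f; case: ifPn => [/(fgain_bounds table)/andP[h1 h2]|_]; last by rewrite lexx ler01.
by apply/andP; split; [rewrite divr_ge0// ltW|rewrite ler_pdivrMr// mul1r].
Qed.

Let fM z : `|f z| <= 1.
Proof. by rewrite ler_norml; have := f01 z; lra. Qed.

Let fJT : {ae nu, forall z, f (J (T z)) = 1 - f z}.
Proof.
apply: ae_transversal => -[s th] tz.
have [rs th0 rs' dN] := tz.
have sm := regular_smooth pieces rs; have sm' := regular_smooth pieces rs'.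
have /= s0 := regular_bounds pieces rs.
have s'0 : 0 <= (J (T (s, th))).1 by have /andP[/ltW] := regular_bounds pieces rs'.
rewrite /f s'0 ifT /=; last by lra.
have -> : fgain L x y Om (J (T (s, th))) = L - fgain L x y Om (s, th).
  exact: (fgain_reversal table sm th0 sm' dN).
by rewrite mulrBl divff// gt_eqF.
Qed.

Lemma rotation_reverse : {ae nu, forall z, rotation (reverse z) = 1 - rotation z}.
Proof. exact: (birkhoff_lim_reversed mpT mpJ (@reverseK R) TJT mf f01 fJT). Qed.

Lemma measurable_rotation : measurable_fun setT rotation.
Proof. exact: (measurable_birkhoff_lim mpT mf). Qed.

Lemma rotation_invariant z : rotation (phi z) = rotation z.
Proof. exact: (birkhoff_lim_invariant T z fM). Qed.

Lemma rotation_bounds z : 0 <= rotation z <= 1.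
Proof. exact: (birkhoff_lim_bounds T f01). Qed.

(** Orbits starting in [Phi L] stay there, so the default in [f] never enters. The equality includes
    the points where the averages diverge, since both sides are then [0]. *)
Lemma rotation_numberE z : Phi L z -> rotation_number L x y Om z = rotation z.
Proof.
move=> Pz; pose u k : R :=
  (\sum_(i < k.+1) fgain L x y Om (iter i phi z)) / k.+1%:R.
have uE : birkhoff_avg T f ^~ z = (fun k => u k / L).
  apply/funext => k; rewrite /birkhoff_avg /u mulrAC; congr (_ / _); rewrite mulr_suml.
  apply: eq_bigr => i _; rewrite /f ifT//.
  have : Phi L (iter i phi z) by case: (val i) => [|j]//; exact: billiard_map_Phi.
  by move=> [/=]; rewrite in_itv/= => /andP[].
rewrite /rotation_number /footpoint_gain -/u /rotation /birkhoff_lim uE.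
have Ln : L != 0 by rewrite gt_eqF.
have [cu|ncu] := pselect (cvgn u).
  by apply/esym/cvg_lim => //; exact: cvgMl.
have nv : ~ cvgn (fun k => u k / L).
  move=> cv; apply: ncu.
  have -> : u = (fun k => (u k / L) * L) by apply/funext => k; rewrite divfK.
  exact: is_cvgMl.
by rewrite (dvgP ncu) (dvgP nv) mul0r.
Qed.

Let measurable_pre (B : set R) : measurable B -> measurable (rotation @^-1` B).
Proof.
by move=> mB; rewrite -[S in measurable S]setTI; exact: measurable_rotation.
Qed.

Let nu_fin A : measurable A -> nu A \is a fin_num.
Proof. exact: fin_num_measure. Qed.

Lemma rotation_symmetric (B : set R) : measurable B ->
  liouville L (rotation @^-1` B) = liouville L (rotation @^-1` ((fun t => 1 - t) @^-1` B)).
Proof.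
move=> mB.
have mB' : measurable ((fun t : R => 1 - t) @^-1` B).
  by rewrite -[S in measurable S]setTI; exact: measurable_one_sub.
have m1 := measurable_pre mB; have m2 := measurable_pre mB'.
have m3 : measurable (@reverse R @^-1` (rotation @^-1` B)).
  by rewrite -[S in measurable S]setTI; exact: measurable_reverse.
rewrite -(liouville_reverse L m1) -!liouville_measureE.
rewrite -(fineK (nu_fin m3)) -(fineK (nu_fin m2)) -!bintegral_indic//; congr EFin.
(* Written as integrals of indicators, the two measures can be compared through the identity that
   holds only almost everywhere. *)
apply: ae_eq_bintegral; [exact: bounded_mfun_indic|exact: bounded_mfun_indic|].
have [N [mN N0 hN]] := rotation_reverse; exists N; split; [exact: mN|exact: N0|].
move=> z nz; apply: hN => /= e; apply: nz; rewrite /= !indicE.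
by congr (nat_of_bool _)%:R; apply/idP/idP; rewrite !inE /preimage/= e.
Qed.

(** The integrals of [rotation] and of [1 - rotation] agree by time reversal, and their sum is the
    total mass [2 * L]. *)
Lemma rotation_integral : liouville_integral L rotation = L%:E.
Proof.
pose w := liouville_density L.
have mw : measurable_fun setT w := @measurable_liouville_density R L.
have w0 z : 0 <= w z := liouville_density_ge0 L z.
have mr := measurable_rotation.
pose I (h : R * R -> R) := (\int[mu \x mu]_z (h z * w z)%:E)%E.
have -> : liouville_integral L rotation = I rotation.
  rewrite /liouville_integral /I integral_mkcond; apply: eq_integral => z _.
  rewrite patchE /w /liouville_density indicE; case: ifPn => _; first by rewrite mul1r.
  by rewrite mul0r mulr0.
pose r1 z := 1 - rotation z.
have mr1 : measurable_fun setT r1 by apply: measurable_funB => //; exact: measurable_cst.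
have r0 z : 0 <= rotation z by have /andP[] := rotation_bounds z.
have r10 z : 0 <= r1 z by have := rotation_bounds z; rewrite /r1; lra.
have mm (h : R * R -> R) : measurable_fun setT h ->
    measurable_fun setT (fun z => (h z * w z)%:E).
  by move=> mh; apply/measurable_EFinP; exact: measurable_funM.
have sum : (I rotation + I r1 = (2 * L)%:E)%E.
  rewrite -liouville_Phi// -ge0_integralD//.
  - rewrite /liouville setIid [RHS]integral_mkcond; apply: eq_integral => z _.
    rewrite patchE -EFinD -mulrDl /r1 addrCA subrr addr0 mul1r.
    by rewrite /w /liouville_density indicE; case: ifPn => _; rewrite ?mul1r ?mul0r.
  - by move=> z _; rewrite lee_fin mulr_ge0.
  - exact: mm.
  - by move=> z _; rewrite lee_fin mulr_ge0.
  - exact: mm.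
have eqI : I rotation = I r1.
  rewrite -[LHS](reverse_integral L mr r0).
  have [N [mN N0 hN]] := rotation_reverse.
  have mrr : measurable_fun setT (fun z => rotation (reverse z)).
    exact: (measurableT_comp mr (@measurable_reverse R)).
  apply: ae_eq_integral.
  - exact: measurableT.
  - exact: (mm _ mrr).
  - exact: (mm _ mr1).
  (* A Liouville-null set need not be null for the product Lebesgue measure, but the weight vanishes
     almost everywhere on it, and both integrands carry this weight. *)
  - have w_ae : {ae (mu \x mu)%E, forall z, N z -> w z = 0}.
      have mwN : measurable_fun N (EFin \o w).
        by apply/measurable_EFinP; exact: measurable_funTS.
      have /(ae_eq_integral_abs _ mN mwN) : (\int[mu \x mu]_(z in N) `|(EFin \o w) z| = 0)%E.
        rewrite -[RHS]N0; apply: eq_integral => z _.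
        by rewrite /= ger0_norm.
      by apply: filterS => z h /h[].
    apply: filterS w_ae => z hz _; have [Nz|nNz] := pselect (N z).
      have e0 : liouville_density L z = 0 := hz Nz.
      by rewrite /w e0 !mulr0.
    have -> : rotation (reverse z) = r1 z by apply: contrapT => h; apply: nNz; exact: hN.
    by [].
have : (I rotation + I rotation = (2 * L)%:E)%E by rewrite {2}eqI.
have : (0 <= I rotation)%E by apply: integral_ge0 => z _; rewrite lee_fin mulr_ge0.
case: (I rotation) => [a| |]//= _; rewrite -EFinD => -[]; move=> e; congr EFin; lra.
Qed.

End rotation.

(** * The three claims *)

Theorem theorem2p3 (R : realType) (L : R) (x y : R -> R) (Om : set (R * R)) :
  billiard_table L x y Om ->
  (* (1) *)
  (forall X : set R, measurable X -> X `<=` `[0, 1] ->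
     [/\ measurable (Phi L `&` rotation_number L x y Om @^-1` X),
         measurable (Phi L `&` rotation_number L x y Om @^-1`
                       ((fun t : R => 1 - t) @` X)) &
         liouville L (Phi L `&` rotation_number L x y Om @^-1` X) =
         liouville L (Phi L `&` rotation_number L x y Om @^-1`
                       ((fun t : R => 1 - t) @` X))]) /\
  (* (2) *)
  (liouville_integral L (rotation_number L x y Om) * (liouville L (Phi L))^-1
     = (2^-1 : R)%:E)%E /\
  (* (3) *)
  (billiard_ergodic L x y Om ->
     liouville L (Phi L `&` [set z | rotation_number L x y Om z != 2^-1]) = 0%E).
Proof.
move=> table; have [[L0 _ _ _ _] [n [b pieces]] _ _ _] := table.
pose r := rotation L x y Om.
have rE z : Phi L z -> rotation_number L x y Om z = r z.
  by move=> Pz; exact: (rotation_numberE table).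
have mP : measurable (Phi L) by apply: measurableX; exact: measurable_itv.
have mr : measurable_fun setT r := measurable_rotation table pieces.
have preE B : Phi L `&` rotation_number L x y Om @^-1` B = Phi L `&` r @^-1` B.
  by apply/seteqP; split => z [Pz]; rewrite /preimage/= rE.
have mpre (B : set R) : measurable B -> measurable (Phi L `&` r @^-1` B).
  by move=> mB; apply: measurableI => //; rewrite -[S in measurable S]setTI; exact: mr.
have liouI A : liouville L (Phi L `&` A) = liouville L A.
  by rewrite /liouville setIC setIA setIid setIC.
have sym (B : set R) : measurable B -> liouville L (Phi L `&` r @^-1` B) =
    liouville L (Phi L `&` r @^-1` ((fun t => 1 - t) @^-1` B)).
  by move=> mB; rewrite !liouI; exact: (rotation_symmetric table pieces mB).
split; [|split].
- move=> B mB _.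
  have -> : (fun t : R => 1 - t) @` B = (fun t => 1 - t) @^-1` B.
    apply/seteqP; split => [_ [t Bt <-]|t Bt]; first by rewrite /= opprB addrC subrK.
    by exists (1 - t) => //; rewrite opprB addrC subrK.
  rewrite !preE; split; [exact: mpre| |exact: sym].
  by apply: mpre; rewrite -[S in measurable S]setTI; exact: measurable_one_sub.
- have -> : liouville_integral L (rotation_number L x y Om) = L%:E.
    rewrite -[RHS](rotation_integral table pieces); apply: eq_integral => z.
    by rewrite inE => /rE ->.
  rewrite liouville_Phi// inver gt_eqF ?mulr_gt0// -EFinM; congr EFin.
  by field; rewrite gt_eqF.
(* The sets [A] and [B] where the rotation number is below and above [1 / 2] have equal measure by
   the symmetry. [A] is invariant, hence null or of null complement; in the latter case [B], being
   contained in the complement, is null, so either way both are null. *)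
- move=> erg; pose A := Phi L `&` r @^-1` `]-oo, 2^-1[.
  pose B := Phi L `&` r @^-1` `]2^-1, +oo[.
  have mA : measurable A by apply: mpre; exact: measurable_itv.
  have mB : measurable B by apply: mpre; exact: measurable_itv.
  have AB : liouville L A = liouville L B.
    rewrite /A sym; last exact: measurable_itv.
    congr (liouville L (_ `&` _)); apply/seteqP; split => z /=; rewrite !in_itv/= andbT; lra.
  have invA : Phi L `&` billiard_map L x y Om @^-1` A = A.
    apply/seteqP; split => z [Pz]; rewrite /preimage /= => h; split => //.
      by case: h => _; rewrite /= /r (rotation_invariant table).
    by split; [exact: (billiard_map_Phi table)|rewrite /= /r (rotation_invariant table)].
  have A0 : liouville L A = 0%E.
    case: (erg A mA (@subIsetl _ _ _) invA) => // cA0; rewrite AB.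
    rewrite -liouville_measureE; apply: (@subset_measure0 _ _ _ (liouville_measure L) _
      (Phi L `\` A)).
    - exact: mB.
    - exact: (measurableD mP mA).
    - move=> z [Pz rz]; split => // -[_]; move: rz; rewrite /= !in_itv/= andbT; lra.
    - exact: (etrans (liouville_measureE L _) cA0).
  have -> : Phi L `&` [set z | rotation_number L x y Om z != 2^-1] = A `|` B.
    apply/seteqP; split => z; rewrite /A /B /=.
      move=> [Pz]; rewrite rE// neq_lt => /orP[h|h]; [left|right]; split => //;
        by rewrite in_itv/= ?andbT.
    by case=> -[Pz] /=; rewrite in_itv/= ?andbT => h; split => //;
      rewrite rE// neq_lt h ?orbT.
  rewrite -liouville_measureE; apply: null_set_setU.
  - exact: mA.
  - exact: mB.
  - exact: (etrans (liouville_measureE L _) A0).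
  - by apply: (etrans (liouville_measureE L _)); rewrite -AB.
Qed.
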